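(* Let $\Phi_1\in\mathcal C(A_0B_0,A_1B_1)$, $\Phi_2\in\mathcal C(A'_0B_0,A'_1B_1)$ and $\epsilon\ge0$. The following are equivalent. (i) $\delta_{A|A'}(\Phi_1\|\Phi_2)\le\epsilon$. (ii) For all finite-dimensional systems $R_0,R_1$ and every $\rho\in\mathfrak S(R_0B_0R_1B_1)$, $$\sup_{\Theta\in\mathcal C_2(A',R)}\langle\rho,(\Theta\otimes\mathrm{id}_B)(\Phi_2)\rangle\le\sup_{\Theta\in\mathcal C_2(A,R)}\langle\rho,(\Theta\otimes\mathrm{id}_B)(\Phi_1)\rangle+\frac{\epsilon}{2}\|\rho\|^\diamond_{R_1B_1|R_0B_0}.$$ (iii) For all systems $R_0,R_1$, all $k,l\in\mathbb N$, every ensemble $\mathcal E=\{\lambda_{i,j},\rho_{i,j}\}_{i\le k,j\le l}$ on $R_0B_0R_1B_1$ and every fixed measurement $M\in\mathcal M_l(B_1B_1)$, $$P^{M}_{\Phi_2,k}(\mathcal E)\le P^{M}_{\Phi_1,k}(\mathcal E)+\frac{\epsilon}{2}P_{\rm succ}(\mathcal E).$$ Moreover, (i) is also equivalent to (ii), resp. (iii), required only for $R_0=A'_0$, $R_1=A'_1$.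
   Context: Finite-dimensional systems; $\mathcal C(X,Y)$ channels; $\mathcal M_k(X)$ measurements with $k$ outcomes on $X$; $\|\cdot\|_\diamond$ diamond norm. $B=B_0B_1$ is fixed. For $A=A_0A_1$, $A'=A'_0A'_1$, $\mathcal C_2(A,A')$ is the set of superchannels $\Theta$ given by an ancilla $U$, $\Theta_{\rm pre}\in\mathcal C(A'_0,UA_0)$, $\Theta_{\rm post}\in\mathcal C(UA_1,A'_1)$; for $\Phi\in\mathcal C(A_0B_0,A_1B_1)$, $(\Theta\otimes\mathrm{id}_B)(\Phi)=(\Theta_{\rm post}\otimes\mathrm{id}_{B_1})\circ(\mathrm{id}_U\otimes\Phi)\circ(\Theta_{\rm pre}\otimes\mathrm{id}_{B_0})\in\mathcal C(A'_0B_0,A'_1B_1)$. $\delta_{A|A'}(\Phi_1\|\Phi_2)=\min_{\Theta\in\mathcal C_2(A,A')}\|(\Theta\otimes\mathrm{id}_B)(\Phi_1)-\Phi_2\|_\diamond$. In (ii), $R=R_0R_1$. For $X\in\mathcal B_h(S_0S_1)$ and $\phi\in\mathcal L(S_0,S_1)$, $\langle X,\phi\rangle={\rm Tr}[XC_{\phi^*}]$ with Choi matrix $C_\psi=(\psi\otimes\mathrm{id})(|I\rangle\rangle\langle\langle I|)$ and $\phi^*$ the adjoint; $\|\rho\|^\diamond_{S_1|S_0}=\max_{\alpha\in\mathcal C(S_0,S_1)}\langle\rho,\alpha\rangle$. $P_{\rm succ}(\mathcal E,M)=\sum\lambda_{i}{\rm Tr}[\rho_iM_i]$, $P_{\rm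 succ}(\mathcal E)=\max_MP_{\rm succ}(\mathcal E,M)$. For $\Phi\in\mathcal C(A''_0B_0,A''_1B_1)$, $P^M_{\Phi,k}(\mathcal E)$ is the supremum over ancillas $U$, preprocessings $\alpha\in\mathcal C(R_0,A''_0U)$ and measurements $N\in\mathcal M_k(UA''_1R_1)$ of $\sum_{i,j}\lambda_{i,j}{\rm Tr}\big[\big(((\mathrm{id}_U\otimes\Phi)\circ(\alpha\otimes\mathrm{id}_{B_0}))\otimes\mathrm{id}_{R_1B_1}\big)(\rho_{i,j})\,(N_i\otimes M_j)\big]$, where $\alpha$ acts on the $R_0$ part of the ensemble, $B_0$ of the ensemble is fed into $\Phi$, $N$ measures $UA''_1R_1$ and $M$ measures the output $B_1$ of $\Phi$ together with the $B_1$ part of the ensemble. *)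

(* Defs.v *)
From HB Require Import structures.
From mathcomp Require Import all_boot all_order all_algebra.
From mathcomp Require Import complex mxtens.
From mathcomp Require Import classical_sets reals constructive_ereal ereal.

Set Implicit Arguments.
Unset Strict Implicit.
Unset Printing Implicit Defensive.

Import Order.TTheory GRing.Theory Num.Theory.
Local Open Scope ring_scope.
Local Open Scope classical_set_scope.
Local Open Scope complex_scope.

Section QuantumDefs.
Variable R : realType.
Local Notation C := R[i].

(* A finite-dimensional system is given by its dimension; a composite
   system XY has dimension (dim X * dim Y), with the Kronecker (mxtens)
   index convention. *)

Definition adjmx m n (A : 'M[C]_(m, n)) : 'M[C]_(n, m) := (map_mx Num.conj A)^T.

Definition psd n (A : 'M[C]_n) : Prop :=
  forall v : 'cV[C]_n, 0 <= (adjmx v *m A *m v) 0 0.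

Definition density n (rho : 'M[C]_n) : Prop := psd rho /\ \tr rho = 1.

Definition unitary n (U : 'M[C]_n) : Prop := U *m adjmx U = 1%:M.

Definition lmap (n m : nat) := 'M[C]_n -> 'M[C]_m.

Definition idmap n : lmap n n := fun X => X.

(* tensor product f (x) g of maps: defined on matrix units and extended
   linearly *)
Definition tmap n1 m1 n2 m2 (f : lmap n1 m1) (g : lmap n2 m2)
  : lmap (n1 * n2) (m1 * m2) :=
  fun X => \sum_(i < n1 * n2) \sum_(j < n1 * n2)
    X i j *: (f (delta_mx (mxtens_unindex i).1 (mxtens_unindex j).1)
             *t g (delta_mx (mxtens_unindex i).2 (mxtens_unindex j).2)).

Definition CP n m (f : lmap n m) : Prop :=
  forall k (X : 'M[C]_(n * k)), psd X -> psd (tmap f (@idmap k) X).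

Definition TP n m (f : lmap n m) : Prop := forall X, \tr (f X) = \tr X.

Definition channel n m (f : lmap n m) : Prop :=
  linear f /\ CP f /\ TP f.

Definition measurement (I : finType) n (M : I -> 'M[C]_n) : Prop :=
  (forall i, psd (M i)) /\ \sum_i M i = 1%:M.

Definition ensemble (I : finType) n (lam : I -> R) (rho : I -> 'M[C]_n) : Prop :=
  [/\ forall i, 0 <= lam i, \sum_i lam i = 1 & forall i, density (rho i)].

(* Choi matrix C_psi = (psi (x) id)(|I>><<I|) = sum_ij psi(E_ij) (x) E_ij *)
Definition choi n m (f : lmap n m) : 'M[C]_(m * n) :=
  \sum_(i < n) \sum_(j < n) (f (delta_mx i j) *t delta_mx i j).

(* Hilbert-Schmidt adjoint: Tr[phi*(Y)^dag X] = Tr[Y^dag phi(X)] *)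
Definition adjmap n m (f : lmap n m) : lmap m n :=
  fun Y => \sum_(i < n) \sum_(j < n)
    \tr (adjmx (f (delta_mx i j)) *m Y) *: delta_mx i j.

Definition pairing s0 s1 (X : 'M[C]_(s0 * s1)) (f : lmap s0 s1) : C :=
  \tr (X *m choi (adjmap f)).

(* trace norm ||X||_1 = max_{U unitary} |Tr(U X)| *)
Definition tnorm n (X : 'M[C]_n) : \bar R :=
  ereal_sup [set t | exists U : 'M[C]_n, unitary U /\ t = (complex.Re `|\tr (U *m X)|)%:E].

Definition dnorm n m (D : lmap n m) : \bar R :=
  ereal_sup [set t | exists k (X : 'M[C]_(n * k)),
    (tnorm X <= 1)%E /\ t = tnorm (tmap D (@idmap k) X)].

(* (Theta (x) id_B)(Phi) for Theta given by ancilla U, pre, post *)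
Definition supch_apply a0 a1 a0' a1' b0 b1 u
  (pre : lmap a0' (u * a0)) (post : lmap (u * a1) a1')
  (Phi : lmap (a0 * b0) (a1 * b1)) : lmap (a0' * b0) (a1' * b1) :=
  fun X => tmap post (@idmap b1)
    (castmx (mulnA u a1 b1, mulnA u a1 b1)
      (tmap (@idmap u) Phi
        (castmx (esym (mulnA u a0 b0), esym (mulnA u a0 b0))
          (tmap pre (@idmap b0) X)))).

Definition superch_outputs a0 a1 a0' a1' b0 b1 (Phi : lmap (a0 * b0) (a1 * b1))
  : set (lmap (a0' * b0) (a1' * b1)) :=
  [set Psi | exists u (pre : lmap a0' (u * a0)) (post : lmap (u * a1) a1'),
     [/\ (0 < u)%N, channel pre, channel post & Psi = @supch_apply a0 a1 a0' a1' b0 b1 u pre post Phi]].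

Definition deltaAA a0 a1 a0' a1' b0 b1
  (Phi1 : lmap (a0 * b0) (a1 * b1)) (Phi2 : lmap (a0' * b0) (a1' * b1)) : \bar R :=
  ereal_inf [set t | exists Psi, @superch_outputs a0 a1 a0' a1' b0 b1 Phi1 Psi /\
                       t = dnorm (fun X => Psi X - Phi2 X)].

Definition sup_pairing a0 a1 r0 r1 b0 b1
  (rho : 'M[C]_((r0 * b0) * (r1 * b1))) (Phi : lmap (a0 * b0) (a1 * b1)) : \bar R :=
  ereal_sup [set t | exists Psi, @superch_outputs a0 a1 r0 r1 b0 b1 Phi Psi /\
                       t = (complex.Re (pairing rho Psi))%:E].

Definition dual_dnorm s0 s1 (rho : 'M[C]_(s0 * s1)) : \bar R :=
  ereal_sup [set t | exists alpha : lmap s0 s1, channel alpha /\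
                       t = (complex.Re (pairing rho alpha))%:E].

Definition psucc_with (I : finType) n (lam : I -> R) (rho : I -> 'M[C]_n)
  (M : I -> 'M[C]_n) : R :=
  complex.Re (\sum_i (lam i)%:C * \tr (rho i *m M i)).

Definition psucc (I : finType) n (lam : I -> R) (rho : I -> 'M[C]_n) : \bar R :=
  ereal_sup [set t | exists M : I -> 'M[C]_n, measurement M /\
                       t = (psucc_with lam rho M)%:E].

Definition reorder_idx u a1 b1 r1 :
  'I_((u * (a1 * b1)) * (r1 * b1)) -> 'I_(((u * a1) * r1) * (b1 * b1)) :=
  fun p =>
    let xy := mxtens_unindex p in
    let ua := mxtens_unindex xy.1 in
    let ab := mxtens_unindex ua.2 in
    let rb := mxtens_unindex xy.2 in
    mxtens_index (mxtens_index (mxtens_index (ua.1, ab.1), rb.1),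
                  mxtens_index (ab.2, rb.2)).

Definition reindex p q (f : 'I_p -> 'I_q) (Z : 'M[C]_q) : 'M[C]_p :=
  \matrix_(i, j) Z (f i) (f j).

Definition PM a0 a1 b0 b1 r0 r1 k l (Phi : lmap (a0 * b0) (a1 * b1))
  (M : 'I_l -> 'M[C]_(b1 * b1)) (lam : 'I_k * 'I_l -> R)
  (rho : 'I_k * 'I_l -> 'M[C]_((r0 * b0) * (r1 * b1))) : \bar R :=
  ereal_sup [set t | exists u (alpha : lmap r0 (u * a0))
                        (N : 'I_k -> 'M[C]_((u * a1) * r1)),
    [/\ (0 < u)%N, channel alpha, measurement N &
     t = (complex.Re (\sum_(ij : 'I_k * 'I_l) (lam ij)%:C *
           \tr (tmap (fun Y => tmap (@idmap u) Phi
                        (castmx (esym (mulnA u a0 b0), esym (mulnA u a0 b0))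
                           (tmap alpha (@idmap b0) Y)))
                     (@idmap (r1 * b1)) (rho ij)
                *m reindex (@reorder_idx u a1 b1 r1) (N ij.1 *t M ij.2))))%:E]].

End QuantumDefs.

(* Main.v *)
Require Import Defs.
From HB Require Import structures.
From mathcomp Require Import all_boot all_order all_algebra.
From mathcomp Require Import complex mxtens spectral sesquilinear.
From mathcomp Require Import boolp classical_sets reals constructive_ereal ereal.
From mathcomp Require Import ring lra.
Set Implicit Arguments.
Unset Strict Implicit.
Unset Printing Implicit Defensive.
Import Order.TTheory GRing.Theory Num.Theory.
Local Open Scope ring_scope.
Local Open Scope complex_scope.

(**
  For a difference [D] of channels, half the diamond norm of [D] is the largest
  value of [Tr (D (x) id)(w) P] over states [w] and effects [0 <= P <= 1]
  ([test_bound]), equivalently the largest pairing [<T, D>] with a test operator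
  [0 <= T <= sigma (x) 1]. As [|rho|^diamond <= p] amounts to
  [rho <= p sigma (x) 1] for some state [sigma], this gives
  [<rho, D> <= |D|_diamond / 2 * |rho|^diamond], and (i) implies (ii) and (iii)
  because superchannels compose and do not increase the diamond norm; for (iii),
  an ensemble is a classical-quantum state whose dual norm is [P_succ].

  Conversely, the outputs of superchannels applied to [Phi1] form a convex set
  (direct sums of ancillas), so a minimax argument over this set and the test
  operators reduces (i) to the existence, for each test operator [T], of an output
  [Psi] with [<T, Phi2 - Psi> <= eps / 2]. This is (ii) for [rho] proportional to
  [T]. For (iii), twirl [rho] by unitary 1-designs on [R1] and [B1] and let [M] be
  the corresponding measurement built from the maximally entangled state: then
  measurements [N] of the player correspond to post-processing channels, and all
  terms of (iii) are those of (ii) multiplied by a common factor.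
*)

(** * Positive semidefinite matrices *)

(** Nothing is assumed to be attained. Ancillas have unbounded dimension and closedness of the set
    of outputs is never established, so [deltaAA] is used only as an infimum: every implication
    carries a positive slack, and the minimax theorem is approximate, needing only convexity and
    boundedness of two sets of matrices. To get a bounded set in one fixed dimension, the reference
    system has to be eliminated: [link] contracts a state and an effect, with any ancilla, into one
    operator on input and output.

    The factor 1/2 comes from writing an effect as P = (U + U^dag)/4 + 1/2 with U unitary: the
    identity part pairs to zero with a trace-annihilating map. The converse estimate is the harder
    one, because [dnorm] ranges over non-Hermitian inputs; these are placed as an off-diagonal block
    of a positive matrix on a doubled ancilla.

    In [pairing_bound] the dominating operator must be inverted. The error term of the approximate
    minimax theorem, a small multiple of the identity, is exactly what makes it invertible. *)

Section MatrixBasics.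
Variable R : realType.
Local Notation C := R[i].
Local Notation Re := complex.Re.

Lemma ReD (x y : C) : Re (x + y) = Re x + Re y.
Proof. by case: x; case: y. Qed.

Lemma ReN (x : C) : Re (- x) = - Re x.
Proof. by case: x. Qed.

Lemma ReB (x y : C) : Re (x - y) = Re x - Re y.
Proof. by rewrite ReD ReN. Qed.

Lemma Re_sum (I : Type) (s : seq I) (P : pred I) (F : I -> C) :
  Re (\sum_(i <- s | P i) F i) = \sum_(i <- s | P i) Re (F i).
Proof. by elim/big_rec2: _ => // i x y _ <-; rewrite ReD. Qed.

Lemma ReZ (a : R) (x : C) : Re (a%:C * x) = a * Re x.
Proof. by case: x => x y /=; rewrite mul0r subr0. Qed.

Lemma ReJ (x : C) : Re (Num.conj x) = Re x.
Proof. by case: x. Qed.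

Lemma conj_RC (a : R) : Num.conj a%:C = a%:C :> C.
Proof. exact: conjc_real. Qed.

Lemma ge0_Re (x : C) : 0 <= x -> 0 <= Re x.
Proof. by rewrite lecE => /andP[]. Qed.

Lemma ge0_ReE (x : C) : 0 <= x -> x = (Re x)%:C.
Proof. by move=> /ger0_real /RRe_real. Qed.

Lemma le_Re_norm (x : C) : Re x <= Re `|x|.
Proof.
rewrite normc_def /=; case: x => a b /=.
apply: (le_trans (ler_norm a)); rewrite -sqrtr_sqr ler_wsqrtr //.
by rewrite lerDl sqr_ge0.
Qed.

Lemma normC_phase (x : C) : exists2 z : C, z * Num.conj z = 1 & z * x = `|x|.
Proof.
have [->|x0] := eqVneq x 0.
  by exists 1; rewrite ?mul1r ?normr0 ?rmorph1 // mulr1.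
exists (Num.conj x / `|x|).
  have -> : Num.conj (Num.conj x / `|x|) = x / `|x|.
    rewrite rmorphM fmorphV /= conjCK; congr (_ / _).
    by apply: conj_Creal; exact: normr_real.
  rewrite mulrACA [_ * x]mulrC -normCK expr2.
  by rewrite mulrACA divff ?mulr1 // normr_eq0.
by rewrite mulrAC [_ * x]mulrC -normCK expr2 mulfK // normr_eq0.
Qed.

Lemma mxDE m n (A B : 'M[C]_(m, n)) i j : (A + B) i j = A i j + B i j.
Proof. by rewrite mxE. Qed.

Lemma mxNE m n (A : 'M[C]_(m, n)) i j : (- A) i j = - A i j.
Proof. by rewrite mxE. Qed.

Lemma mxZE m n a (A : 'M[C]_(m, n)) i j : (a *: A) i j = a * A i j.
Proof. by rewrite mxE. Qed.

Lemma adjmxE m n (A : 'M[C]_(m, n)) i j : adjmx A i j = Num.conj (A j i).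
Proof. by rewrite !mxE. Qed.

Lemma adjmxK m n (A : 'M[C]_(m, n)) : adjmx (adjmx A) = A.
Proof. by apply/matrixP => i j; rewrite !adjmxE conjCK. Qed.

Lemma adjmxM m n p (A : 'M[C]_(m, n)) (B : 'M[C]_(n, p)) :
  adjmx (A *m B) = adjmx B *m adjmx A.
Proof. by rewrite /adjmx map_mxM trmx_mul. Qed.

Lemma adjmxD m n (A B : 'M[C]_(m, n)) : adjmx (A + B) = adjmx A + adjmx B.
Proof. by apply/matrixP => i j; rewrite !(adjmxE, mxE) rmorphD. Qed.

Lemma adjmxN m n (A : 'M[C]_(m, n)) : adjmx (- A) = - adjmx A.
Proof. by apply/matrixP => i j; rewrite !(adjmxE, mxE) rmorphN. Qed.

Lemma adjmxZ m n (a : C) (A : 'M[C]_(m, n)) :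
  adjmx (a *: A) = Num.conj a *: adjmx A.
Proof. by apply/matrixP => i j; rewrite !(adjmxE, mxE) rmorphM. Qed.

Lemma adjmx_sum m n (I : Type) (s : seq I) (P : pred I) (F : I -> 'M[C]_(m, n)) :
  adjmx (\sum_(i <- s | P i) F i) = \sum_(i <- s | P i) adjmx (F i).
Proof.
apply: (big_morph (@adjmx R m n)); first exact: adjmxD.
by apply/matrixP => i j; rewrite !(adjmxE, mxE) rmorph0.
Qed.

Lemma adjmx1 n : adjmx (1%:M : 'M[C]_n) = 1%:M.
Proof. by apply/matrixP => i j; rewrite !(adjmxE, mxE) eq_sym rmorph_nat. Qed.

Lemma adjmx_tens m n p q (A : 'M[C]_(m, n)) (B : 'M[C]_(p, q)) :
  adjmx (A *t B) = adjmx A *t adjmx B.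
Proof. by rewrite /adjmx map_mxT trmx_tens. Qed.

Lemma tr_adjmx n (A : 'M[C]_n) : \tr (adjmx A) = Num.conj (\tr A).
Proof.
rewrite /mxtrace rmorph_sum /=; apply: eq_bigr => i _; exact: adjmxE.
Qed.

(* A plain constant: rewriting under the record projection [Re] is slow. *)
Definition retr n (A : 'M[C]_n) : R := Re (\tr A).

Lemma retrD n (A B : 'M[C]_n) : retr (A + B) = retr A + retr B.
Proof. by rewrite /retr mxtraceD ReD. Qed.

Lemma retrN n (A : 'M[C]_n) : retr (- A) = - retr A.
Proof. by rewrite /retr raddfN /= ReN. Qed.

Lemma retrB n (A B : 'M[C]_n) : retr (A - B) = retr A - retr B.
Proof. by rewrite retrD retrN. Qed.

Lemma retrZ n (a : R) (A : 'M[C]_n) : retr (a%:C *: A) = a * retr A.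
Proof. by rewrite /retr mxtraceZ ReZ. Qed.

Lemma retr_sum n (I : Type) (s : seq I) (P : pred I) (F : I -> 'M[C]_n) :
  retr (\sum_(i <- s | P i) F i) = \sum_(i <- s | P i) retr (F i).
Proof.
elim/big_rec2: _ => [|i x A _ <-]; last by rewrite retrD.
by rewrite /retr mxtrace0.
Qed.

Lemma retr_adj n (A : 'M[C]_n) : retr (adjmx A) = retr A.
Proof. by rewrite /retr tr_adjmx ReJ. Qed.

Lemma retrC m n (A : 'M[C]_(m, n)) (B : 'M[C]_(n, m)) : retr (A *m B) = retr (B *m A).
Proof. by rewrite /retr mxtrace_mulC. Qed.

Lemma unitaryC n (U : 'M[C]_n) : unitary U -> adjmx U *m U = 1%:M.
Proof. exact: mulmx1C. Qed.

Lemma unitary_adj n (U : 'M[C]_n) : unitary U -> unitary (adjmx U).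
Proof. by move=> hU; rewrite /unitary adjmxK unitaryC. Qed.

Lemma psd_gram n m (B : 'M[C]_(n, m)) : psd (B *m adjmx B).
Proof.
move=> v; rewrite mulmxA -[_ *m B]adjmxK adjmxM adjmxK -mulmxA mxE.
by apply: sumr_ge0 => i _; rewrite adjmxE mulrC; exact: mul_conjC_ge0.
Qed.

Lemma psd_gramC n m (B : 'M[C]_(m, n)) : psd (adjmx B *m B).
Proof. by rewrite -[X in _ *m X]adjmxK; exact: psd_gram. Qed.

Lemma psd_conj n m (K : 'M[C]_(m, n)) (A : 'M[C]_n) :
  psd A -> psd (K *m A *m adjmx K).
Proof. by move=> hA v; have := hA (adjmx K *m v); rewrite adjmxM adjmxK !mulmxA. Qed.

Lemma psd_conjC n m (K : 'M[C]_(n, m)) (A : 'M[C]_n) :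
  psd A -> psd (adjmx K *m A *m K).
Proof. by move=> hA; rewrite -[X in _ *m X]adjmxK; exact: psd_conj. Qed.

Lemma psd0 n : psd (0 : 'M[C]_n).
Proof. by move=> v; rewrite mulmx0 mul0mx mxE. Qed.

Lemma psdD n (A B : 'M[C]_n) : psd A -> psd B -> psd (A + B).
Proof. by move=> hA hB v; rewrite mulmxDr mulmxDl mxE addr_ge0. Qed.

Lemma psdZ n (a : C) (A : 'M[C]_n) : 0 <= a -> psd A -> psd (a *: A).
Proof. by move=> a0 hA v; rewrite -scalemxAr -scalemxAl mxE mulr_ge0. Qed.

Lemma psd_sum n (I : Type) (s : seq I) (P : pred I) (F : I -> 'M[C]_n) :
  (forall i, P i -> psd (F i)) -> psd (\sum_(i <- s | P i) F i).
Proof.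
by move=> h; apply: (@big_ind _ (@psd R n)); [exact: psd0|exact: psdD|exact: h].
Qed.

Lemma psd1 n : psd (1%:M : 'M[C]_n).
Proof. by rewrite -[1%:M]mulmx1 -[X in _ *m X]adjmx1; exact: psd_gram. Qed.

Lemma quad_form n (A : 'M[C]_n) (u v : 'cV[C]_n) :
  (adjmx u *m A *m v) 0 0 = \sum_i \sum_j Num.conj (u i 0) * A i j * v j 0.
Proof.
rewrite mxE exchange_big /=; apply: eq_bigr => j _; rewrite mxE mulr_suml.
by apply: eq_bigr => i _; rewrite adjmxE.
Qed.

(** Polarisation on two coordinates: z = 1 and z = i force Hermitian symmetry in [psd_herm], and a
    phase aligned with [A i j] bounds that entry in [psd_entry_le]. *)
Lemma quad_form2 n (A : 'M[C]_n) i j (z : C) : i != j ->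
  (adjmx (delta_mx i 0 + z *: delta_mx j 0 : 'cV[C]_n) *m A
     *m (delta_mx i 0 + z *: delta_mx j 0 : 'cV[C]_n)) 0 0 =
  A i i + z * A i j + Num.conj z * A j i + Num.conj z * z * A j j.
Proof.
move=> ij.
have e (a b : 'I_n) (B : 'M[C]_n) :
    (adjmx (delta_mx a 0 : 'cV[C]_n) *m B *m (delta_mx b 0 : 'cV[C]_n)) 0 0 = B a b.
  rewrite quad_form (bigD1 a) //= (bigD1 b) //= !mxE !eqxx /= rmorph1 mulr1 mul1r.
  rewrite big1 ?addr0 => [|k kb]; last first.
    by rewrite !mxE (negbTE kb) mulr0.
  rewrite big1 ?addr0 // => k ka; rewrite big1 // => l _.
  by rewrite !mxE (negbTE ka) /= rmorph0 !mul0r.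
rewrite adjmxD adjmxZ !mulmxDl !mulmxDr -!scalemxAl -!scalemxAr.
have eD (P Q : 'M[C]_1) : (P + Q) 0 0 = P 0 0 + Q 0 0 by rewrite mxE.
have eZ a (P : 'M[C]_1) : (a *: P) 0 0 = a * P 0 0 by rewrite mxE.
by rewrite !(eD, eZ) !e; ring.
Qed.

Lemma psd_diag_ge0 n (A : 'M[C]_n) i : psd A -> 0 <= A i i.
Proof.
move=> /(_ (delta_mx i 0)); rewrite quad_form (bigD1 i) //= (bigD1 i) //=.
rewrite !mxE !eqxx /= rmorph1 mulr1 mul1r big1 ?addr0 => [|k kb]; last first.
  by rewrite !mxE (negbTE kb) mulr0.
rewrite big1 ?addr0 // => k ka; rewrite big1 // => l _.
by rewrite !mxE (negbTE ka) /= rmorph0 !mul0r.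
Qed.

(** In the complex order [0 <= x] includes that x is real, so symmetry need not be part of [psd]:
    the imaginary part of the quadratic form vanishes at two test vectors, which determines [A j i]
    from [A i j]. *)
Lemma psd_herm n (A : 'M[C]_n) : psd A -> adjmx A = A.
Proof.
move=> hA; apply/matrixP => i j; rewrite adjmxE.
have [->|ij] := eqVneq i j.
  by rewrite conj_Creal // ger0_real // psd_diag_ge0.
have h z := ger0_Im (eq_ind _ (fun x : C => 0 <= x) (hA _) _ (quad_form2 A z ij)).
have d k := ger0_Im (psd_diag_ge0 k hA).
have := h 1; have := h 'i%C; move: (d i) (d j).
case: (A i i) (A i j) (A j i) (A j j) => [a a'] [b b'] [c c'] [e e'] /= -> ->.
rewrite /= => h1 h2; apply/eqP; rewrite eq_complex /=; apply/andP; split; lra.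
Qed.

Lemma psd_hermsym n (A : 'M[C]_n) : psd A -> A \is hermsymmx.
Proof.
move=> /psd_herm hA; apply/is_hermitianmxP; rewrite expr0 scale1r.
by rewrite -[LHS]hA /adjmx map_trmx.
Qed.

Lemma psd_spectral n (A : 'M[C]_n) : psd A ->
  exists (U : 'M[C]_n) (d : 'I_n -> R),
    [/\ unitary U, forall i, 0 <= d i &
        A = adjmx U *m diag_mx (\row_i (d i)%:C) *m U].
Proof.
move=> hA; have hn := hermitian_normalmx (psd_hermsym hA).
have uU := spectral_unitarymx A.
have AE := elimT (@orthomx_spectralP _ _ A) hn; rewrite (invmx_unitary uU) in AE.
move: (spectralmx A) (spectral_diag A) uU AE => U d uU AE0.
have uU' : unitary U.
  by move/unitarymxP: uU; rewrite /unitary /adjmx map_trmx.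
have AE : A = adjmx U *m diag_mx d *m U.
  by rewrite [LHS]AE0 /adjmx map_trmx.
move=> {AE0}; have dE : diag_mx d = U *m A *m adjmx U.
  by rewrite AE !mulmxA uU' mul1mx -mulmxA uU' mulmx1.
have d0 i : 0 <= d 0 i.
  have : psd (diag_mx d) by rewrite dE; exact: psd_conj.
  by move=> /psd_diag_ge0 => /(_ i); rewrite mxE eqxx.
exists U, (fun i => Re (d 0 i)); split => // [i|]; first exact: ge0_Re.
rewrite [LHS]AE; congr (_ *m diag_mx _ *m _).
by apply/rowP => i; rewrite mxE -ge0_ReE.
Qed.

Lemma adjmx_diag n (d : 'I_n -> C) :
  adjmx (diag_mx (\row_i d i)) = diag_mx (\row_i Num.conj (d i)).
Proof.
apply/matrixP => i j; rewrite adjmxE !mxE eq_sym; case: eqVneq => [->|_] //.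
by rewrite !mulr0n rmorph0.
Qed.

Lemma mul_diag_mx2 n (d e : 'I_n -> C) :
  diag_mx (\row_i d i) *m diag_mx (\row_i e i) = diag_mx (\row_i (d i * e i)).
Proof.
apply/matrixP => i j; rewrite mul_diag_mx !mxE.
by case: eqVneq => [->|_] //; rewrite !mulr0n mulr0.
Qed.

Lemma psd_sqrt n (A : 'M[C]_n) : psd A -> exists B : 'M[C]_n, A = B *m adjmx B.
Proof.
move=> /psd_spectral[U [d [uU d0 ->]]].
exists (adjmx U *m diag_mx (\row_i (Num.sqrt (d i))%:C)).
rewrite adjmxM adjmxK adjmx_diag -!mulmxA; congr (_ *m _); rewrite mulmxA.
congr (_ *m _); rewrite mul_diag_mx2; congr diag_mx; apply/rowP => i.
by rewrite !mxE conj_RC -rmorphM /= -expr2 sqr_sqrtr.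
Qed.

Lemma psd_tr_ge0 n (A : 'M[C]_n) : psd A -> 0 <= \tr A.
Proof. by move=> hA; apply: sumr_ge0 => i _; exact: psd_diag_ge0. Qed.

Lemma psd_trM_ge0 n (A B : 'M[C]_n) : psd A -> psd B -> 0 <= \tr (A *m B).
Proof.
move=> hA /psd_sqrt[K ->]; rewrite mulmxA mxtrace_mulC mulmxA.
exact/psd_tr_ge0/psd_conjC.
Qed.

(** With z the phase that turns [A i j] into its modulus, the vector e_i - z e_j gives 2|A i j| <= A
    i i + A j j. This crude estimate is behind all the boundedness hypotheses of the minimax
    theorem. *)
Lemma psd_entry_le n (A : 'M[C]_n) i j : psd A -> Re `|A i j| <= Re (\tr A).
Proof.
move=> hA.
have hd k : 0 <= Re (A k k) by exact/ge0_Re/psd_diag_ge0.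
have trE : Re (\tr A) = \sum_k Re (A k k) by rewrite Re_sum.
have [<-|ij] := eqVneq i j.
  rewrite ger0_norm ?psd_diag_ge0 // trE (bigD1 i) //= lerDl.
  by apply: sumr_ge0.
have hij : Re (A i i) + Re (A j j) <= Re (\tr A).
  rewrite trE (bigD1 i) //= lerD2l (bigD1 j) 1?eq_sym //= lerDl.
  by apply: sumr_ge0.
have [z z1 zA] := normC_phase (A i j).
have := ge0_Re (eq_ind _ (fun x : C => 0 <= x) (hA _) _ (quad_form2 A (- z) ij)).
have -> : A j i = Num.conj (A i j) by rewrite -adjmxE psd_herm.
rewrite rmorphN mulrNN [Num.conj z * z]mulrC z1 mul1r !mulNr zA -rmorphM zA /=.
rewrite !(ReD, ReN) ReJ.
change (Normc.normc (A i j)) with (Re `|A i j|).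
have : 0 <= Re `|A i j| by rewrite ge0_Re.
move: hij; lra.
Qed.

Lemma psd_tr0 n (A : 'M[C]_n) : psd A -> Re (\tr A) = 0 -> A = 0.
Proof.
move=> hA h; apply/matrixP => i j; rewrite mxE; apply/normr0_eq0.
rewrite (ge0_ReE (normr_ge0 _)).
suff -> : Re `|A i j| = 0 by [].
by apply/eqP; rewrite eq_le ge0_Re // andbT -h; exact: psd_entry_le.
Qed.

Lemma psd_tens m n (A : 'M[C]_m) (B : 'M[C]_n) : psd A -> psd B -> psd (A *t B).
Proof.
move=> /psd_sqrt[K ->] /psd_sqrt[L ->].
by rewrite -tensmx_mul -adjmx_tens; exact: psd_gram.
Qed.

(** [f] may be any map of indices: selecting or repeating rows of a Gram factor leaves a Gram
    matrix. Permutations of tensor factors and the diagonal blocks in [ptr_psd] are instances. *)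
Lemma psd_reindex p q (f : 'I_p -> 'I_q) (Z : 'M[C]_q) :
  psd Z -> psd (Defs.reindex f Z).
Proof.
move=> /psd_sqrt[B ->].
have -> : Defs.reindex f (B *m adjmx B) = rowsub f B *m adjmx (rowsub f B).
  by apply/matrixP => i j; rewrite !mxE; apply: eq_bigr => k _; rewrite !mxE.
exact: psd_gram.
Qed.

Lemma psd_cast p q (e e' : p = q) (Z : 'M[C]_p) : psd Z -> psd (castmx (e, e') Z).
Proof. by rewrite (eq_irrelevance e' e); case: q / e {e'} => hZ; rewrite castmx_id. Qed.

End MatrixBasics.

(** * Tensor products, Kraus decompositions and channels *)

Section Tensors.
Variable R : realType.
Local Notation C := R[i].
Local Notation Re := complex.Re.
Local Notation ix := mxtens_index.

Section LinearProp.
Variables (U V : lmodType C) (f : U -> V).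
Hypothesis hf : linear f.

(** Maps are bare functions with a propositional [linear], so the usual consequences are derived for
    an arbitrary such function. *)
Lemma lin0 : f 0 = 0.
Proof. by have := hf (-1) 0 0; rewrite scaler0 addr0 scaleN1r addNr. Qed.

Lemma linD u v : f (u + v) = f u + f v.
Proof. by have := hf 1 u v; rewrite !scale1r. Qed.

Lemma linZ a u : f (a *: u) = a *: f u.
Proof. by have := hf a u 0; rewrite lin0 !addr0. Qed.

Lemma linN u : f (- u) = - f u.
Proof. by rewrite -scaleN1r linZ scaleN1r. Qed.

Lemma linB u v : f (u - v) = f u - f v.
Proof. by rewrite linD linN. Qed.

Lemma lin_sum (I : Type) (s : seq I) (P : pred I) (F : I -> U) :
  f (\sum_(i <- s | P i) F i) = \sum_(i <- s | P i) f (F i).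
Proof. exact: (big_morph f linD lin0). Qed.

End LinearProp.

Lemma linear_subf (U V : lmodType C) (f g : U -> V) :
  linear f -> linear g -> linear (fun x => f x - g x).
Proof.
by move=> hf hg a u v; rewrite hf hg scalerBr opprD addrACA.
Qed.

Lemma big_mxtens (V : nmodType) m n (F : 'I_(m * n) -> V) :
  \sum_k F k = \sum_i \sum_j F (ix (i, j)).
Proof.
rewrite pair_big (reindex (fun p : 'I_m * 'I_n => ix p)) /=.
  by apply: eq_bigr => -[i j].
by exists (@mxtens_unindex m n) => k _; rewrite ?mxtens_indexK ?mxtens_unindexK.
Qed.

Lemma tensmx_linl m n p q a (A B : 'M[C]_(m, n)) (D : 'M[C]_(p, q)) :
  (a *: A + B) *t D = a *: (A *t D) + B *t D.
Proof. by apply/matrixP => i j; rewrite !mxE mulrDl mulrA. Qed.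

Lemma tensmx_linr m n p q a (D : 'M[C]_(m, n)) (A B : 'M[C]_(p, q)) :
  D *t (a *: A + B) = a *: (D *t A) + D *t B.
Proof. by apply/matrixP => i j; rewrite !mxE mulrDr mulrCA. Qed.

Lemma tensmxZl m n p q a (A : 'M[C]_(m, n)) (D : 'M[C]_(p, q)) :
  (a *: A) *t D = a *: (A *t D).
Proof. by apply/matrixP => i j; rewrite !mxE mulrA. Qed.

Lemma tensmxZr m n p q a (A : 'M[C]_(m, n)) (D : 'M[C]_(p, q)) :
  A *t (a *: D) = a *: (A *t D).
Proof. by apply/matrixP => i j; rewrite !mxE mulrCA. Qed.

Lemma tensmxDl m n p q (A B : 'M[C]_(m, n)) (D : 'M[C]_(p, q)) :
  (A + B) *t D = A *t D + B *t D.
Proof. by apply/matrixP => i j; rewrite !mxE mulrDl. Qed.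

Lemma tensmxDr m n p q (D : 'M[C]_(m, n)) (A B : 'M[C]_(p, q)) :
  D *t (A + B) = D *t A + D *t B.
Proof. by apply/matrixP => i j; rewrite !mxE mulrDr. Qed.

Lemma tensmxBl m n p q (A B : 'M[C]_(m, n)) (D : 'M[C]_(p, q)) :
  (A - B) *t D = A *t D - B *t D.
Proof. by apply/matrixP => i j; rewrite !mxE mulrBl. Qed.

Lemma tensmx_suml m n p q (I : Type) (s : seq I) (P : pred I)
    (F : I -> 'M[C]_(m, n)) (D : 'M[C]_(p, q)) :
  (\sum_(i <- s | P i) F i) *t D = \sum_(i <- s | P i) (F i *t D).
Proof.
apply: (big_morph (fun X => X *t D)) => [X Y|]; first exact: tensmxDl.
exact: tens0mx.
Qed.

Lemma tensmx_sumr m n p q (I : Type) (s : seq I) (P : pred I)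
    (D : 'M[C]_(p, q)) (F : I -> 'M[C]_(m, n)) :
  D *t (\sum_(i <- s | P i) F i) = \sum_(i <- s | P i) (D *t F i).
Proof.
apply: (big_morph (fun X => D *t X)) => [X Y|]; first exact: tensmxDr.
exact: tensmx0.
Qed.

Lemma tr_tens m n (A : 'M[C]_m) (B : 'M[C]_n) : \tr (A *t B) = \tr A * \tr B.
Proof.
rewrite /mxtrace big_mxtens mulr_suml; apply: eq_bigr => i _.
by rewrite mulr_sumr; apply: eq_bigr => j _; rewrite tensmxE.
Qed.

Lemma ix_eq m n (i j : 'I_m) (k l : 'I_n) :
  (ix (i, k) == ix (j, l)) = (i == j) && (k == l).
Proof. by rewrite (can_eq (@mxtens_indexK m n)). Qed.

Lemma mxtensP m n p q (A B : 'M[C]_(m * n, p * q)) :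
  (forall i j k l, A (ix (i, j)) (ix (k, l)) = B (ix (i, j)) (ix (k, l))) -> A = B.
Proof.
move=> h; apply/matrixP => a b.
by case: (mxtens_indexP a) => i j; case: (mxtens_indexP b) => k l.
Qed.

Lemma tens11 m n : (1%:M : 'M[C]_m) *t (1%:M : 'M[C]_n) = 1%:M.
Proof.
apply: mxtensP => i j k l; rewrite tensmxE !mxE ix_eq.
by case: eqP; case: eqP; rewrite ?mulr0 ?mul0r ?mulr1.
Qed.

Lemma delta_tens m n p q (i : 'I_m) (j : 'I_n) (k : 'I_p) (l : 'I_q) :
  (delta_mx i j : 'M[C]__) *t (delta_mx k l : 'M[C]__) =
  delta_mx (ix (i, k)) (ix (j, l)).
Proof.
apply: mxtensP => a b c d; rewrite tensmxE !mxE !ix_eq.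
by case: eqP; case: eqP; case: eqP; case: eqP; rewrite ?mulr0 ?mul0r ?mulr1.
Qed.

Lemma linear_ext_delta m n (V : lmodType C) (F G : 'M[C]_(m, n) -> V) :
  linear F -> linear G ->
  (forall i j, F (delta_mx i j) = G (delta_mx i j)) -> F =1 G.
Proof.
move=> lF lG h X; rewrite [X]matrix_sum_delta.
rewrite (lin_sum lF) (lin_sum lG); apply: eq_bigr => i _.
rewrite (lin_sum lF) (lin_sum lG); apply: eq_bigr => j _.
by rewrite (linZ lF) (linZ lG) h.
Qed.

(* Equalities between linear expressions on composite systems are checked on
   product operators only. *)
Lemma tens_ext m n p q (V : lmodType C) (F G : 'M[C]_(m * n, p * q) -> V) :
  linear F -> linear G ->
  (forall A B, F (A *t B) = G (A *t B)) -> F =1 G.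
Proof.
move=> lF lG h; apply: linear_ext_delta => // a b.
case: (mxtens_indexP a) => i j; case: (mxtens_indexP b) => k l.
by rewrite -delta_tens h.
Qed.

Lemma tr_deltaM m n (i : 'I_m) (j : 'I_n) (D : 'M[C]_(n, m)) :
  \tr (delta_mx i j *m D) = D j i.
Proof.
rewrite /mxtrace (bigD1 i) //= big1 ?addr0 => [|a hn]; last first.
  by rewrite mxE big1 // => b _; rewrite !mxE (negbTE hn) mul0r.
rewrite mxE (bigD1 j) //= big1 ?addr0 => [|b hn]; last first.
  by rewrite !mxE (negbTE hn) andbF mul0r.
by rewrite !mxE !eqxx mul1r.
Qed.

Lemma psd_delta n (i : 'I_n) : psd (delta_mx i i : 'M[C]_n).
Proof.
have -> : delta_mx i i = delta_mx i 0 *m adjmx (delta_mx i 0 : 'cV[C]_n).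
  apply/matrixP => x y; rewrite [RHS]mxE big_ord1 adjmxE !mxE !andbT rmorph_nat.
  by rewrite -natrM mulnb.
exact: psd_gram.
Qed.

Lemma density_delta n (i : 'I_n) : density (delta_mx i i : 'M[C]_n).
Proof.
by split; [exact: psd_delta|rewrite -[delta_mx _ _]mulmx1 tr_deltaM mxE eqxx].
Qed.

Lemma tr_tens_ext m n (A B : 'M[C]_(m * n)) :
  (forall X Y, \tr ((X *t Y) *m A) = \tr ((X *t Y) *m B)) -> A = B.
Proof.
move=> h; apply: mxtensP => i j k l.
by have := h (delta_mx k i) (delta_mx l j); rewrite delta_tens !tr_deltaM.
Qed.

Lemma tensA_idx m n p (i : 'I_m) (j : 'I_n) (k : 'I_p) (e : (m * (n * p) = m * n * p)%N) :
  cast_ord e (ix (i, ix (j, k))) = ix (ix (i, j), k).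
Proof. by apply: val_inj => /=; rewrite mulnDl addnA mulnA. Qed.

Lemma tensA m n p (A : 'M[C]_m) (B : 'M[C]_n) (D : 'M[C]_p)
    (e e' : (m * (n * p) = m * n * p)%N) :
  castmx (e, e') (A *t (B *t D)) = (A *t B) *t D.
Proof.
apply/matrixP => a b.
case: (mxtens_indexP a) => ij k; case: (mxtens_indexP b) => ij' k'.
case: (mxtens_indexP ij) => i j; case: (mxtens_indexP ij') => i' j'.
rewrite castmxE !tensmxE -(tensA_idx _ _ _ e) -(tensA_idx _ _ _ e') !cast_ordK.
by rewrite !tensmxE mulrA.
Qed.

Lemma tensAV m n p (A : 'M[C]_m) (B : 'M[C]_n) (D : 'M[C]_p)
    (e e' : (m * n * p = m * (n * p))%N) :
  castmx (e, e') ((A *t B) *t D) = A *t (B *t D).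
Proof.
by rewrite -(tensA A B D (esym e) (esym e')) castmx_comp castmx_id.
Qed.

Lemma castmx_lin p q (e e' : p = q) a (A B : 'M[C]_p) :
  castmx (e, e') (a *: A + B) = a *: castmx (e, e') A + castmx (e, e') B.
Proof. by rewrite (eq_irrelevance e' e); case: q / e {e'}; rewrite !castmx_id. Qed.

Lemma tr_cast p q (e e' : p = q) (A : 'M[C]_p) : \tr (castmx (e, e') A) = \tr A.
Proof. by rewrite (eq_irrelevance e' e); case: q / e {e'}; rewrite !castmx_id. Qed.

Lemma tmap_lin n1 m1 n2 m2 (f : lmap R n1 m1) (g : lmap R n2 m2) a X Y :
  tmap f g (a *: X + Y) = a *: tmap f g X + tmap f g Y.
Proof.
rewrite /tmap scaler_sumr -big_split; apply: eq_bigr => i _ /=.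
rewrite scaler_sumr -big_split; apply: eq_bigr => j _ /=.
by rewrite !mxE scalerDl scalerA.
Qed.

Lemma tmap_linear n1 m1 n2 m2 (f : lmap R n1 m1) (g : lmap R n2 m2) :
  linear (tmap f g).
Proof. move=> a X Y; exact: tmap_lin. Qed.

Lemma tmap_delta n1 m1 n2 m2 (f : lmap R n1 m1) (g : lmap R n2 m2) i j k l :
  tmap f g (delta_mx i j *t delta_mx k l) = f (delta_mx i j) *t g (delta_mx k l).
Proof.
rewrite delta_tens /tmap (@big_only1 _ _ _ _ (ix (i, k))) //; last first.
  by move=> a hn _; rewrite big1 // => b _; rewrite mxE (negbTE hn) scale0r.
rewrite (@big_only1 _ _ _ _ (ix (j, l))) => [||b hn _] //; last first.
  by rewrite mxE (negbTE hn) andbF scale0r.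
by rewrite mxE !eqxx scale1r !mxtens_indexK.
Qed.

Lemma tmap_tens n1 m1 n2 m2 (f : lmap R n1 m1) (g : lmap R n2 m2) A B :
  linear f -> linear g -> tmap f g (A *t B) = f A *t g B.
Proof.
move=> lf lg; move: A; apply: linear_ext_delta => [a u v|a u v|i j].
- by rewrite tensmx_linl tmap_lin.
- by rewrite lf tensmx_linl.
move: B; apply: linear_ext_delta => [a u v|a u v|k l].
- by rewrite tensmx_linr tmap_lin.
- by rewrite lg tensmx_linr.
exact: tmap_delta.
Qed.

Lemma idmap_linear n : linear (@idmap R n).
Proof. by []. Qed.

Definition blk n k (X : 'M[C]_(n * k)) (x y : 'I_k) : 'M[C]_n :=
  \matrix_(p, q) X (ix (p, x)) (ix (q, y)).

Lemma tmap_idE n m k (f : lmap R n m) (X : 'M[C]_(n * k)) i j x y : linear f ->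
  tmap f (@idmap R k) X (ix (i, x)) (ix (j, y)) = f (blk X x y) i j.
Proof.
move=> lf.
(* The scalar is wrapped into a 1 x 1 row, because [tens_ext] compares functions with values in a
   module. *)
suff /rowP/(_ 0) : (\row_(_ < 1) tmap f (@idmap R k) X (ix (i, x)) (ix (j, y))
          = \row_(_ < 1) f (blk X x y) i j :> 'rV[C]_1) by rewrite !mxE.
move: X; apply: tens_ext => [a u v|a u v|A B].
- by apply/rowP => z; rewrite tmap_lin !mxE.
- apply/rowP => z; have -> : blk (a *: u + v) x y = a *: blk u x y + blk v x y.
    by apply/matrixP => p q; rewrite !mxE.
  by rewrite lf !mxE.
apply/rowP => z; rewrite tmap_tens // !mxE !mxtens_indexK /=.
have -> : blk (A *t B) x y = B x y *: A.
  by apply/matrixP => p q; rewrite !mxE !mxtens_indexK mulrC.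
by rewrite (linZ lf) mxE mulrC.
Qed.

(** The index is any finite type: direct sums of ancillas use a sum type, measurements a product
    type. *)
Definition krausf n m (S : finType) (K : S -> 'M[C]_(m, n)) : lmap R n m :=
  fun X => \sum_s (K s *m X *m adjmx (K s)).

Lemma krausf_linear n m (S : finType) (K : S -> 'M[C]_(m, n)) : linear (krausf K).
Proof.
move=> a u v; rewrite /krausf scaler_sumr -big_split; apply: eq_bigr => s _ /=.
by rewrite mulmxDr mulmxDl -scalemxAr -scalemxAl.
Qed.

Lemma krausf_psd n m (S : finType) (K : S -> 'M[C]_(m, n)) X :
  psd X -> psd (krausf K X).
Proof. by move=> hX; apply: psd_sum => s _; exact: psd_conj. Qed.

Lemma tmap_krausf_id n m k (S : finType) (K : S -> 'M[C]_(m, n)) :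
  tmap (krausf K) (@idmap R k) = krausf (fun s => K s *t 1%:M).
Proof.
apply/funext; apply: tens_ext => [||A B]; [exact: tmap_linear|exact: krausf_linear|].
rewrite tmap_tens; [|exact: krausf_linear|exact: idmap_linear].
rewrite /krausf tensmx_suml; apply: eq_bigr => s _.
by rewrite adjmx_tens adjmx1 !tensmx_mul mul1mx mulmx1.
Qed.

Lemma tmap_id_krausf n m k (S : finType) (K : S -> 'M[C]_(m, n)) :
  tmap (@idmap R k) (krausf K) = krausf (fun s => 1%:M *t K s).
Proof.
apply/funext; apply: tens_ext => [||A B]; [exact: tmap_linear|exact: krausf_linear|].
rewrite tmap_tens; [|exact: idmap_linear|exact: krausf_linear].
rewrite /krausf tensmx_sumr; apply: eq_bigr => s _.
by rewrite adjmx_tens adjmx1 !tensmx_mul mul1mx mulmx1.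
Qed.

Lemma krausf_CP n m (S : finType) (K : S -> 'M[C]_(m, n)) : CP (krausf K).
Proof. by move=> k X hX; rewrite tmap_krausf_id; exact: krausf_psd. Qed.

(** Heisenberg picture: cyclicity of the trace moves the map from the state to the effect. *)
Lemma tr_krausf n m (S : finType) (K : S -> 'M[C]_(m, n)) X (P : 'M[C]_m) :
  \tr (krausf K X *m P) = \tr (X *m (\sum_s (adjmx (K s) *m P *m K s))).
Proof.
rewrite /krausf mulmx_suml mulmx_sumr !raddf_sum; apply: eq_bigr => s _ /=.
by rewrite -!mulmxA mxtrace_mulC -!mulmxA.
Qed.

Lemma tr_ext n (A B : 'M[C]_n) :
  (forall X, \tr (X *m A) = \tr (X *m B)) -> A = B.
Proof.
by move=> h; apply/matrixP => i j; have := h (delta_mx j i); rewrite !tr_deltaM.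
Qed.

Lemma krausf_TP n m (S : finType) (K : S -> 'M[C]_(m, n)) :
  TP (krausf K) <-> \sum_s (adjmx (K s) *m K s) = 1%:M.
Proof.
have e X : \tr (krausf K X) = \tr (X *m (\sum_s (adjmx (K s) *m K s))).
  rewrite -[krausf K X]mulmx1 tr_krausf; congr (\tr (_ *m _)).
  by apply: eq_bigr => s _; rewrite mulmx1.
split=> [h|h X]; last by rewrite e h mulmx1.
by apply: tr_ext => X; rewrite -e h mulmx1.
Qed.

(** The rank-one operator |I>><<I| of the unnormalised maximally entangled vector. *)
Definition Omega n : 'M[C]_(n * n) :=
  \matrix_(a, b) (((mxtens_unindex a).1 == (mxtens_unindex a).2)
                  && ((mxtens_unindex b).1 == (mxtens_unindex b).2))%:R.

Lemma OmegaE n i j k l : Omega n (ix (i, j)) (ix (k, l)) = ((i == j) && (k == l))%:R.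
Proof. by rewrite mxE !mxtens_indexK. Qed.

Lemma Omega_psd n : psd (Omega n).
Proof.
pose w : 'cV[C]_(n * n) := \col_a ((mxtens_unindex a).1 == (mxtens_unindex a).2)%:R.
have -> : Omega n = w *m adjmx w.
  apply/matrixP => a b; rewrite mxE [RHS]mxE big_ord1 !mxE rmorph_nat -natrM.
  by rewrite mulnb.
exact: psd_gram.
Qed.

Lemma tr_tens_Omega n (A B : 'M[C]_n) : \tr ((A *t B) *m Omega n) = \tr (A *m B^T).
Proof.
rewrite /mxtrace big_mxtens; apply: eq_bigr => i _; rewrite mxE.
rewrite (bigD1 i) //= [X in _ + X]big1 ?addr0 => [|j ji]; last first.
  rewrite mxE big_mxtens big1 // => k _; rewrite big1 // => l _.
  by rewrite OmegaE [i == j]eq_sym (negbTE ji) andbF mulr0.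
rewrite mxE big_mxtens; apply: eq_bigr => k _.
rewrite (bigD1 k) //= big1 ?addr0 => [|l lk]; last first.
  by rewrite OmegaE [k == l]eq_sym (negbTE lk) mulr0.
by rewrite OmegaE !eqxx mulr1 tensmxE mxE.
Qed.

Lemma blk_Omega n (x y : 'I_n) : blk (Omega n) x y = delta_mx x y.
Proof. by apply/matrixP => p q; rewrite mxE OmegaE mxE. Qed.

(** Choi's argument: complete positivity, tested on [Omega] alone, makes the Choi matrix a Gram
    matrix B B^dag. Each column of B, reshaped to an m x n matrix, is a Kraus operator. *)
Lemma CP_krausP n m (f : lmap R n m) : linear f -> CP f ->
  exists K : 'I_(m * n) -> 'M[C]_(m, n), f = krausf K.
Proof.
move=> lf /(_ _ _ (@Omega_psd n))/psd_sqrt[B BE].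
exists (fun s => \matrix_(i, x) B (ix (i, x)) s).
apply/funext; apply: linear_ext_delta => [//||x y]; first exact: krausf_linear.
apply/matrixP => i j; rewrite -[in LHS]blk_Omega -tmap_idE // BE mxE /krausf summxE.
apply: eq_bigr => s _; rewrite [RHS]mxE (bigD1 y) //= [X in _ = _ + X]big1; last first.
  move=> z zy; rewrite mxE big1 ?mul0r // => w _.
  by rewrite !mxE (negbTE zy) andbF mulr0.
rewrite addr0 [X in _ = X * _]mxE (bigD1 x) //= [X in _ = (_ + X) * _]big1; last first.
  by move=> w wx; rewrite !mxE (negbTE wx) mulr0.
by rewrite !mxE !eqxx mulr1 addr0.
Qed.

Lemma channel_krausf n m (S : finType) (K : S -> 'M[C]_(m, n)) :
  \sum_s (adjmx (K s) *m K s) = 1%:M -> channel (krausf K).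
Proof.
by move=> h; split; [exact: krausf_linear|split; [exact: krausf_CP|exact/krausf_TP]].
Qed.

Lemma channel_krausP n m (f : lmap R n m) : channel f ->
  exists2 K : 'I_(m * n) -> 'M[C]_(m, n), f = krausf K &
    \sum_s (adjmx (K s) *m K s) = 1%:M.
Proof.
case=> lf [/(CP_krausP lf)[K ->] hT]; exists K => //; exact/krausf_TP.
Qed.

Lemma tmap_comp_id n m p k (f : lmap R m p) (g : lmap R n m) X :
  linear f -> linear g ->
  tmap (fun X => f (g X)) (@idmap R k) X = tmap f (@idmap R k) (tmap g (@idmap R k) X).
Proof.
move=> lf lg; move: X; apply: tens_ext => [||A B]; first exact: tmap_linear.
  by move=> a u v; rewrite !tmap_lin.
by rewrite !tmap_tens // => a u v; rewrite lg lf.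
Qed.

Lemma channel_comp n m p (f : lmap R m p) (g : lmap R n m) :
  channel f -> channel g -> channel (fun X => f (g X)).
Proof.
case=> lf [cf tf] [lg [cg tg]]; split; first by move=> a u v; rewrite lg lf.
split=> [k X hX|X]; last by rewrite tf tg.
by rewrite tmap_comp_id //; exact/cf/cg.
Qed.

Lemma channel_id n : channel (@idmap R n).
Proof.
have -> : @idmap R n = krausf (fun _ : 'I_1 => 1%:M).
  by apply/funext => X; rewrite /krausf big_ord1 adjmx1 mul1mx mulmx1.
by apply: channel_krausf; rewrite big_ord1 adjmx1 mul1mx.
Qed.

Lemma channel_cast n m (e e' : n = m) : channel (fun X : 'M[C]_n => castmx (e, e') X).
Proof.
rewrite (eq_irrelevance e' e); case: m / e {e'}.
by have -> : (fun X : 'M[C]_n => castmx (erefl n, erefl n) X) = @idmap R n;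
  [apply/funext => X; rewrite castmx_id|exact: channel_id].
Qed.

Lemma channel_tensid n m k (f : lmap R n m) : channel f -> channel (tmap f (@idmap R k)).
Proof.
move=> /channel_krausP[K -> h]; rewrite tmap_krausf_id; apply: channel_krausf.
under eq_bigr do rewrite adjmx_tens adjmx1 tensmx_mul mul1mx.
by rewrite -tensmx_suml h tens11.
Qed.

Lemma channel_idtens n m k (f : lmap R n m) : channel f -> channel (tmap (@idmap R k) f).
Proof.
move=> /channel_krausP[K -> h]; rewrite tmap_id_krausf; apply: channel_krausf.
under eq_bigr do rewrite adjmx_tens adjmx1 tensmx_mul mul1mx.
by rewrite -tensmx_sumr h tens11.
Qed.

Lemma channel_herm n m (f : lmap R n m) X : linear f -> CP f ->
  f (adjmx X) = adjmx (f X).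
Proof.
move=> lf /(CP_krausP lf)[K ->]; rewrite /krausf adjmx_sum; apply: eq_bigr => s _.
by rewrite !adjmxM adjmxK mulmxA.
Qed.

End Tensors.

(** * The diamond norm of a difference of channels *)

Section Diamond.
Variable R : realType.
Local Notation C := R[i].
Local Notation Re := complex.Re.
Local Notation ix := mxtens_index.

Lemma le_eps (x y M : R) :
  (forall d, 0 < d -> x <= y + d * M) -> x <= y.
Proof.
move=> h; rewrite leNgt; apply/negP => yx.
have [M0|M0] := leP M 0.
  by have := h 1 ltr01; lra.
have d0 : 0 < (x - y) / (2 * M) by rewrite divr_gt0 ?subr_gt0 ?mulr_gt0.
have := h _ d0.
have -> : (x - y) / (2 * M) * M = (x - y) / 2 by field; rewrite gt_eqF.
lra.
Qed.

(** Functional calculus in a fixed eigenbasis: products, sums and adjoints act pointwise on [d].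
    Complex values are allowed since unitaries are also built this way. *)
Definition fcalc n (U : 'M[C]_n) (d : 'I_n -> C) : 'M[C]_n :=
  adjmx U *m diag_mx (\row_i d i) *m U.

Lemma fcalcM n (U : 'M[C]_n) d e : unitary U ->
  fcalc U d *m fcalc U e = fcalc U (fun i => d i * e i).
Proof.
move=> uU; rewrite /fcalc -!mulmxA [U *m (_ *m _)]mulmxA uU mul1mx.
by rewrite [diag_mx _ *m (diag_mx _ *m _)]mulmxA mul_diag_mx2.
Qed.

Lemma fcalc1 n (U : 'M[C]_n) d : unitary U -> (forall i, d i = 1) ->
  fcalc U d = 1%:M.
Proof.
move=> uU d1; rewrite /fcalc.
have -> : diag_mx (\row_i d i) = 1%:M :> 'M[C]_n.
  by apply/matrixP => i j; rewrite !mxE d1.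
by rewrite mulmx1 unitaryC.
Qed.

Lemma adjmx_fcalc n (U : 'M[C]_n) d :
  adjmx (fcalc U d) = fcalc U (fun i => Num.conj (d i)).
Proof. by rewrite /fcalc !adjmxM adjmxK adjmx_diag mulmxA. Qed.

Lemma fcalcZ n (U : 'M[C]_n) a d : fcalc U (fun i => a * d i) = a *: fcalc U d.
Proof.
rewrite /fcalc scalemxAl scalemxAr; congr (_ *m _ *m _).
by apply/matrixP => i j; rewrite !mxE; case: eqP; rewrite ?mulr1n // !mulr0n mulr0.
Qed.

Lemma fcalcD n (U : 'M[C]_n) d e :
  fcalc U (fun i => d i + e i) = fcalc U d + fcalc U e.
Proof.
rewrite /fcalc -mulmxDl -mulmxDr; congr (_ *m _ *m _).
by apply/matrixP => i j; rewrite !mxE; case: eqP; rewrite ?mulr1n // !mulr0n addr0.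
Qed.

Lemma eq_fcalc n (U : 'M[C]_n) d e : d =1 e -> fcalc U d = fcalc U e.
Proof. by move=> h; rewrite (funext h). Qed.

Lemma fcalc_psd n (U : 'M[C]_n) d : (forall i, 0 <= d i) -> psd (fcalc U d).
Proof.
move=> d0; apply: psd_conjC => v; rewrite quad_form.
apply: sumr_ge0 => i _; rewrite (bigD1 i) //= big1 ?addr0 => [|j ji]; last first.
  by rewrite !mxE eq_sym (negbTE ji) mulr0n mulr0 mul0r.
by rewrite !mxE eqxx mulr1n mulrAC mulr_ge0 // mulrC mul_conjC_ge0.
Qed.

(** The trace of (1 - V) w (1 - V)^dag >= 0 expands to 2 Tr w - 2 Re Tr(V w). *)
Lemma Re_tr_unitary n (V w : 'M[C]_n) : unitary V -> psd w ->
  Re (\tr (V *m w)) <= Re (\tr w).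
Proof.
move=> uV hw.
have := ge0_Re (psd_tr_ge0 (psd_conj (1%:M - V) hw)).
rewrite adjmxD adjmxN adjmx1 !mulmxBl !mulmxBr mul1mx mulmx1.
rewrite raddfB /= ![\tr (_ - _)]raddfB /= mulmx1.
rewrite [\tr (V *m w *m adjmx V)]mxtrace_mulC mulmxA unitaryC // mul1mx.
have -> : \tr (w *m adjmx V) = Num.conj (\tr (V *m w)).
  by rewrite -tr_adjmx adjmxM (psd_herm hw).
rewrite !ReB ReJ; lra.
Qed.

Lemma unitaryZ n (z : C) (U : 'M[C]_n) : z * Num.conj z = 1 -> unitary U ->
  unitary (z *: U).
Proof.
by move=> z1 uU; rewrite /unitary adjmxZ -scalemxAl -scalemxAr scalerA z1 scale1r.
Qed.

Lemma tnorm_psd_le n (w : 'M[C]_n) : psd w -> (tnorm w <= (Re (\tr w))%:E)%E.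
Proof.
move=> hw; apply: ge_ereal_sup => _ [U [uU ->]]; rewrite lee_fin.
have [z z1 zE] := normC_phase (\tr (U *m w)).
rewrite -zE -linearZ /= scalemxAl; apply: Re_tr_unitary => //; exact: unitaryZ.
Qed.

Lemma Re_tr_le_tnorm n (U Z : 'M[C]_n) : unitary U ->
  ((Re (\tr (U *m Z)))%:E <= tnorm Z)%E.
Proof.
move=> uU; apply: (@le_trans _ _ (Re `|\tr (U *m Z)|)%:E).
  by rewrite lee_fin le_Re_norm.
by apply: ereal_sup_ubound; exists U.
Qed.

Lemma effect_unitary n (P : 'M[C]_n) : psd P -> psd (1%:M - P) ->
  exists2 U, unitary U & P = 4^-1 *: (U + adjmx U) + 2^-1 *: 1%:M.
Proof.
move=> hP hQ; have [V [p [uV p0 PE]]] := psd_spectral hP.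
have p1 i : p i <= 1.
  have := psd_diag_ge0 i (psd_conj V hQ).
  rewrite mulmxBr mulmxBl mulmx1 uV PE !mulmxA uV mul1mx -mulmxA uV mulmx1.
  by rewrite !mxE eqxx mulr1n -rmorphB /= lecR subr_ge0.
(* The identity forces the real part 2p - 1; modulus one then forces the imaginary part up to
   sign. *)
pose u i : C := Complex (2 * p i - 1) (2 * Num.sqrt (p i * (1 - p i))).
have uu i : u i * Num.conj (u i) = 1.
  have := @sqr_sqrtr _ (p i * (1 - p i)); rewrite mulr_ge0 ?subr_ge0 // => /(_ isT).
  rewrite /u; move: (Num.sqrt _) => s hs; apply/eqP; rewrite eq_complex /=.
  apply/andP; split; apply/eqP; last ring.
  have -> : (2 * p i - 1) * (2 * p i - 1) - 2 * s * - (2 * s) =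
    (2 * p i - 1) ^+ 2 + 4 * s ^+ 2 by ring.
  by rewrite hs; ring.
exists (fcalc V u).
  by rewrite /unitary adjmx_fcalc fcalcM // fcalc1.
rewrite PE -/(fcalc V (fun i => (p i)%:C)) adjmx_fcalc.
rewrite -(@fcalc1 _ V (fun=> 1)) // -fcalcD -!fcalcZ -fcalcD; apply: eq_fcalc => i.
have -> : u i + Num.conj (u i) = 2%:R * (2 * p i - 1)%:C by exact: addcJ.
by rewrite rmorphB rmorphM /= rmorph_nat rmorph1; field.
Qed.

(** Homogeneous in [w], so inputs need no normalisation. Only one sign is tested; for
    trace-annihilating [D] the other one follows from [test_boundN]. *)
Definition test_bound n m (D : lmap R n m) (c : R) : Prop :=
  forall k (w : 'M[C]_(n * k)) (P : 'M[C]_(m * k)),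
    psd w -> psd P -> psd (1%:M - P) ->
    Re (\tr (tmap D (@idmap R k) w *m P)) <= c * Re (\tr w).

Lemma tr_tmap0 n m k (D : lmap R n m) (w : 'M[C]_(n * k)) : linear D ->
  (forall X, \tr (D X) = 0) -> \tr (tmap D (@idmap R k) w) = 0.
Proof.
move=> lD D0; move: w.
apply: (@tens_ext R _ _ _ _ C^o (fun w => \tr (tmap D (@idmap R k) w)) (fun=> 0)).
- by move=> a u v; rewrite tmap_lin raddfD /= linearZ.
- by move=> a u v; rewrite scaler0 addr0.
- by move=> A B; rewrite tmap_tens // tr_tens D0 mul0r.
Qed.

Lemma tmap_adj n m k (D : lmap R n m) (X : 'M[C]_(n * k)) : linear D ->
  (forall X, D (adjmx X) = adjmx (D X)) ->
  tmap D (@idmap R k) (adjmx X) = adjmx (tmap D (@idmap R k) X).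
Proof.
move=> lD hD; rewrite -[LHS]adjmxK; congr adjmx; move: X.
apply: tens_ext => [a u v|a u v|A B].
- by rewrite adjmxD adjmxZ tmap_lin adjmxD adjmxZ conjCK.
- by rewrite tmap_lin.
- by rewrite adjmx_tens !tmap_tens // adjmx_tens hD adjmxK /idmap adjmxK.
Qed.

(** By [effect_unitary] the effect is a quarter of two unitaries plus half the identity. Each
    unitary value is at most 2c and the identity gives zero, as [D] annihilates traces. Normalising
    [w] needs a positive trace; with zero trace [w] vanishes. *)
Lemma dnorm_test_bound n m (D : lmap R n m) (c : R) : linear D ->
  (forall X, \tr (D X) = 0) -> (dnorm D <= (2 * c)%:E)%E -> test_bound D c.
Proof.
move=> lD D0 hd k w P hw hP hQ.
have t0 : 0 <= Re (\tr w) by exact/ge0_Re/psd_tr_ge0.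
have [t1|tn0] := eqVneq (Re (\tr w)) 0.
  by rewrite t1 (psd_tr0 hw t1) (lin0 (@tmap_linear _ _ _ _ _ _ _)) mul0mx linear0 mulr0.
have tp : 0 < Re (\tr w) by rewrite lt_def tn0.
set t := Re (\tr w) in t0 tn0 tp *.
pose w' := (t^-1)%:C *: w.
have hw' : psd w' by apply: psdZ => //; rewrite ler0c invr_ge0.
have tw' : Re (\tr w') = 1 by rewrite linearZ /= ReZ mulVf.
have wE : w = t%:C *: w' by rewrite scalerA -rmorphM /= divff ?scale1r.
set Z := tmap D (@idmap R k) w'.
have hZ : (tnorm Z <= (2 * c)%:E)%E.
  apply: le_trans hd; apply: ereal_sup_ubound; exists k, w'; split=> //.
  by rewrite -[1%E]/(1%:E) -tw'; exact: tnorm_psd_le.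
have hU U : unitary U -> Re (\tr (U *m Z)) <= 2 * c.
  by move=> uU; rewrite -lee_fin; apply: le_trans hZ; exact: Re_tr_le_tnorm.
have [U uU ->] := effect_unitary hP hQ.
rewrite wE (linZ (@tmap_linear _ _ _ _ _ _ _)) -/Z.
rewrite -scalemxAl linearZ /= ReZ mulrC ler_wpM2r //.
rewrite mulmxDr -!scalemxAr mulmx1 raddfD /= ![\tr (_ *: _)]linearZ /=.
rewrite tr_tmap0 // mulr0 addr0 mulmxDr raddfD /=.
have -> : 4^-1 = (4^-1 : R)%:C :> C by rewrite fmorphV rmorph_nat.
rewrite ReZ ReD [\tr (Z *m U)]mxtrace_mulC [\tr (Z *m adjmx U)]mxtrace_mulC.
have := hU _ uU; have := hU _ (unitary_adj uU); lra.
Qed.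

(** Test with 1 - P instead of P: the two values add up to the trace of the output, which is
    zero. *)
Lemma test_boundN n m (D : lmap R n m) (c : R) : linear D ->
  (forall X, \tr (D X) = 0) -> test_bound D c -> test_bound (fun X => - D X) c.
Proof.
move=> lD D0 h k w P hw hP hQ.
have -> : tmap (fun X => - D X) (@idmap R k) w = - tmap D (@idmap R k) w.
  move: w {hw}; apply: tens_ext => [a u v|a u v|A B].
  - by rewrite tmap_lin.
  - by rewrite tmap_lin opprD scalerN.
  rewrite !tmap_tens //; last by move=> a u v; rewrite lD opprD scalerN.
  by rewrite -scaleN1r tensmxZl scaleN1r.
have := h k w (1%:M - P) hw hQ.
rewrite opprB addrC subrK => /(_ hP).
by rewrite mulmxBr mulmx1 raddfB /= tr_tmap0 // sub0r mulNmx !raddfN /=.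
Qed.

Definition inlmx m n : 'M[C]_(m + n, m) := col_mx 1%:M 0.
Definition inrmx m n : 'M[C]_(m + n, n) := col_mx 0 1%:M.

Lemma adjmx_col m n p (A : 'M[C]_(m, p)) (B : 'M[C]_(n, p)) :
  adjmx (col_mx A B) = row_mx (adjmx A) (adjmx B).
Proof. by rewrite /adjmx map_col_mx tr_col_mx. Qed.

Lemma adjmx0 m n : adjmx (0 : 'M[C]_(m, n)) = 0.
Proof. by rewrite /adjmx map_mx0 trmx0. Qed.

Lemma inlK m n : adjmx (inlmx m n) *m inlmx m n = 1%:M.
Proof. by rewrite adjmx_col mul_row_col adjmx1 adjmx0 mul1mx mul0mx addr0. Qed.

Lemma inrK m n : adjmx (inrmx m n) *m inrmx m n = 1%:M.
Proof. by rewrite adjmx_col mul_row_col adjmx1 adjmx0 mul1mx mul0mx add0r. Qed.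

Lemma inlr0 m n : adjmx (inlmx m n) *m inrmx m n = 0.
Proof. by rewrite adjmx_col mul_row_col adjmx1 adjmx0 mulmx0 mul0mx addr0. Qed.

Lemma inrl0 m n : adjmx (inrmx m n) *m inlmx m n = 0.
Proof. by rewrite adjmx_col mul_row_col adjmx1 adjmx0 mulmx0 mul0mx addr0. Qed.

Lemma inlr1 m n :
  inlmx m n *m adjmx (inlmx m n) + inrmx m n *m adjmx (inrmx m n) = 1%:M.
Proof.
rewrite !adjmx_col !mul_col_row !adjmx1 !adjmx0 !mul1mx !mulmx0 !mul0mx.
by rewrite add_block_mx !addr0 add0r -scalar_mx_block.
Qed.

Lemma tmap_conj n m k l (D : lmap R n m) (F : 'M[C]_(k, l)) (G : 'M[C]_(k, l))
    (X : 'M[C]_(n * l)) : linear D ->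
  tmap D (@idmap R k) ((1%:M *t F) *m X *m adjmx (1%:M *t G)) =
  (1%:M *t F) *m tmap D (@idmap R l) X *m adjmx (1%:M *t G).
Proof.
move=> lD; move: X; apply: tens_ext => [a u v|a u v|A B].
- by rewrite mulmxDr mulmxDl -scalemxAr -scalemxAl tmap_lin.
- by rewrite tmap_lin mulmxDr mulmxDl -scalemxAr -scalemxAl.
by rewrite !adjmx_tens !adjmx1 !tensmx_mul !tmap_tens // !tensmx_mul !mul1mx !mulmx1.
Qed.

(** The input V Q is not positive, but it is a corner of the positive matrix with blocks V Q V^dag,
    V Q, Q V^dag, Q on a doubled ancilla. An effect is chosen that sees only the two off-diagonal
    corners, which are adjoint to each other and produce the real part. As Tr w = 2 Tr Q, the
    constant becomes 2c. *)
Lemma test_bound_polar n m k (D : lmap R n m) c (V Q : 'M[C]_(n * k))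
    (W : 'M[C]_(m * k)) :
  linear D -> (forall X, \tr (D X) = 0) ->
  (forall X, D (adjmx X) = adjmx (D X)) -> test_bound D c ->
  unitary V -> psd Q -> unitary W ->
  Re (\tr (tmap D (@idmap R k) (V *m Q) *m W)) <= 2 * c * Re (\tr Q).
Proof.
move=> lD D0 hD tD uV hQ uW.
pose f0 : 'M[C]_(n * (k + k), n * k) := 1%:M *t inlmx k k.
pose f1 : 'M[C]_(n * (k + k), n * k) := 1%:M *t inrmx k k.
pose g0 : 'M[C]_(m * (k + k), m * k) := 1%:M *t inlmx k k.
pose g1 : 'M[C]_(m * (k + k), m * k) := 1%:M *t inrmx k k.
have f00 : adjmx f0 *m f0 = 1%:M by rewrite adjmx_tens tensmx_mul inlK adjmx1 mul1mx tens11.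
have f11 : adjmx f1 *m f1 = 1%:M by rewrite adjmx_tens tensmx_mul inrK adjmx1 mul1mx tens11.
have g00 : adjmx g0 *m g0 = 1%:M by rewrite adjmx_tens tensmx_mul inlK adjmx1 mul1mx tens11.
have g11 : adjmx g1 *m g1 = 1%:M by rewrite adjmx_tens tensmx_mul inrK adjmx1 mul1mx tens11.
have f01 : adjmx f0 *m f1 = 0 by rewrite adjmx_tens tensmx_mul inlr0 tensmx0.
have f10 : adjmx f1 *m f0 = 0 by rewrite adjmx_tens tensmx_mul inrl0 tensmx0.
have g01 : adjmx g0 *m g1 = 0 by rewrite adjmx_tens tensmx_mul inlr0 tensmx0.
have g10 : adjmx g1 *m g0 = 0 by rewrite adjmx_tens tensmx_mul inrl0 tensmx0.
have gg : g0 *m adjmx g0 + g1 *m adjmx g1 = 1%:M.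
  by rewrite !adjmx_tens !tensmx_mul adjmx1 mul1mx -tensmxDr inlr1 tens11.
pose T X := tmap D (@idmap R k) X; set T2 := tmap D (@idmap R (k + k)).
have lT2 : linear T2 by exact: tmap_linear.
have c00 X : T2 (f0 *m X *m adjmx f0) = g0 *m T X *m adjmx g0 by exact: tmap_conj.
have c01 X : T2 (f0 *m X *m adjmx f1) = g0 *m T X *m adjmx g1 by exact: tmap_conj.
have c10 X : T2 (f1 *m X *m adjmx f0) = g1 *m T X *m adjmx g0 by exact: tmap_conj.
have c11 X : T2 (f1 *m X *m adjmx f1) = g1 *m T X *m adjmx g1 by exact: tmap_conj.
clearbody f0 f1 g0 g1.
pose G := f0 *m V + f1.
pose w := G *m Q *m adjmx G.
pose L W' : 'M[C]_(m * (k + k), m * k) := g0 + g1 *m W'.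
pose P := 2^-1 *: (L W *m adjmx (L W)).
have h20 : 0 <= 2^-1 :> C by rewrite invr_ge0.
have hP : psd P by exact: psdZ h20 (psd_gram _).
(* As W is unitary, L(W) and L(-W) are sqrt 2 times isometries with complementary ranges, so P and 1
   - P are both halves of Gram matrices. *)
have LL : L W *m adjmx (L W) + L (- W) *m adjmx (L (- W)) = 2 *: 1%:M.
  rewrite /L !adjmxD !mulmxN !adjmxN !mulmxDl !mulmxDr !mulNmx !mulmxN opprK.
  rewrite !adjmxM -![g1 *m W *m (_ *m _)]mulmxA ![W *m (_ *m _)]mulmxA uW mul1mx -gg.
  move: (g0 *m adjmx g0) (g0 *m (_ *m _)) (g1 *m W *m _) (g1 *m adjmx g1).
  by move=> x y z t; apply/matrixP => i j; rewrite !mxE; ring.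
have hP1 : psd (1%:M - P).
  have -> : 1%:M - P = 2^-1 *: (L (- W) *m adjmx (L (- W))).
    have -> : L (- W) *m adjmx (L (- W)) = 2 *: 1%:M - L W *m adjmx (L W).
      by rewrite -LL addrC addKr.
    by rewrite scalerBr scalerA mulVf ?scale1r // pnatr_eq0.
  exact: psdZ h20 (psd_gram _).
have hw : psd w by exact: psd_conj.
have trw : \tr w = 2 * \tr Q.
  rewrite /w -mulmxA mxtrace_mulC -mulmxA.
  have -> : adjmx G *m G = 2 *: 1%:M.
    rewrite /G adjmxD adjmxM mulmxDl !mulmxDr -!mulmxA [adjmx f0 *m (_ *m _)]mulmxA.
    rewrite f00 mul1mx f01 mulmx0 addr0 [adjmx f1 *m (_ *m _)]mulmxA f10 mul0mx add0r.
    by rewrite f11 unitaryC // scaler_nat mulr2n.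
  by rewrite -scalemxAr mulmx1 linearZ.
have := tD _ w P hw hP hP1; rewrite trw -/T2.
have -> : Re (2 * \tr Q) = 2 * Re (\tr Q) by rewrite mulr_natl mulr2n ReD -mulr2n mulr_natl.
rewrite mulrCA mulrA; apply: le_trans.
have wE : w = f0 *m (V *m Q *m adjmx V) *m adjmx f0 + f0 *m (V *m Q) *m adjmx f1
      + (f1 *m (Q *m adjmx V) *m adjmx f0 + f1 *m Q *m adjmx f1).
  by rewrite /w /G adjmxD !adjmxM !mulmxDl !mulmxDr !mulmxA.
have gL0 : adjmx g0 *m L W = 1%:M by rewrite /L mulmxDr g00 mulmxA g01 mul0mx addr0.
have gL1 : adjmx g1 *m L W = W by rewrite /L mulmxDr g10 mulmxA g11 mul1mx add0r.
have gL0' : adjmx (L W) *m g0 = 1%:M by rewrite -[RHS]adjmx1 -gL0 adjmxM adjmxK.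
have gL1' : adjmx (L W) *m g1 = adjmx W by rewrite -[in RHS]gL1 adjmxM adjmxK.
have e X (g g' : 'M[C]_(m * (k + k), m * k)) :
    \tr (g *m X *m adjmx g' *m (L W *m adjmx (L W))) =
    \tr (X *m (adjmx g' *m L W) *m (adjmx (L W) *m g)).
  by rewrite -!mulmxA mxtrace_mulC !mulmxA.
have tr4 N (A1 A2 A3 A4 Z : 'M[C]_N) : \tr ((A1 + A2 + (A3 + A4)) *m Z) =
    \tr (A1 *m Z) + \tr (A2 *m Z) + (\tr (A3 *m Z) + \tr (A4 *m Z)).
  by rewrite !mulmxDl !mxtraceD.
rewrite wE !(linD lT2) c00 c01 c10 c11 /P.
clearbody L T2; rewrite -scalemxAr mxtraceZ.
rewrite tr4 (e (T (V *m Q *m adjmx V)) g0 g0) (e (T (V *m Q)) g0 g1).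
rewrite (e (T (Q *m adjmx V)) g1 g0) (e (T Q) g1 g1).
rewrite gL0 gL1 gL0' gL1' !mulmx1.
rewrite -[_ *m W *m adjmx W]mulmxA uW mulmx1.
(* The diagonal corners meet the identity, one of them as W W^dag; they contribute traces of outputs
   of [D], hence nothing. *)
rewrite {1 4}/T !tr_tmap0 // add0r addr0.
have -> : T (Q *m adjmx V) = adjmx (T (V *m Q)).
  by rewrite /T -tmap_adj // adjmxM (psd_herm hQ).
rewrite -adjmxM tr_adjmx [\tr (W *m _)]mxtrace_mulC -/(T (V *m Q)).
move: (\tr _) => z.
have -> : 2^-1 * (z + Num.conj z) = (Re z)%:C.
  by rewrite mulrC; apply/esym; exact: ReJ_add.
by [].
Qed.

(** For invertible X the unitary is X |X|^{-1} and no partial isometry has to be extended.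
    [perturb_unit] makes this case sufficient. *)
Lemma polar n (X : 'M[C]_n) : X \in unitmx ->
  exists V Q : 'M[C]_n, [/\ unitary V, psd Q & X = V *m Q].
Proof.
move=> uX; have [U [d [uU d0 XE]]] := psd_spectral (psd_gramC X).
have dn0 i : d i != 0.
  have : adjmx X *m X \in unitmx.
    rewrite unitmx_mul uX andbT /adjmx unitmx_tr.
    by rewrite map_unitmx.
  rewrite XE !unitmx_mul => /andP[/andP[_]].
  rewrite unitmxE det_diag unitfE => /prodf_neq0/(_ i isT) /=.
  by rewrite mxE => + _; rewrite -(rmorph0 (real_complex R)) (inj_eq (@complexI _)).
pose s i := Num.sqrt (d i).
have s0 i : s i != 0 by rewrite sqrtr_eq0 -ltNge lt_def dn0 d0.
have ss i : s i * s i = d i by rewrite -expr2 sqr_sqrtr.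
pose Q := fcalc U (fun i => (s i)%:C); pose Qi := fcalc U (fun i => (s i)^-1%:C).
have QQ : Qi *m Q = 1%:M.
  by rewrite fcalcM // fcalc1 // => i; rewrite -rmorphM /= mulVf.
exists (X *m Qi), Q; split; last by rewrite -mulmxA QQ mulmx1.
  apply: mulmx1C; rewrite adjmxM -mulmxA [adjmx X *m _]mulmxA XE -/(fcalc U (fun i => (d i)%:C)).
  rewrite adjmx_fcalc !fcalcM // fcalc1 // => i.
  by rewrite conj_RC -!rmorphM /= -ss; congr (_%:C); field.
by apply: fcalc_psd => i; rewrite ler0c sqrtr_ge0.
Qed.

Lemma perturb_unit n (X : 'M[C]_n) (d : R) : 0 < d ->
  exists2 e : R, 0 < e <= d & X + e%:C *: 1%:M \in unitmx.
Proof.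
move=> d0; pose e j : R := d / j.+1%:R.
have eP j : 0 < e j <= d.
  by rewrite divr_gt0 //= ler_pdivrMr // -[leLHS]mulr1 ler_pM2l // ler1n.
have inj_e : injective e.
  move=> i j /(mulfI _) => /(_ (lt0r_neq0 d0)) /invr_inj /eqP.
  by rewrite eqr_nat => /eqP[].
(* There is one candidate more than the degree, so the characteristic polynomial cannot vanish at
   all the distinct points -d/(j+1). *)
pose p := char_poly X; pose s := [seq - (e j)%:C | j <- iota 0 (size p)].
case: (boolP (all (root p) s)) => [ar|/allPn[_ /mapP[j _ ->] rj]]; last first.
  exists (e j) => //; move: rj; rewrite -eigenvalue_root_char /eigenvalue negbK.
  by rewrite /eigenspace kermx_eq0 row_free_unit rmorphN opprK scalemx1.
have us : uniq s.
  rewrite map_inj_uniq ?iota_uniq // => i j /oppr_inj /complexI; exact: inj_e.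
have := max_poly_roots _ ar us; rewrite size_map size_iota ltnn.
by move=> h; have := h (monic_neq0 (char_poly_monic X)).
Qed.

(** A phase absorbed into the unitary removes the modulus. For X + e 1 = V Q one has Re Tr Q = Re
    Tr(V^dag X) + e Re Tr(V^dag) <= 1 + e N, since X has trace norm at most one. The perturbation
    thus costs at most e (2cN + M), with e arbitrarily small. *)
Lemma test_bound_dnorm n m (D : lmap R n m) (c : R) : 0 <= c -> linear D ->
  (forall X, \tr (D X) = 0) -> (forall X, D (adjmx X) = adjmx (D X)) ->
  test_bound D c -> (dnorm D <= (2 * c)%:E)%E.
Proof.
move=> c0 lD D0 hD tD; apply: ge_ereal_sup => _ [k [X [tX ->]]].
apply: ge_ereal_sup => _ [U [uU ->]]; rewrite lee_fin.
set T := tmap D (@idmap R k).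
have lT : linear T by exact: tmap_linear.
have [z z1 zE] := normC_phase (\tr (U *m T X)).
rewrite -zE -linearZ /= scalemxAl mxtrace_mulC; set W := z *: U.
have uW : unitary W by exact: unitaryZ.
pose N := Re (\tr (1%:M : 'M[C]_(n * k))).
pose M := `|Re (\tr (T 1%:M *m W))|.
apply: (@le_eps _ _ (2 * c * N + M)) => d d0.
have [e /andP[e0 ed] /polar[V [Q [uV hQ XE]]]] := perturb_unit X d0.
have hX : Re (\tr (adjmx V *m X)) <= 1.
  rewrite -lee_fin; apply: le_trans tX; apply: Re_tr_le_tnorm; exact: unitary_adj.
have hV : Re (\tr (adjmx V)) <= N.
  by rewrite -[adjmx V]mulmx1; apply: Re_tr_unitary; [exact: unitary_adj|exact: psd1].
have N0 : 0 <= N by exact/ge0_Re/psd_tr_ge0/psd1.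
have trQ : Re (\tr Q) <= 1 + e * N.
  have -> : Q = adjmx V *m X + e%:C *: adjmx V.
    by rewrite -[Q]mul1mx -(unitaryC uV) -mulmxA -XE mulmxDr -scalemxAr mulmx1.
  by rewrite raddfD /= ReD linearZ /= ReZ lerD // ler_wpM2l // ltW.
have := test_bound_polar lD D0 hD tD uV hQ uW.
rewrite -XE -/T (linD lT) (linZ lT) mulmxDl -scalemxAl mxtraceD mxtraceZ ReD ReZ.
have hM : - M <= Re (\tr (T 1%:M *m W)) by rewrite lerNnormlW // lerN_normlW.
have M0 : 0 <= M by exact: normr_ge0.
move: (Re (\tr (T X *m W))) (Re (\tr (T 1%:M *m W))) hM => x y hM h.
have h1 : 2 * c * Re (\tr Q) <= 2 * c * (1 + e * N) by rewrite ler_wpM2l // mulr_ge0.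
have h2 : e * (2 * c * N + M) <= d * (2 * c * N + M).
  by rewrite ler_wpM2r // addr_ge0 // !mulr_ge0.
have h3 : e * y >= e * - M by rewrite ler_wpM2l // ltW.
nra.
Qed.

End Diamond.

(** * An approximate minimax theorem *)

Section Minimax.
Variable R : realType.
Local Notation C := R[i].
Local Notation Re := complex.Re.
Definition convexp (V : lmodType C) (X : V -> Prop) := forall (t : R) x y,
  0 <= t <= 1 -> X x -> X y -> X (t%:C *: x + (1 - t)%:C *: y).

(** * Minimax for a bilinear pairing controlled by a quadratic form *)

Section Abstract.
Variables (V : lmodType C) (B : V -> V -> R) (q : V -> R).
Hypothesis pairDl : forall (s t : R) x x' y,
  B (s%:C *: x + t%:C *: x') y = s * B x y + t * B x' y.
Hypothesis pairDr : forall (s t : R) x y y',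
  B x (s%:C *: y + t%:C *: y') = s * B x y + t * B x y'.
Hypothesis q_ge0 : forall x, 0 <= q x.
Hypothesis q_mid : forall x y, q ((2^-1)%:C *: x + (1 - 2^-1)%:C *: y) =
  2^-1 * q x + 2^-1 * q y - 4^-1 * q (x - y).
Hypothesis pair_amgm : forall (s : R) x y, 2 * s * B x y <= s ^+ 2 * q x + q y.

Variables (X Y : V -> Prop) (D : R).
Hypotheses (cX : convexp X) (cY : convexp Y).
Hypotheses (qX : forall x, X x -> q x <= D) (qY : forall y, Y y -> q y <= D).

Lemma pair_le_bound x y : X x -> Y y -> B x y <= D.
Proof.
by move=> hx hy; have := pair_amgm 1 x y; have := qX hx; have := qY hy; lra.
Qed.

Lemma pair_ge_bound x y : X x -> Y y -> - D <= B x y.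
Proof.
by move=> hx hy; have := pair_amgm (-1) x y; have := qX hx; have := qY hy; lra.
Qed.

(* Replacing [B] by the strongly concave [B - d/2 q] makes almost maximisers
   [x] of nearby [y] close to each other, so that an almost maximiser for an
   almost optimal [y0] is good against every [y]: no compactness is used. *)
Lemma minimax_quant (c d s t e : R) x1 y1 :
  0 < d -> 0 < s -> 0 < t <= 1 -> 0 < e -> X x1 -> Y y1 ->
  (forall x, X x -> exists2 y, Y y & B x y <= c) ->
  exists2 y, Y y & forall x, X x ->
    B x y <= c + (e + d / 2 * D + 2 * e / t + 4 * s * (2 * e + t * D) / d + D / (2 * s)).
Proof.
move=> d0 s0 /andP[t0 t1] e0 hx1 hy1 hyp.
pose f x y := B x y - d / 2 * q x.
(* [G] collects the uniform upper bounds achieved by some y, so its infimum v is the min-max value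
   of the regularised pairing. *)
pose G : set R := (fun r => exists2 y, Y y & forall x, X x -> f x y <= r).
have fB x y : f x y <= B x y.
  by rewrite gerBl mulr_ge0 ?q_ge0 // divr_ge0 // ltW.
have G0 : (G !=set0)%classic.
  exists D, y1 => // x hx; exact: le_trans (fB _ _) (pair_le_bound hx hy1).
have Glb : has_lbound G.
  exists (- D - d / 2 * D) => r [y hy /(_ _ hx1)]; apply: le_trans.
  rewrite /f lerB ?pair_ge_bound // ler_wpM2l ?qX // divr_ge0 // ltW //.
pose v := inf G.
have [r [y0 hy0 hr] rv] := inf_adherent e0 (conj G0 Glb).
have h0 x : X x -> f x y0 <= v + e by move=> hx; apply: le_trans (hr _ hx) (ltW rv).
have hv y : Y y -> exists2 x, X x & v - e < f x y.
  move=> hy; apply: contrapT => hn.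
  have : G (v - e).
    exists y => // x hx; rewrite leNgt; apply/negP => h; apply: hn; by exists x.
  by move=> /(ge_inf Glb); rewrite -/v; lra.
have [x0 hx0 x0v] := hv _ hy0.
have [y hy hyc] := hyp _ hx0.
(* Here y answers x0. A small step t from y0 towards y yields a new almost maximiser xt, whose value
   against y itself is still at least v - 2e/t. *)
pose yt := t%:C *: y + (1 - t)%:C *: y0.
have hyt : Y yt by apply: cY => //; rewrite ltW.
have [xt hxt xtv] := hv _ hyt.
have ftE : f xt yt = t * f xt y + (1 - t) * f xt y0 by rewrite /f /yt pairDr; ring.
have h1 : v - 2 * e / t <= f xt y.
  have := h0 _ hxt; move: xtv; rewrite ftE => xtv h0t.
  rewrite -(ler_pM2l t0) mulrBr.
  have -> : t * (2 * e / t) = 2 * e by field; rewrite gt_eqF.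
  nra.
(* At the midpoint of xt and x0 strong concavity gains d/8 times q(xt - x0), yet no value against y0
   exceeds v + e. So the two almost maximisers are close. *)
have h2 : q (xt - x0) <= 8 * (2 * e + t * D) / d.
  pose m := (2^-1)%:C *: xt + (1 - 2^-1)%:C *: x0.
  have hm : X m by apply: cX => //; apply/andP; split; lra.
  have fm : f m y0 = 2^-1 * f xt y0 + 2^-1 * f x0 y0 + d / 8 * q (xt - x0).
    rewrite /f /m pairDl q_mid; have -> : 1 - 2^-1 = 2^-1 :> R by lra.
    by field.
  have := h0 _ hm; rewrite fm => hfm.
  have b1 := pair_le_bound hxt hy; have b2 := pair_ge_bound hxt hy0.
  have ff : f xt y - f xt y0 <= 2 * D by rewrite /f; lra.
  rewrite ler_pdivlMr // mulrC.
  have : t * (f xt y - f xt y0) <= t * (2 * D) by rewrite ler_pM2l.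
  move: xtv; rewrite ftE; nra.
have h3 : B xt y - B x0 y <= 4 * s * (2 * e + t * D) / d + D / (2 * s).
  have -> : B xt y - B x0 y = B (xt - x0) y.
    have -> : xt - x0 = 1%:C *: xt + (-1)%:C *: x0.
      by rewrite rmorphN rmorph1 scaleN1r scale1r.
    by rewrite pairDl; ring.
  have := pair_amgm s (xt - x0) y => ha.
  have hb : s ^+ 2 * q (xt - x0) <= s ^+ 2 * (8 * (2 * e + t * D) / d).
    by rewrite ler_wpM2l // sqr_ge0.
  have s20 : 0 < 2 * s by rewrite mulr_gt0.
  rewrite -(ler_pM2l s20) mulrDr.
  have -> : 2 * s * (D / (2 * s)) = D by field; rewrite gt_eqF.
  have -> : 2 * s * (4 * s * (2 * e + t * D) / d) = s ^+ 2 * (8 * (2 * e + t * D) / d).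
    by field; rewrite gt_eqF.
  by apply: le_trans ha _; rewrite lerD // qY.
exists y0 => // x hx.
have hx' : B x y0 <= v + e + d / 2 * D.
  have -> : B x y0 = f x y0 + d / 2 * q x by rewrite /f; ring.
  by rewrite lerD ?h0 // ler_wpM2l ?qX // divr_ge0 // ltW.
have := fB xt y; lra.
Qed.

Lemma minimax_abstract (c e : R) x1 y1 : 0 < e -> X x1 -> Y y1 ->
  (forall x, X x -> exists2 y, Y y & B x y <= c) ->
  exists2 y, Y y & forall x, X x -> B x y <= c + e.
Proof.
move=> e0 hx1 hy1 hyp.
have D0 : 0 <= D by apply: le_trans (q_ge0 x1) (qX hx1).
(* With d = a/M, s = M/a and inner slack t^2, the five errors are at most a, a/2, a, a and a/2, in
   total 4a <= e. Taking D + 1 avoids division by zero when D = 0. *)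
pose M := D + 1; pose a := Num.min 1 (e / 4).
have M1 : 1 <= M by rewrite /M; lra.
have M0 : 0 < M by lra.
have a0 : 0 < a by rewrite lt_min ltr01 divr_gt0.
have a1 : a <= 1 by rewrite ge_min lexx.
have ae : a <= e / 4 by rewrite ge_min lexx orbT.
(* The fourth error is at most 12 t M^3 / a^2, which this t makes equal to a. *)
pose t := a ^+ 3 / (12 * M ^+ 3).
have M3 : 0 < M ^+ 3 by rewrite exprn_gt0.
have M31 : 1 <= M ^+ 3 by rewrite exprn_ege1.
have t0 : 0 < t by rewrite divr_gt0 ?exprn_gt0 // mulr_gt0.
have a3 : a ^+ 3 <= a by rewrite -[leRHS]expr1 ler_wiXn2l // ltW.
have ta : t <= a / 12.
  rewrite /t ler_pdivrMr ?mulr_gt0 //; nra.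
have [y hy h] := @minimax_quant c (a / M) (M / a) t (t ^+ 2) x1 y1
  (divr_gt0 a0 M0) (divr_gt0 M0 a0) ltac:(lra) (exprn_gt0 2 t0) hx1 hy1 hyp.
exists y => // x hx; apply: le_trans (h _ hx) _; rewrite lerD2l.
have e1 : t ^+ 2 <= a by nra.
have DM : D / M <= 1 by rewrite ler_pdivrMr // mul1r /M; lra.
have a2 : 0 <= a / 2 by lra.
have e2 : a / M / 2 * D <= a / 2.
  have -> : a / M / 2 * D = a / 2 * (D / M) by field; rewrite gt_eqF.
  by rewrite -[leRHS]mulr1; exact: ler_wpM2l a2 _ _ DM.
have e3 : 2 * t ^+ 2 / t <= a.
  have -> : 2 * t ^+ 2 / t = 2 * t by field; rewrite gt_eqF.
  lra.
have e4 : D / (2 * (M / a)) <= a / 2.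
  have -> : D / (2 * (M / a)) = a / 2 * (D / M) by field; rewrite !gt_eqF.
  by rewrite -[leRHS]mulr1; exact: ler_wpM2l a2 _ _ DM.
have e5 : 4 * (M / a) * (2 * t ^+ 2 + t * D) / (a / M) <= a.
  have h1 : 2 * t ^+ 2 + t * D <= t * (3 * M) by rewrite /M; nra.
  have -> : 4 * (M / a) * (2 * t ^+ 2 + t * D) / (a / M) =
      (2 * t ^+ 2 + t * D) * (4 * M ^+ 2 / a ^+ 2) by field; rewrite !gt_eqF.
  have h2 : 0 <= 4 * M ^+ 2 / a ^+ 2 by rewrite divr_ge0 ?mulr_ge0 ?exprn_ge0 // ltW.
  apply: le_trans (ler_wpM2r h2 h1) _.
  have -> : t * (3 * M) * (4 * M ^+ 2 / a ^+ 2) = a.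
    by rewrite /t; field; rewrite !gt_eqF.
  exact: lexx.
lra.
Qed.

End Abstract.

(** * The real trace pairing and the Frobenius norm on square matrices *)

Section Matrices.
Variable n : nat.
Implicit Types x y : 'M[C]_n.

Let B x y : R := retr (x *m y).
Let q x : R := retr (x *m adjmx x).

Lemma sqnorm_ge0 x : 0 <= q x.
Proof. exact/ge0_Re/psd_tr_ge0/psd_gram. Qed.

Lemma mxpairDl (s t : R) x x' y :
  B (s%:C *: x + t%:C *: x') y = s * B x y + t * B x' y.
Proof. by rewrite /B mulmxDl -!scalemxAl retrD !retrZ. Qed.

Lemma mxpairDr (s t : R) x y y' :
  B x (s%:C *: y + t%:C *: y') = s * B x y + t * B x y'.
Proof. by rewrite /B mulmxDr -!scalemxAr retrD !retrZ. Qed.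

Lemma sqnorm_comb (s t : R) x y :
  q (s%:C *: x + t%:C *: y) = s ^+ 2 * q x + t ^+ 2 * q y + 2 * s * t * B x (adjmx y).
Proof.
rewrite /q adjmxD !adjmxZ !conj_RC mulmxDl !mulmxDr -!scalemxAl -!scalemxAr.
have -> : B x (adjmx y) = retr (y *m adjmx x) by rewrite -retr_adj adjmxM adjmxK.
have : retr (x *m adjmx y) = retr (y *m adjmx x) by rewrite -retr_adj adjmxM adjmxK.
move: (x *m adjmx x) (x *m adjmx y) (y *m adjmx x) (y *m adjmx y) => a b c d bc.
have eZ (u v : R) (A : 'M[C]_n) : retr (u%:C *: (v%:C *: A)) = u * (v * retr A) by rewrite !retrZ.
rewrite [LHS]retrD [X in X + _ = _]retrD [X in _ + X = _]retrD.
by rewrite (eZ s s a) (eZ s t b) (eZ t s c) (eZ t t d) bc; ring.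
Qed.

(** Nonnegativity of the squared Frobenius norm of s x - y^dag. The adjoint appears because the
    pairing Tr(x y) carries no conjugation. *)
Lemma mxpair_amgm (s : R) x y : 2 * s * B x y <= s ^+ 2 * q x + q y.
Proof.
have := sqnorm_ge0 (s%:C *: x + (- 1)%:C *: adjmx y).
rewrite sqnorm_comb adjmxK.
have -> : q (adjmx y) = q y by rewrite /q adjmxK retrC.
lra.
Qed.

Lemma sqnorm_mid x y : q ((2^-1)%:C *: x + (1 - 2^-1)%:C *: y) =
  2^-1 * q x + 2^-1 * q y - 4^-1 * q (x - y).
Proof.
have -> : x - y = 1%:C *: x + (-1)%:C *: y by rewrite rmorphN rmorph1 scaleN1r scale1r.
rewrite !sqnorm_comb; move: (q x) (q y) (B x _) => a b c; lra.
Qed.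

Lemma minimax (X Y : 'M[C]_n -> Prop) (D c e : R) x1 y1 :
  convexp X -> convexp Y ->
  (forall x, X x -> q x <= D) -> (forall y, Y y -> q y <= D) ->
  0 < e -> X x1 -> Y y1 ->
  (forall x, X x -> exists2 y, Y y & B x y <= c) ->
  exists2 y, Y y & forall x, X x -> B x y <= c + e.
Proof.
move=> cX cY qX qY.
exact: (minimax_abstract mxpairDl mxpairDr sqnorm_ge0 sqnorm_mid mxpair_amgm cX cY qX qY).
Qed.

End Matrices.
End Minimax.

(** * Stability of the test bound *)

Section TestBoundMono.
Variable R : realType.
Local Notation C := R[i].
Local Notation Re := complex.Re.
Local Notation ix := mxtens_index.

Lemma test_bound_pre n0 n m (a : lmap R n0 n) (D : lmap R n m) c :
  linear D -> channel a -> test_bound D c -> test_bound (fun X => D (a X)) c.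
Proof.
move=> lD ca tD k w P hw hP hQ; have [la [cpa _]] := ca.
have [_ [_ tpa]] := channel_tensid k ca.
by rewrite tmap_comp_id // -[X in _ <= c * Re X]tpa; apply: tD => //; exact: cpa.
Qed.

(** The dual of a channel is positive and unital, hence maps effects to effects; unitality is the
    Kraus completeness relation. *)
Lemma test_bound_post n m m' (b : lmap R m m') (D : lmap R n m) c :
  linear D -> channel b -> test_bound D c -> test_bound (fun X => b (D X)) c.
Proof.
move=> lD cb tD k w P hw hP hQ; have [lb _] := cb.
have [K bE /(congr1 (fun M => M *t (1%:M : 'M[C]_k)))] := channel_krausP cb.
rewrite tens11 tensmx_suml => K1.
rewrite tmap_comp_id // {1}bE tmap_krausf_id tr_krausf; apply: tD => //.
  by apply: psd_sum => s _; exact: psd_conjC.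
rewrite -K1 -sumrB; apply: psd_sum => s _.
have -> : (adjmx (K s) *m K s) *t 1%:M = adjmx (K s *t 1%:M) *m 1%:M *m (K s *t (1%:M : 'M[C]_k)).
  by rewrite mulmx1 adjmx_tens tensmx_mul adjmx1 mulmx1.
by rewrite -mulmxBl -mulmxBr; exact: psd_conjC.
Qed.

Lemma tr_castM p q (e e' : p = q) (A : 'M[C]_p) (B : 'M[C]_q) :
  \tr (castmx (e, e') A *m B) = \tr (A *m castmx (esym e, esym e') B).
Proof. by rewrite (eq_irrelevance e' e); case: q / e {e'} B => B; rewrite !castmx_id. Qed.

Lemma cast1 p q (e e' : p = q) : castmx (e, e') 1%:M = 1%:M :> 'M[C]_q.
Proof. by rewrite (eq_irrelevance e' e); case: q / e {e'}; rewrite castmx_id. Qed.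

Lemma castB p q (e e' : p = q) (A B : 'M[C]_p) :
  castmx (e, e') (A - B) = castmx (e, e') A - castmx (e, e') B.
Proof. by rewrite (eq_irrelevance e' e); case: q / e {e'}; rewrite !castmx_id. Qed.

Lemma tmap_tmapA n m j k (D : lmap R n m) (X : 'M[C]_(n * j * k)) : linear D ->
  tmap (tmap D (@idmap R j)) (@idmap R k) X =
  castmx (mulnA m j k, mulnA m j k)
    (tmap D (@idmap R (j * k)) (castmx (esym (mulnA n j k), esym (mulnA n j k)) X)).
Proof.
move=> lD; move: X; apply: tens_ext => [|a u v|A B]; first exact: tmap_linear.
  by rewrite castmx_lin tmap_lin castmx_lin.
rewrite tmap_tens //; last exact: tmap_linear.
move: A; apply: tens_ext => [a u v|a u v|A A'].
- by rewrite tmap_lin tensmx_linl.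
- by rewrite tensmx_linl castmx_lin tmap_lin castmx_lin.
by rewrite tensAV !tmap_tens // tensA.
Qed.

(** [test_bound] quantifies over all references, so an idle system is simply merged with the
    reference. *)
Lemma test_bound_idr n m j (D : lmap R n m) c :
  linear D -> test_bound D c -> test_bound (tmap D (@idmap R j)) c.
Proof.
move=> lD tD k w P hw hP hQ; rewrite tmap_tmapA // tr_castM.
rewrite -(tr_cast (esym (mulnA n j k)) (esym (mulnA n j k)) w); apply: tD.
- exact: psd_cast.
- exact: psd_cast.
- by rewrite -(cast1 (esym (mulnA m j k)) (esym (mulnA m j k))) -castB; exact: psd_cast.
Qed.

Lemma channel_reindex p q (f : 'I_p -> 'I_q) : bijective f ->
  channel (Defs.reindex f : lmap R q p).
Proof.
move=> [g fK gK]; have lf : linear (Defs.reindex f : lmap R q p).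
  by move=> a u v; apply/matrixP => i j; rewrite !mxE.
split=> //; split=> [k X hX|X].
  have -> : tmap (Defs.reindex f : lmap R q p) (@idmap R k) X =
      Defs.reindex (fun a => ix (f (mxtens_unindex a).1, (mxtens_unindex a).2)) X.
    by apply: mxtensP => i x j y; rewrite tmap_idE // !mxE !mxtens_indexK.
  exact: psd_reindex.
rewrite /mxtrace [RHS](reindex f); last by exists g => i _; rewrite ?fK ?gK.
by apply: eq_bigr => i _; rewrite mxE.
Qed.

Definition swapf n m : lmap R (n * m) (m * n) :=
  Defs.reindex (fun a => ix ((mxtens_unindex a).2, (mxtens_unindex a).1)).

Lemma swapf_channel n m : channel (@swapf n m).
Proof.
apply: channel_reindex.
by exists (fun a => ix ((mxtens_unindex a).2, (mxtens_unindex a).1)) => a;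
  rewrite !mxtens_indexK /= -[RHS]mxtens_unindexK; congr ix; rewrite -surjective_pairing.
Qed.

Lemma swapf_tens n m (A : 'M[C]_n) (B : 'M[C]_m) : swapf (A *t B) = B *t A.
Proof.
by apply: mxtensP => i j k l; rewrite mxE !mxtens_indexK !tensmxE mulrC.
Qed.

Lemma test_bound_idl n m u (D : lmap R n m) c :
  linear D -> test_bound D c -> test_bound (tmap (@idmap R u) D) c.
Proof.
move=> lD tD.
have -> : tmap (@idmap R u) D =
    fun X => @swapf m u (tmap D (@idmap R u) (@swapf u n X)).
  apply/funext; apply: tens_ext => [||A B]; first exact: tmap_linear.
    move=> a x y; rewrite (swapf_channel _ _).1 tmap_lin.
    exact: (swapf_channel _ _).1.
  by rewrite swapf_tens !tmap_tens // swapf_tens.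
have [ls _] := swapf_channel u n.
apply: (@test_bound_post _ _ _ (@swapf m u) (fun X => tmap D (@idmap R u) (@swapf u n X))).
- by move=> a x y; rewrite ls tmap_lin.
- exact: swapf_channel.
apply: test_bound_pre; [exact: tmap_linear|exact: swapf_channel|].
exact: test_bound_idr.
Qed.

End TestBoundMono.

(** * Pairings, Choi matrices and test operators *)

Section PairingDuality.
Variable R : realType.
Local Notation C := R[i].
Local Notation Re := complex.Re.
Local Notation ix := mxtens_index.

Lemma choi_adjE n m (f : lmap R n m) p q i j :
  choi (adjmap f) (ix (p, i)) (ix (q, j)) = Num.conj (f (delta_mx p q) i j).
Proof.
rewrite /choi summxE (@big_only1 _ _ _ _ i) // => [|a ai _]; last first.
  by rewrite summxE big1 // => b _; rewrite tensmxE mxE eq_sym (negbTE ai) mulr0.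
rewrite summxE (@big_only1 _ _ _ _ j) // => [|b bj _]; last first.
  by rewrite tensmxE mxE andbC eq_sym (negbTE bj) mulr0.
rewrite tensmxE mxE !eqxx mulr1 /adjmap.
rewrite summxE (@big_only1 _ _ _ _ p) // => [|a ai _]; last first.
  by rewrite summxE big1 // => b _; rewrite !mxE eq_sym (negbTE ai) mulr0.
rewrite summxE (@big_only1 _ _ _ _ q) // => [|b bj _]; last first.
  by rewrite !mxE andbC eq_sym (negbTE bj) mulr0.
by rewrite [LHS]mxE [delta_mx _ _ _ _]mxE !eqxx mulr1 mxtrace_mulC tr_deltaM adjmxE.
Qed.

(** The definition is conjugate-linear in [f]. Preservation of adjoints turns it into an expression
    linear in [f], which then makes sense for differences of channels too; [pval] is its real
    part. *)
Lemma pairingE n m (f : lmap R n m) (X : 'M[C]_(n * m)) : linear f ->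
  (forall X, f (adjmx X) = adjmx (f X)) ->
  pairing X f = \tr (tmap f (@idmap R m) X *m Omega R m).
Proof.
move=> lf hf; rewrite /pairing; move: X.
apply: (@linear_ext_delta R _ _ C^o (fun X => \tr (X *m choi (adjmap f)))
  (fun X => \tr (tmap f (@idmap R m) X *m Omega R m))).
- by move=> a u v; rewrite mulmxDl -scalemxAl mxtraceD mxtraceZ.
- by move=> a u v; rewrite tmap_lin mulmxDl -scalemxAl mxtraceD mxtraceZ.
move=> a b; case: (mxtens_indexP a) => p i; case: (mxtens_indexP b) => q j.
rewrite tr_deltaM choi_adjE -delta_tens tmap_tens // tr_tens_Omega trmx_delta.
rewrite mxtrace_mulC tr_deltaM.
have -> : delta_mx q p = adjmx (delta_mx p q) :> 'M[C]_n.
  by apply/matrixP => x y; rewrite adjmxE !mxE rmorph_nat andbC.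
by rewrite hf adjmxE conjCK.
Qed.

Definition pval n m (X : 'M[C]_(n * m)) (f : lmap R n m) : R :=
  retr (tmap f (@idmap R m) X *m Omega R m).

Lemma Re_pairing n m (f : lmap R n m) (X : 'M[C]_(n * m)) : channel f ->
  Re (pairing X f) = pval X f.
Proof.
move=> [lf [cf _]]; rewrite pairingE // => Y; exact: channel_herm.
Qed.

Lemma tmapB_id n m k (f g : lmap R n m) (X : 'M[C]_(n * k)) : linear f -> linear g ->
  tmap (fun Y => f Y - g Y) (@idmap R k) X =
  tmap f (@idmap R k) X - tmap g (@idmap R k) X.
Proof.
move=> lf lg; move: X; apply: tens_ext => [|a u v|A B]; first exact: tmap_linear.
  by rewrite !tmap_lin scalerBr opprD addrACA.
rewrite !tmap_tens // ?tensmxBl //; exact: linear_subf.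
Qed.

Lemma pvalB n m (X : 'M[C]_(n * m)) (f g : lmap R n m) : linear f -> linear g ->
  pval X (fun Y => f Y - g Y) = pval X f - pval X g.
Proof.
by move=> lf lg; rewrite /pval tmapB_id // mulmxBl retrB.
Qed.

Definition ptr n k (w : 'M[C]_(n * k)) : 'M[C]_n := \sum_x blk w x x.

Lemma ptrE n k (w : 'M[C]_(n * k)) p q : ptr w p q = \sum_x w (ix (p, x)) (ix (q, x)).
Proof. by rewrite summxE; apply: eq_bigr => x _; rewrite mxE. Qed.

Lemma ptr_psd n k (w : 'M[C]_(n * k)) : psd w -> psd (ptr w).
Proof.
move=> hw; apply: psd_sum => x _.
exact: (@psd_reindex R _ _ (fun p => ix (p, x)) w hw).
Qed.

Lemma tr_ptr n k (w : 'M[C]_(n * k)) : \tr (ptr w) = \tr w.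
Proof. by rewrite /mxtrace big_mxtens; apply: eq_bigr => p _; rewrite ptrE. Qed.

Lemma ptr_tens n k (A : 'M[C]_n) (B : 'M[C]_k) : ptr (A *t B) = \tr B *: A.
Proof.
apply/matrixP => p q; rewrite ptrE mxE mulr_suml.
by apply: eq_bigr => x _; rewrite tensmxE mulrC.
Qed.

Lemma tr_ptrM n k (A : 'M[C]_n) (w : 'M[C]_(n * k)) :
  \tr ((A *t 1%:M) *m w) = \tr (A *m ptr w).
Proof.
rewrite /mxtrace big_mxtens; apply: eq_bigr => p _; rewrite mxE.
under eq_bigr do rewrite mxE big_mxtens.
rewrite exchange_big /=; apply: eq_bigr => q _; rewrite ptrE mulr_sumr.
apply: eq_bigr => x _; rewrite (bigD1 x) //= big1 ?addr0 => [|y yx]; last first.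
  by rewrite tensmxE mxE eq_sym (negbTE yx) mulr0 mul0r.
by rewrite tensmxE mxE eqxx mulr1.
Qed.

(** Choi-Jamiolkowski correspondence in functional form: positivity of [w] yields complete
    positivity and [ptr w = 1] yields trace preservation. With [channel_choi], pairing with channels
    is pairing with such operators. *)
Lemma choi_channel n m (w : 'M[C]_(n * m)) : psd w -> ptr w = 1%:M ->
  exists2 f : lmap R n m, channel f &
    forall X, \tr (tmap f (@idmap R m) X *m Omega R m) = \tr (X *m w).
Proof.
move=> /psd_sqrt[B BE] w1.
pose K s : 'M[C]_(m, n) := \matrix_(i, p) Num.conj (B (ix (p, i)) s).
have fE p q i j : krausf K (delta_mx p q) i j = w (ix (q, j)) (ix (p, i)).
  rewrite BE mxE summxE; apply: eq_bigr => s _.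
  rewrite mxE (@big_only1 _ _ _ _ q) // => [|y yq _]; last first.
    rewrite mxE big1 ?mul0r // => x _.
    by rewrite [delta_mx _ _ _ _]mxE (negbTE yq) andbF mulr0.
  rewrite mxE (@big_only1 _ _ _ _ p) // => [|x xp _]; last first.
    by rewrite [delta_mx _ _ _ _]mxE (negbTE xp) mulr0.
  rewrite [delta_mx _ _ _ _]mxE !eqxx mulr1 !adjmxE !mxE conjCK.
  exact: mulrC.
exists (krausf K).
  apply: channel_krausf; rewrite -w1; apply/matrixP => p q; rewrite ptrE summxE.
  rewrite BE; under [RHS]eq_bigr do rewrite mxE.
  rewrite exchange_big /=; apply: eq_bigr => s _; rewrite mxE; apply: eq_bigr => i _.
  by rewrite adjmxE !mxE conjCK.
apply: (@linear_ext_delta R _ _ C^o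
  (fun X => \tr (tmap (krausf K) (@idmap R m) X *m Omega R m)) (fun X => \tr (X *m w))).
- by move=> a u v; rewrite tmap_lin mulmxDl -scalemxAl mxtraceD mxtraceZ.
- by move=> a u v; rewrite mulmxDl -scalemxAl mxtraceD mxtraceZ.
move=> a b; case: (mxtens_indexP a) => p i; case: (mxtens_indexP b) => q j.
rewrite tr_deltaM -delta_tens tmap_tens //; last exact: krausf_linear.
by rewrite tr_tens_Omega trmx_delta mxtrace_mulC tr_deltaM fE.
Qed.

Lemma channel_choi n m (f : lmap R n m) : channel f ->
  exists w : 'M[C]_(n * m), [/\ psd w, ptr w = 1%:M &
    forall X, \tr (tmap f (@idmap R m) X *m Omega R m) = \tr (X *m w)].
Proof.
move=> cf; have [lf [_ tf]] := cf; have [K fE _] := channel_krausP cf.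
pose w := \sum_s (adjmx (K s *t 1%:M) *m Omega R m *m (K s *t (1%:M : 'M[C]_m))).
have wE X : \tr (tmap f (@idmap R m) X *m Omega R m) = \tr (X *m w).
  by rewrite {1}fE tmap_krausf_id tr_krausf.
exists w; split=> //.
  by apply: psd_sum => s _; apply: psd_conjC; exact: Omega_psd.
apply: tr_ext => A; rewrite -tr_ptrM -wE tmap_tens // tr_tens_Omega.
by rewrite /idmap trmx1 !mulmx1 tf.
Qed.

(** The link product over the reference of dimension k, with [P] transposed. It merges state and
    effect into one operator on input and output, in which k no longer appears. *)
Definition link n m k (w : 'M[C]_(n * k)) (P : 'M[C]_(m * k)) : 'M[C]_(n * m) :=
  \matrix_(a, b) \sum_x \sum_y
    w (ix ((mxtens_unindex a).1, x)) (ix ((mxtens_unindex b).1, y)) *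
    P (ix ((mxtens_unindex b).2, y)) (ix ((mxtens_unindex a).2, x)).

Lemma linkE n m k (w : 'M[C]_(n * k)) (P : 'M[C]_(m * k)) p i q j :
  link w P (ix (p, i)) (ix (q, j)) =
  \sum_x \sum_y w (ix (p, x)) (ix (q, y)) * P (ix (j, y)) (ix (i, x)).
Proof. by rewrite mxE !mxtens_indexK. Qed.

Lemma link_tr n m k (f : lmap R n m) (w : 'M[C]_(n * k)) (P : 'M[C]_(m * k)) :
  linear f ->
  \tr (tmap f (@idmap R m) (link w P) *m Omega R m) = \tr (tmap f (@idmap R k) w *m P).
Proof.
move=> lf; move: w.
apply: (@tens_ext R _ _ _ _ C^o
  (fun w => \tr (tmap f (@idmap R m) (link w P) *m Omega R m))
  (fun w => \tr (tmap f (@idmap R k) w *m P))).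
- move=> a u v; have -> : link (a *: u + v) P = a *: link u P + link v P.
    apply: mxtensP => p i q j; rewrite mxDE mxZE !linkE.
    rewrite mulr_sumr -big_split; apply: eq_bigr => x _ /=.
    rewrite mulr_sumr -big_split; apply: eq_bigr => y _ /=.
    by rewrite !mxE; ring.
  by rewrite tmap_lin mulmxDl -scalemxAl mxtraceD mxtraceZ.
- by move=> a u v; rewrite tmap_lin mulmxDl -scalemxAl mxtraceD mxtraceZ.
move=> A B.
pose M : 'M[C]_m := \matrix_(i, j) \sum_x \sum_y B x y * P (ix (j, y)) (ix (i, x)).
have -> : link (A *t B) P = A *t M.
  apply: mxtensP => p i q j; rewrite linkE tensmxE mxE mulr_sumr.
  apply: eq_bigr => x _; rewrite mulr_sumr; apply: eq_bigr => y _.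
  by rewrite tensmxE mulrA.
rewrite !tmap_tens // tr_tens_Omega /mxtrace big_mxtens; apply: eq_bigr => i _.
rewrite mxE; under [RHS]eq_bigr do rewrite mxE big_mxtens.
rewrite exchange_big /=; apply: eq_bigr => j _; rewrite !mxE mulr_sumr.
apply: eq_bigr => x _; rewrite mulr_sumr; apply: eq_bigr => y _.
by rewrite tensmxE mulrA.
Qed.

(** Contracting the reference index between Gram factors of [w] and [P], the latter conjugated,
    gives a Gram factor of the link product. *)
Lemma link_psd n m k (w : 'M[C]_(n * k)) (P : 'M[C]_(m * k)) :
  psd w -> psd P -> psd (link w P).
Proof.
move=> /psd_sqrt[G ->] /psd_sqrt[H ->].
pose L : 'M[C]_(n * m, n * k * (m * k)) := \matrix_(a, c) \sum_x
  G (ix ((mxtens_unindex a).1, x)) (mxtens_unindex c).1 *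
  Num.conj (H (ix ((mxtens_unindex a).2, x)) (mxtens_unindex c).2).
suff -> : link (G *m adjmx G) (H *m adjmx H) = L *m adjmx L by exact: psd_gram.
apply: mxtensP => p i q j; rewrite linkE mxE big_mxtens.
have Lc s r : L (ix (p, i)) (ix (s, r)) * adjmx L (ix (s, r)) (ix (q, j)) =
    \sum_x \sum_y (G (ix (p, x)) s * adjmx G s (ix (q, y))) *
                  (H (ix (j, y)) r * adjmx H r (ix (i, x))).
  rewrite adjmxE !mxE !mxtens_indexK /= rmorph_sum /= mulr_suml.
  apply: eq_bigr => x _; rewrite mulr_sumr; apply: eq_bigr => y _.
  by rewrite !adjmxE rmorphM /= conjCK; ring.
under [RHS]eq_bigr => s _ do (under eq_bigr => r _ do rewrite Lc; rewrite exchange_big /=).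
rewrite [RHS]exchange_big /=; apply: eq_bigr => x _.
under [RHS]eq_bigr => s _ do rewrite exchange_big /=.
rewrite [RHS]exchange_big /=; apply: eq_bigr => y _; rewrite !mxE mulr_suml.
by apply: eq_bigr => s _; rewrite mulr_sumr.
Qed.

(** With [linkB] and [link_psd] this turns P <= 1 into link w P <= ptr w (x) 1, which is the
    normalisation required by [testop]. *)
Lemma link1 n m k (w : 'M[C]_(n * k)) : link w (1%:M : 'M[C]_(m * k)) = ptr w *t 1%:M.
Proof.
apply: mxtensP => p i q j; rewrite linkE tensmxE ptrE mxE mulr_suml.
apply: eq_bigr => x _; rewrite (bigD1 x) //= big1 ?addr0 => [|y yx]; last first.
  by rewrite mxE ix_eq (negbTE yx) andbF mulr0.
by rewrite mxE ix_eq eqxx andbT eq_sym.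
Qed.

Lemma linkB n m k (w : 'M[C]_(n * k)) (P Q : 'M[C]_(m * k)) :
  link w (P - Q) = link w P - link w Q.
Proof.
apply: mxtensP => p i q j; rewrite mxDE mxNE !linkE -sumrB.
by apply: eq_bigr => x _; rewrite -sumrB; apply: eq_bigr => y _; rewrite !mxE mulrBr.
Qed.

Definition testop n m (T : 'M[C]_(n * m)) : Prop :=
  psd T /\ exists2 s : 'M[C]_n, density s & psd (s *t 1%:M - T).

(** Every test with a reference is a link product, so a bound on one bounded convex set of matrices
    controls all ancilla dimensions at once. *)
Lemma testop_bound n m (D : lmap R n m) c : linear D ->
  (forall T, testop T -> pval T D <= c) -> test_bound D c.
Proof.
move=> lD h k w P hw hP hQ.
have t0 : 0 <= Re (\tr w) by exact/ge0_Re/psd_tr_ge0.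
have [t1|tn0] := eqVneq (Re (\tr w)) 0.
  rewrite t1 (psd_tr0 hw t1) (lin0 (@tmap_linear R _ _ _ _ D _)) mul0mx mulr0.
  by rewrite mxtrace0.
have tp : 0 < Re (\tr w) by rewrite lt_def tn0.
set t := Re (\tr w) in t0 tn0 tp *.
pose w' := (t^-1)%:C *: w.
have hw' : psd w' by apply: psdZ => //; rewrite ler0c invr_ge0.
have tw' : \tr w' = 1.
  rewrite mxtraceZ (ge0_ReE (psd_tr_ge0 hw)) -/t -rmorphM /= mulVf //.
have wE : w = t%:C *: w' by rewrite scalerA -rmorphM /= divff ?scale1r.
have hT : testop (link w' P).
  split; first exact: link_psd.
  exists (ptr w'); first by split; [exact: ptr_psd|rewrite tr_ptr].
  by rewrite -link1 -linkB; exact: link_psd.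
have := h _ hT; rewrite /pval /retr link_tr // => hc.
rewrite wE (linZ (@tmap_linear R _ _ _ _ D _)) -scalemxAl mxtraceZ ReZ mulrC.
by rewrite ler_wpM2r.
Qed.

Lemma sqnorm_le n (x : 'M[C]_n) (b : R) : (forall i j, Re `|x i j| <= b) ->
  retr (x *m adjmx x) <= (n * n)%:R * b ^+ 2.
Proof.
move=> h; rewrite /retr /mxtrace Re_sum.
have -> : (n * n)%:R * b ^+ 2 = \sum_(i < n) \sum_(j < n) b ^+ 2.
  by rewrite sumr_const sumr_const !card_ord -mulrnA mulr_natl.
apply: ler_sum => i _; rewrite mxE Re_sum; apply: ler_sum => j _.
rewrite adjmxE -normCK (ge0_ReE (normr_ge0 _)) -rmorphXn /=.
have : 0 <= Re `|x i j| by rewrite ge0_Re.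
by move: (h i j) => h1 h2; rewrite lerXn2r // nnegrE // (le_trans h2).
Qed.

End PairingDuality.

(** * Duality for the dual diamond norm *)

Section PairingBound.
Variable R : realType.
Local Notation C := R[i].
Local Notation Re := complex.Re.
Local Notation ix := mxtens_index.

Lemma psd_trmx n (A : 'M[C]_n) : psd A -> psd A^T.
Proof.
move=> /psd_sqrt[B ->]; rewrite trmx_mul.
have -> : (adjmx B)^T *m B^T = (adjmx B)^T *m adjmx ((adjmx B)^T).
  congr (_ *m _); apply/matrixP => i j; rewrite adjmxE mxE [in RHS]mxE.
  by rewrite adjmxE conjCK.
exact: psd_gram.
Qed.

Lemma retr_psd_ge0 n (A B : 'M[C]_n) : psd A -> psd B -> 0 <= retr (A *m B).
Proof. by move=> hA hB; exact/ge0_Re/psd_trM_ge0. Qed.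

Lemma psd_retrP n (A : 'M[C]_n) : adjmx A = A ->
  (forall w, density w -> 0 <= retr (w *m A)) -> psd A.
Proof.
move=> hA h v.
have -> : (adjmx v *m A *m v) 0 0 = \tr (v *m adjmx v *m A).
  transitivity (\tr (adjmx v *m A *m v)); first by rewrite /mxtrace big_ord1.
  by rewrite mxtrace_mulC mulmxA.
have hv : psd (v *m adjmx v) by exact: psd_gram.
have real_tr : \tr (v *m adjmx v *m A) = (retr (v *m adjmx v *m A))%:C.
  rewrite /retr RRe_real //; apply/CrealP; rewrite -tr_adjmx !adjmxM adjmxK hA.
  by rewrite mxtrace_mulC.
rewrite real_tr ler0c.
have t0 : 0 <= Re (\tr (v *m adjmx v)) by exact/ge0_Re/psd_tr_ge0.
set t := Re _ in t0; have [t1|tn0] := eqVneq t 0.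
  by rewrite (psd_tr0 hv t1) mul0mx /retr mxtrace0.
have : density ((t^-1)%:C *: (v *m adjmx v)).
  split; first by apply: psdZ => //; rewrite ler0c invr_ge0.
  by rewrite mxtraceZ (ge0_ReE (psd_tr_ge0 hv)) -/t -rmorphM /= mulVf.
move=> /h; rewrite -scalemxAl retrZ pmulr_rge0 // invr_gt0 lt_def tn0.
exact: t0.
Qed.

(** Let M be the largest eigenvalue of the reduced state N of [w], and s its eigenprojector, so that
    Tr w (s (x) 1) = M. Since N/M <= 1, the operator w/M extends to one representing a channel,
    whence Tr(w X)/M <= p. *)
Lemma subpartial_channel n m (X w : 'M[C]_(n * m)) (p : R) : (0 < n)%N -> (0 < m)%N ->
  psd X -> (forall f, channel f -> pval X f <= p) -> density w ->
  exists2 s : 'M[C]_n, density s & retr (w *m X) <= p * retr (w *m (s *t 1%:M)).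
Proof.
move=> n0 m0 hX hp [hw w1]; set N := ptr w.
have hN : psd N by exact: ptr_psd.
have trN : \tr N = 1 by rewrite tr_ptr.
have [U [d [uU d0 NE]]] := psd_spectral hN.
pose i0 := [arg max_(i > Ordinal n0) d i]%O.
have dmax i : d i <= d i0 by rewrite /i0; case: arg_maxP => // j _; exact.
have sumd : \sum_i d i = 1.
  have : retr N = 1 by rewrite /retr trN.
  rewrite /retr NE -mulmxA mxtrace_mulC -mulmxA uU mulmx1 mxtrace_diag Re_sum => <-.
  by apply: eq_bigr => i _; rewrite mxE.
have M0 : 0 < d i0.
  rewrite lt_def d0 andbT; apply/negP => /eqP M0; move: sumd.
  rewrite big1 => [/eqP|i _]; first by rewrite eq_sym oner_eq0.
  by apply/eqP; rewrite eq_le d0 andbT -M0 dmax.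
set M := d i0 in M0 dmax.
pose s := adjmx U *m delta_mx i0 i0 *m U.
have sE : s = fcalc U (fun i => (i == i0)%:R).
  rewrite /s /fcalc; congr (_ *m _ *m _); apply/matrixP => i j; rewrite !mxE.
  case: (eqVneq i j) => [<-|ij]; rewrite ?andbb ?mulr1n ?mulr0n //.
  by case: (eqVneq i i0) ij => [->|//]; rewrite eq_sym => /negbTE ->.
have hs : density s.
  split; first by rewrite sE; apply: fcalc_psd => i; exact: ler0n.
  rewrite /s -mulmxA mxtrace_mulC -mulmxA uU mulmx1 -[delta_mx _ _]mulmx1 tr_deltaM.
  by rewrite mxE eqxx.
exists s => //.
have -> : retr (w *m (s *t 1%:M)) = M.
  rewrite retrC /retr tr_ptrM -/N [X in s *m X]NE /s -!mulmxA mxtrace_mulC -!mulmxA uU.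
  rewrite mulmx1 [U *m (adjmx U *m _)]mulmxA uU mul1mx tr_deltaM !mxE eqxx.
  by [].
pose E : 'M[C]_m := delta_mx (Ordinal m0) (Ordinal m0).
have [hE trE] : density E by exact: density_delta.
have MC0 : 0 <= (M^-1)%:C :> C by rewrite ler0c invr_ge0 ltW.
(* The deficit 1 - N/M, tensored with a fixed state, brings the partial trace to 1. This positive
   addition can only increase the pairing with X. *)
pose w' := (M^-1)%:C *: w + (1%:M - (M^-1)%:C *: N) *t E.
have hc : psd (1%:M - (M^-1)%:C *: N).
  rewrite NE -[(adjmx U *m _ *m U)]/(fcalc U (fun i => (d i)%:C)) -fcalcZ.
  rewrite -(@fcalc1 _ _ U (fun=> 1)) // -scaleN1r -fcalcZ -fcalcD.
  apply: fcalc_psd => i; rewrite mulN1r -rmorphM /= -(rmorph1 (real_complex R)) -rmorphB /= ler0c.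
  by rewrite subr_ge0 mulrC ler_pdivrMr // mul1r.
have hw' : psd w' by apply: psdD; [exact: psdZ|exact: psd_tens].
have pw' : ptr w' = 1%:M.
  have -> : ptr w' = (M^-1)%:C *: N + ptr ((1%:M - (M^-1)%:C *: N) *t E).
    apply/matrixP => a b; rewrite mxDE mxZE !ptrE mulr_sumr -big_split.
    by apply: eq_bigr => x _; rewrite mxDE mxZE.
  by rewrite ptr_tens trE scale1r addrC subrK.
have [f cf fE] := choi_channel hw' pw'.
have : retr (X *m w') <= p by have := hp _ cf; rewrite /pval /retr fE.
rewrite /w' mulmxDr -scalemxAr retrD retrZ => h.
have h2 : 0 <= retr (X *m ((1%:M - (M^-1)%:C *: N) *t E)).
  exact: retr_psd_ge0 hX (psd_tens hc hE).
rewrite [retr (w *m X)]retrC -ler_pdivrMr // mulrC.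
by apply: le_trans h; rewrite lerDl.
Qed.

Lemma channel_exists n m : (0 < m)%N -> exists f : lmap R n m, channel f.
Proof.
move=> m0; have [hE E1] := @density_delta R m (Ordinal m0).
have hw := psd_tens (@psd1 R n) hE.
have [|f cf _] := choi_channel hw; last by exists f.
by rewrite ptr_tens E1 scale1r.
Qed.

(* Semidefinite duality for the dual norm, from minimax over pairs of states. *)
Lemma dual_norm_dominate n m (X : 'M[C]_(n * m)) (p e : R) :
  (0 < n)%N -> (0 < m)%N -> 0 < e -> psd X ->
  (forall f, channel f -> pval X f <= p) ->
  0 <= p /\ exists2 s : 'M[C]_n, density s &
    psd ((p%:C *: s + e%:C *: 1%:M) *t 1%:M - X).
Proof.
move=> n0 m0 e0 hX hp.
pose E : 'M[C]_n := delta_mx (Ordinal n0) (Ordinal n0).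
pose F : 'M[C]_m := delta_mx (Ordinal m0) (Ordinal m0).
have dE : density E by exact: density_delta.
have dF : density F by exact: density_delta.
have dEF : density (E *t F).
  by split; [exact: psd_tens dE.1 dF.1|rewrite tr_tens dE.2 dF.2 mulr1].
have p0 : 0 <= p.
  have [f cf] := @channel_exists n m m0; apply: le_trans (hp _ cf).
  by have [w [hw _ wE]] := channel_choi cf; rewrite /pval /retr wE; exact: retr_psd_ge0.
split=> //.
(* For each state w some s makes the pairing nonpositive, by [subpartial_channel]. Minimax gives a
   single s that keeps it below e for all w, which is an operator inequality. *)
pose Y y := exists2 s : 'M[C]_n, density s & y = X - p%:C *: (s *t (1%:M : 'M[C]_m)).
have dens_conv k (t : R) (x y : 'M[C]_k) : 0 <= t <= 1 -> density x -> density y ->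
    density (t%:C *: x + (1 - t)%:C *: y).
  move=> /andP[t0 t1] [hx x1] [hy y1]; split.
    by apply: psdD; apply: psdZ => //; rewrite ler0c // subr_ge0.
  by rewrite mxtraceD !mxtraceZ x1 y1 !mulr1 -rmorphD /= addrC subrK.
have cY : convexp Y.
  move=> t _ _ ht [s hs ->] [s' hs' ->]; exists (t%:C *: s + (1 - t)%:C *: s').
    exact: dens_conv.
  rewrite tensmxDl !tensmxZl; move: (s *t 1%:M) (s' *t 1%:M) => u u'.
  by apply/matrixP => i j; rewrite !mxE rmorphB rmorph1; ring.
have dens_entry k (x : 'M[C]_k) : density x -> forall i j, Re `|x i j| <= 1.
  by move=> [hx x1] i j; have := psd_entry_le i j hx; rewrite x1.
have [bX hbX] : exists b, forall i j, Re `|X i j| <= b.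
  by exists (Re (\tr X)) => i j; exact: psd_entry_le.
pose b := bX + p.
have qY y : Y y -> retr (y *m adjmx y) <= (n * m * (n * m))%:R * b ^+ 2.
  move=> [s hs ->]; apply: sqnorm_le => i j; rewrite mxDE mxNE mxZE.
  have /= := ler_normB (X i j) (p%:C * (s *t (1%:M : 'M[C]_m)) i j).
  rewrite normrM [`|p%:C|]ger0_norm ?ler0c // lecE => /andP[_]; rewrite ReD ReZ.
  move=> /le_trans; apply; rewrite lerD // -[leRHS]mulr1 ler_wpM2l //.
  case: (mxtens_indexP i) => i1 i2; case: (mxtens_indexP j) => j1 j2.
  rewrite tensmxE mxE; case: eqP => _; last by rewrite mulr0 normr0.
  by rewrite mulr1; exact: dens_entry.
have qX (x : 'M[C]_(n * m)) : density x -> retr (x *m adjmx x) <= (n * m * (n * m))%:R * 1 ^+ 2.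
  by move=> hx; exact: (@sqnorm_le R _ x 1 (dens_entry _ _ hx)).
pose D : R := (n * m * (n * m))%:R * 1 ^+ 2 + (n * m * (n * m))%:R * b ^+ 2.
have D1 : (n * m * (n * m))%:R * 1 ^+ 2 <= D by rewrite lerDl mulr_ge0 // sqr_ge0.
have D2 : (n * m * (n * m))%:R * b ^+ 2 <= D by rewrite lerDr mulr_ge0 // sqr_ge0.
have := @minimax R (n * m) (@density R (n * m)) Y D 0 e _ _ (fun t x y => dens_conv _ t x y) cY
  (fun x hx => le_trans (qX x hx) D1) (fun y hy => le_trans (qY y hy) D2) e0 dEF (ex_intro2 _ _ E dE (erefl _)).
case.
  move=> w hw; have [s hs h] := subpartial_channel n0 m0 hX hp hw.
  exists (X - p%:C *: (s *t 1%:M)); first by exists s.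
  by rewrite mulmxBr -scalemxAr retrB retrZ subr_le0.
move=> _ [s hs ->] h; exists s => //; apply: psd_retrP.
  rewrite adjmxD adjmxN (psd_herm hX) adjmx_tens adjmx1 adjmxD !adjmxZ !conj_RC.
  by rewrite (psd_herm hs.1) adjmx1.
move=> w hw; have := h _ hw; rewrite add0r tensmxDl !tensmxZl tens11.
rewrite !mulmxBr mulmxDr -!scalemxAr mulmx1.
have -> : retr (p%:C *: (w *m (s *t 1%:M)) + e%:C *: w - w *m X) =
   p * retr (w *m (s *t 1%:M)) + e * retr w - retr (w *m X).
  by rewrite retrB retrD !retrZ.
have -> : retr w = 1 by rewrite /retr hw.2.
by rewrite retrB retrZ; lra.
Qed.

Lemma conj_tens1E n m k (s : 'M[C]_(m, n)) (Z : 'M[C]_(n * k)) p i q j :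
  ((s *t (1%:M : 'M[C]_k)) *m Z *m adjmx (s *t (1%:M : 'M[C]_k)))
    (ix (p, i)) (ix (q, j)) =
  \sum_x \sum_y s p x * Z (ix (x, i)) (ix (y, j)) * Num.conj (s q y).
Proof.
rewrite mxE big_mxtens exchange_big /= (@big_only1 _ _ _ _ j) // => [|j' jj _]; last first.
  rewrite big1 // => y _; rewrite adjmxE tensmxE [1%:M _ _]mxE eq_sym (negbTE jj).
  by rewrite mulr0 rmorph0 mulr0.
rewrite [RHS]exchange_big /=; apply: eq_bigr => y _.
rewrite adjmxE tensmxE [1%:M _ _]mxE eqxx mulr1 mxE big_mxtens mulr_suml.
apply: eq_bigr => x _; rewrite (@big_only1 _ _ _ _ i) // => [|i' ii _].
  by rewrite tensmxE [1%:M _ _]mxE eqxx mulr1.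
by rewrite tensmxE [1%:M _ _]mxE eq_sym (negbTE ii) mulr0 mul0r.
Qed.

(** By duality X <= S (x) 1 with S = p s0 + e 1. Here s = S^{1/2} is invertible, and s^{-1} X
    s^{-1}, taken on the input factor, is an effect. The pairing of X with [D] becomes this effect
    tested on the image of the vector |s>>, whose squared norm is p + e n; then e is arbitrary. *)
Lemma pairing_bound n m (D : lmap R n m) (X : 'M[C]_(n * m)) (c p : R) :
  (0 < n)%N -> (0 < m)%N -> linear D -> 0 <= c -> test_bound D c -> psd X ->
  (forall f, channel f -> pval X f <= p) -> pval X D <= c * p.
Proof.
move=> n0 m0 lD c0 tD hX hp; apply: (@le_eps _ _ _ (c * n%:R)) => e e0.
have [p0 [s0 [hs0 s1] hS]] := dual_norm_dominate n0 m0 e0 hX hp.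
have [U [d [uU d0 sE]]] := psd_spectral hs0.
pose r i := Num.sqrt (p * d i + e).
have r0 i : 0 < r i by rewrite sqrtr_gt0 ltr_wpDl // mulr_ge0.
have rr i : r i * r i = p * d i + e by
  rewrite -expr2 sqr_sqrtr //; apply: addr_ge0; [exact: mulr_ge0|exact: ltW].
pose s := fcalc U (fun i => (r i)%:C); pose si := fcalc U (fun i => (r i)^-1%:C).
have sis : s *m si = 1%:M.
  by rewrite fcalcM // fcalc1 // => i; rewrite -rmorphM /= divff // gt_eqF.
have sis' : si *m s = 1%:M by exact: mulmx1C.
have as_ : adjmx s = s by rewrite adjmx_fcalc; apply: eq_fcalc => i; rewrite conj_RC.
have asi : adjmx si = si by rewrite adjmx_fcalc; apply: eq_fcalc => i; rewrite conj_RC.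
have ss : s *m s = p%:C *: s0 + e%:C *: 1%:M.
  rewrite fcalcM // sE -[adjmx U *m _ *m U]/(fcalc U (fun i => (d i)%:C)).
  rewrite -(@fcalc1 _ _ U (fun=> 1)) // -!fcalcZ -fcalcD; apply: eq_fcalc => i.
  by rewrite mulr1 -!rmorphM /= -rmorphD /= rr.
clearbody s si.
(* The vectorisation of s: a pure, unnormalised input whose reference is a copy of the input
   system. *)
pose v : 'cV[C]_(n * n) := \col_a s (mxtens_unindex a).1 (mxtens_unindex a).2.
pose w := v *m adjmx v.
have hw : psd w by exact: psd_gram.
pose P' := (si *t 1%:M) *m X *m adjmx (si *t (1%:M : 'M[C]_m)).
have hP' : psd P' by exact: psd_conj.
have hQ' : psd (1%:M - P').
  have -> : 1%:M - P' = (si *t 1%:M) *m ((p%:C *: s0 + e%:C *: 1%:M) *t 1%:M - X)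
      *m adjmx (si *t (1%:M : 'M[C]_m)).
    rewrite mulmxBr mulmxBl; congr (_ - _); rewrite -ss adjmx_tens asi adjmx1.
    by rewrite !tensmx_mul !mulmx1 mulmxA sis' mul1mx sis tens11.
  exact: psd_conj _ hS.
have XE : X = (s *t 1%:M) *m P' *m adjmx (s *t (1%:M : 'M[C]_m)).
  rewrite /P' !adjmx_tens as_ asi !adjmx1 !mulmxA tensmx_mul sis mulmx1 tens11 mul1mx.
  by rewrite -mulmxA tensmx_mul sis' mulmx1 tens11 mulmx1.
(* The test expects output before reference, whereas P' has the input factor first; the link product
   also transposes. Hence the swap and the transpose. *)
pose sw (a : 'I_(m * n)) := ix ((mxtens_unindex a).2, (mxtens_unindex a).1).
pose P := Defs.reindex sw P'^T.
have hP : psd P by apply: psd_reindex; exact: psd_trmx.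
have hQ : psd (1%:M - P).
  have -> : 1%:M - P = Defs.reindex sw (1%:M - P')^T.
    apply: mxtensP => i x j y; rewrite mxDE mxNE [P _ _]mxE [RHS]mxE.
    rewrite /sw !mxtens_indexK /= ![_^T _ _]mxE mxDE mxNE; congr (_ - _); rewrite !mxE.
    by rewrite !ix_eq andbC [i == j]eq_sym [x == y]eq_sym.
  by apply: psd_reindex; exact: psd_trmx.
have wE a x b y : w (ix (a, x)) (ix (b, y)) = s a x * Num.conj (s b y).
  by rewrite mxE big_ord1 adjmxE !mxE !mxtens_indexK.
have trw : Re (\tr w) = p + e * n%:R.
  have -> : \tr w = \tr (s *m adjmx s).
    rewrite /mxtrace big_mxtens; apply: eq_bigr => a _; rewrite mxE.
    by apply: eq_bigr => x _; rewrite wE adjmxE.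
  rewrite as_ ss -/(retr _) retrD !retrZ /retr s1 mxtrace1 mulr1; congr (_ + _ * _).
  by rewrite -(rmorph_nat (real_complex R)).
have := tD _ w P hw hP hQ; rewrite trw.
suff -> : \tr (tmap D (@idmap R n) w *m P) = \tr (tmap D (@idmap R m) X *m Omega R m).
  by have -> : c * (p + e * n%:R) = c * p + e * (c * n%:R) by ring.
rewrite -link_tr //; congr (\tr (tmap _ _ _ *m _)).
apply: mxtensP => a i b j; rewrite linkE [in RHS]XE conj_tens1E.
apply: eq_bigr => x _; apply: eq_bigr => y _.
by rewrite wE [P _ _]mxE /sw !mxtens_indexK [_^T _ _]mxE mulrAC.
Qed.

End PairingBound.

(** * Superchannels *)

Lemma mulmx_conj_lin (R : realType) m n p q (K : 'M[R[i]]_(m, n)) (L : 'M[R[i]]_(p, q))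
    a (X Y : 'M[R[i]]_(n, p)) :
  K *m (a *: X + Y) *m L = a *: (K *m X *m L) + K *m Y *m L.
Proof. by rewrite mulmxDr mulmxDl -scalemxAr -scalemxAl. Qed.

Ltac lin_tac := by move=> ? ? ?;
  rewrite ?(mulmx_conj_lin, tensmx_linl, tensmx_linr, castmx_lin, tmap_lin).

Section Superchannels.
Variable R : realType.
Local Notation C := R[i].
Local Notation Re := complex.Re.
Local Notation ix := mxtens_index.

Lemma supch_linear a0 a1 a0' a1' b0 b1 u (pre : lmap R a0' (u * a0))
    (post : lmap R (u * a1) a1') (Phi : lmap R (a0 * b0) (a1 * b1)) :
  linear (supch_apply pre post Phi).
Proof. rewrite /supch_apply; lin_tac. Qed.

Lemma supch_channel a0 a1 a0' a1' b0 b1 u (pre : lmap R a0' (u * a0))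
    (post : lmap R (u * a1) a1') (Phi : lmap R (a0 * b0) (a1 * b1)) :
  channel pre -> channel post -> channel Phi -> channel (supch_apply pre post Phi).
Proof.
move=> cpre cpost cPhi; rewrite /supch_apply.
apply: (@channel_comp R _ _ _ (tmap post (@idmap R b1))); first exact: channel_tensid.
apply: (@channel_comp R _ _ _ (fun Z => castmx (mulnA u a1 b1, mulnA u a1 b1) Z)).
  exact: channel_cast.
apply: (@channel_comp R _ _ _ (tmap (@idmap R u) Phi)); first exact: channel_idtens.
apply: (@channel_comp R _ _ _
  (fun Z => castmx (esym (mulnA u a0 b0), esym (mulnA u a0 b0)) Z)).
  exact: channel_cast.
exact: channel_tensid.
Qed.

Lemma supch_test_bound a0 a1 a0' a1' b0 b1 u (pre : lmap R a0' (u * a0))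
    (post : lmap R (u * a1) a1') (D : lmap R (a0 * b0) (a1 * b1)) c :
  channel pre -> channel post -> linear D -> test_bound D c ->
  test_bound (supch_apply pre post D) c.
Proof.
move=> cpre cpost lD tD; rewrite /supch_apply.
apply: (@test_bound_post R _ _ _ (tmap post (@idmap R b1))); first lin_tac.
  exact: channel_tensid.
apply: (@test_bound_post R _ _ _ (fun Z => castmx (mulnA u a1 b1, mulnA u a1 b1) Z)).
- lin_tac.
- exact: channel_cast.
apply: (@test_bound_pre R _ _ _
  (fun X => castmx (esym (mulnA u a0 b0), esym (mulnA u a0 b0)) (tmap pre (@idmap R b0) X))).
- lin_tac.
- apply: (@channel_comp R _ _ _
    (fun Z => castmx (esym (mulnA u a0 b0), esym (mulnA u a0 b0)) Z)).
    exact: channel_cast.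
  exact: channel_tensid.
exact: test_bound_idl.
Qed.

Lemma tmap_idB n m u (f g : lmap R n m) X : linear f -> linear g ->
  tmap (@idmap R u) (fun Y => f Y - g Y) X =
  tmap (@idmap R u) f X - tmap (@idmap R u) g X.
Proof.
move=> lf lg; move: X; apply: tens_ext => [|a x y|A B]; first lin_tac.
  by rewrite !tmap_lin scalerBr opprD addrACA.
rewrite !tmap_tens // /idmap; last exact: linear_subf.
by apply/matrixP => i j; rewrite !mxE mulrBr.
Qed.

Lemma supchB a0 a1 a0' a1' b0 b1 u (pre : lmap R a0' (u * a0))
    (post : lmap R (u * a1) a1') (f g : lmap R (a0 * b0) (a1 * b1)) X :
  linear f -> linear g ->
  supch_apply pre post (fun Y => f Y - g Y) X =
  supch_apply pre post f X - supch_apply pre post g X.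
Proof.
by move=> lf lg; rewrite /supch_apply tmap_idB // castB (linB (@tmap_linear R _ _ _ _ post _)).
Qed.

Lemma supch_tens a0 a1 a0' a1' b0 b1 u (pre : lmap R a0' (u * a0))
    (post : lmap R (u * a1) a1') (Phi : lmap R (a0 * b0) (a1 * b1)) A B :
  linear pre ->
  supch_apply pre post Phi (A *t B) =
  tmap post (@idmap R b1) (castmx (mulnA u a1 b1, mulnA u a1 b1)
    (tmap (@idmap R u) Phi
      (castmx (esym (mulnA u a0 b0), esym (mulnA u a0 b0)) (pre A *t B)))).
Proof. by move=> lpre; rewrite /supch_apply tmap_tens. Qed.

Definition comp_pre a0 a0' r0 u u' (pre' : lmap R r0 (u' * a0'))
    (pre : lmap R a0' (u * a0)) : lmap R r0 (u' * u * a0) :=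
  fun X => castmx (mulnA u' u a0, mulnA u' u a0) (tmap (@idmap R u') pre (pre' X)).

(** The inner postprocessing with the outer ancilla idle. It is kept apart from the outer
    postprocessing because in a guessing game a measurement takes the place of the latter. *)
Definition comp_mid a1 a1' u u' (post : lmap R (u * a1) a1') :
    lmap R (u' * u * a1) (u' * a1') :=
  fun Y => tmap (@idmap R u') post
    (castmx (esym (mulnA u' u a1), esym (mulnA u' u a1)) Y).

Lemma comp_pre_channel a0 a0' r0 u u' (pre' : lmap R r0 (u' * a0'))
    (pre : lmap R a0' (u * a0)) :
  channel pre' -> channel pre -> channel (comp_pre pre' pre).
Proof.
move=> c' c.
apply: (@channel_comp R _ _ _ (fun Z => castmx (mulnA u' u a0, mulnA u' u a0) Z)).
  exact: channel_cast.
by apply: (@channel_comp R _ _ _ (tmap (@idmap R u') pre)) => //; exact: channel_idtens.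
Qed.

Lemma comp_mid_channel a1 a1' u u' (post : lmap R (u * a1) a1') :
  channel post -> channel (@comp_mid a1 a1' u u' post).
Proof.
move=> c; apply: (@channel_comp R _ _ _ (tmap (@idmap R u') post)).
  exact: channel_idtens.
exact: channel_cast.
Qed.

(** Each layer is evaluated on product operators; its output is then generalised and decomposed into
    products again. The reassociations [castmx] disappear on products. The same peeling serves for
    the guessing games. *)
Lemma supch_comp a0 a1 a0' a1' r0 r1 b0 b1 u u'
    (pre : lmap R a0' (u * a0)) (post : lmap R (u * a1) a1')
    (pre' : lmap R r0 (u' * a0')) (post' : lmap R (u' * a1') r1)
    (Phi : lmap R (a0 * b0) (a1 * b1)) :
  linear pre -> linear post -> linear pre' -> linear post' -> linear Phi ->
  supch_apply pre' post' (supch_apply pre post Phi) =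
  supch_apply (comp_pre pre' pre) (fun Y => post' (comp_mid post Y)) Phi.
Proof.
move=> lpre lpost lpre' lpost' lPhi; apply/funext.
have lpp : linear (comp_pre pre' pre) by move=> a x y; rewrite /comp_pre lpre' tmap_lin castmx_lin.
have lpo : linear (fun Y => post' (@comp_mid a1 a1' u u' post Y)).
  by move=> a x y; rewrite /comp_mid castmx_lin tmap_lin lpost'.
apply: tens_ext => [||A B]; [exact: supch_linear|exact: supch_linear|].
rewrite !supch_tens // {1}/comp_pre; move: (pre' A) => Z {A}.
move: Z; apply: tens_ext => [||P Q]; [lin_tac|lin_tac|].
rewrite tensAV [tmap _ pre _]tmap_tens // /idmap.
rewrite [tmap _ (supch_apply _ _ _) _]tmap_tens //; last exact: supch_linear.
rewrite supch_tens // /idmap; move: (pre Q) => Z {Q}.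
move: Z; apply: tens_ext => [||S T]; [lin_tac|lin_tac|].
rewrite !tensAV tensA tensAV !tmap_tens // /idmap; move: (Phi _) => W.
move: W; apply: tens_ext => [||F G]; [lin_tac|lin_tac|].
rewrite !tensA !tmap_tens // tensA tmap_tens // /idmap /comp_mid tensAV tmap_tens //.
Qed.

Lemma outputs_comp a0 a1 a0' a1' r0 r1 b0 b1 u'
    (pre' : lmap R r0 (u' * a0')) (post' : lmap R (u' * a1') r1)
    (Phi : lmap R (a0 * b0) (a1 * b1)) (Psi : lmap R (a0' * b0) (a1' * b1)) :
  (0 < u')%N -> channel pre' -> channel post' -> channel Phi ->
  superch_outputs Phi Psi ->
  @superch_outputs R a0 a1 r0 r1 b0 b1 Phi (supch_apply pre' post' Psi).
Proof.
move=> u0' c1' c2' cPhi [u [pre [post [u0 c1 c2 ->]]]].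
exists (u' * u)%N, (comp_pre pre' pre), (fun Y => post' (comp_mid post Y)); split.
- by rewrite muln_gt0 u0'.
- exact: comp_pre_channel.
- apply: channel_comp => //; exact: comp_mid_channel.
by apply: supch_comp; [exact: c1.1|exact: c2.1|exact: c1'.1|exact: c2'.1|exact: cPhi.1].
Qed.

Lemma outputs_channel a0 a1 a0' a1' b0 b1 (Phi : lmap R (a0 * b0) (a1 * b1))
    (Psi : lmap R (a0' * b0) (a1' * b1)) :
  channel Phi -> superch_outputs Phi Psi -> channel Psi.
Proof. by move=> cPhi [u [pre [post [_ c1 c2 ->]]]]; exact: supch_channel. Qed.

Lemma outputs_self a0 a1 b0 b1 (Phi : lmap R (a0 * b0) (a1 * b1)) :
  channel Phi -> @superch_outputs R a0 a1 a0 a1 b0 b1 Phi Phi.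
Proof.
move=> [lPhi _].
pose pre : lmap R a0 (1 * a0) := fun X => castmx (esym (mul1n _), esym (mul1n _)) X.
pose post : lmap R (1 * a1) a1 := fun X => castmx (mul1n _, mul1n _) X.
have preE X : pre X = 1 *t X by rewrite tens_scalar1mx.
have postE X : post (1 *t X) = X by rewrite tens_scalar1mx /post castmx_comp castmx_id.
have cpre : channel pre by exact: channel_cast.
have cpost : channel post by exact: channel_cast.
exists 1%N, pre, post; split=> //; apply/funext.
apply: tens_ext => [//||A B]; first exact: supch_linear.
rewrite supch_tens; last exact: cpre.1.
rewrite preE tensAV tmap_tens // /idmap; move: (Phi _) => W.
move: W; apply: tens_ext => [//||F G]; first lin_tac.
by rewrite tensA tmap_tens //; [rewrite postE|exact: cpost.1].
Qed.

(** The ancilla is the direct sum of the two ancillas. Preprocessing enters the branches with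
    weights t and 1 - t, leaving a block-diagonal state, and postprocessing applies the map
    belonging to the block it finds. *)
Lemma outputs_convex a0 a1 a0' a1' b0 b1 (Phi : lmap R (a0 * b0) (a1 * b1))
    (Psi1 Psi2 : lmap R (a0' * b0) (a1' * b1)) (t : R) :
  channel Phi -> 0 <= t <= 1 -> superch_outputs Phi Psi1 -> superch_outputs Phi Psi2 ->
  superch_outputs Phi (fun X => t%:C *: Psi1 X + (1 - t)%:C *: Psi2 X).
Proof.
move=> [lPhi _] /andP[t0 t1] [u1 [pre1 [post1 [u10 cpre1 cpost1 ->]]]]
  [u2 [pre2 [post2 [u20 cpre2 cpost2 ->]]]].
have [K1 K1E K11] := channel_krausP cpre1; have [K2 K2E K21] := channel_krausP cpre2.
have [L1 L1E L11] := channel_krausP cpost1; have [L2 L2E L21] := channel_krausP cpost2.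
pose J1 := inlmx R u1 u2; pose J2 := inrmx R u1 u2.
pose s1 := Num.sqrt t; pose s2 := Num.sqrt (1 - t).
have s11 : s1 * s1 = t by rewrite -expr2 sqr_sqrtr.
have s22 : s2 * s2 = 1 - t by rewrite -expr2 sqr_sqrtr // subr_ge0.
pose K (s : 'I_(u1 * a0 * a0') + 'I_(u2 * a0 * a0')) : 'M[C]_((u1 + u2) * a0, a0') :=
  match s with
  | inl s => s1%:C *: ((J1 *t 1%:M) *m K1 s)
  | inr s => s2%:C *: ((J2 *t 1%:M) *m K2 s) end.
pose L (s : 'I_(a1' * (u1 * a1)) + 'I_(a1' * (u2 * a1))) : 'M[C]_(a1', (u1 + u2) * a1) :=
  match s with
  | inl s => L1 s *m adjmx (J1 *t 1%:M)
  | inr s => L2 s *m adjmx (J2 *t 1%:M) end.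
have JJ k : adjmx (J1 *t (1%:M : 'M[C]_k)) *m (J1 *t 1%:M) = 1%:M.
  by rewrite adjmx_tens tensmx_mul inlK adjmx1 mul1mx tens11.
have JJ' k : adjmx (J2 *t (1%:M : 'M[C]_k)) *m (J2 *t 1%:M) = 1%:M.
  by rewrite adjmx_tens tensmx_mul inrK adjmx1 mul1mx tens11.
have cK : channel (krausf K).
  apply: channel_krausf; rewrite big_sumType /=.
  have e1 s : adjmx (K (inl s)) *m K (inl s) = t%:C *: (adjmx (K1 s) *m K1 s).
    rewrite /K adjmxZ conj_RC adjmxM -scalemxAl -scalemxAr scalerA -rmorphM /= s11.
    by rewrite -mulmxA [X in _ *m X]mulmxA JJ mul1mx.
  have e2 s : adjmx (K (inr s)) *m K (inr s) = (1 - t)%:C *: (adjmx (K2 s) *m K2 s).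
    rewrite /K adjmxZ conj_RC adjmxM -scalemxAl -scalemxAr scalerA -rmorphM /= s22.
    by rewrite -mulmxA [X in _ *m X]mulmxA JJ' mul1mx.
  rewrite (eq_bigr _ (fun s _ => e1 s)) (eq_bigr _ (fun s _ => e2 s)).
  by rewrite -!scaler_sumr K11 K21 -scalerDl -rmorphD /= addrC subrK scale1r.
have cL : channel (krausf L).
  apply: channel_krausf; rewrite big_sumType /=.
  under eq_bigr => s _ do rewrite adjmxM adjmxK -mulmxA [adjmx (L1 _) *m _]mulmxA mulmxA.
  under [X in _ + X]eq_bigr => s _ do
    rewrite adjmxM adjmxK -mulmxA [adjmx (L2 _) *m _]mulmxA mulmxA.
  rewrite -!mulmx_suml -!mulmx_sumr L11 L21 !mulmx1 !adjmx_tens !tensmx_mul adjmx1 mul1mx.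
  by rewrite -tensmxDl inlr1 tens11.
have preE X : krausf K X =
    t%:C *: ((J1 *t 1%:M) *m pre1 X *m adjmx (J1 *t 1%:M)) +
    (1 - t)%:C *: ((J2 *t 1%:M) *m pre2 X *m adjmx (J2 *t 1%:M)).
  rewrite /krausf big_sumType /= K1E K2E /krausf !mulmx_sumr !mulmx_suml !scaler_sumr.
  congr (_ + _); apply: eq_bigr => s _; rewrite adjmxZ conj_RC adjmxM -!scalemxAl -scalemxAr
    scalerA -rmorphM /= ?s11 ?s22 !mulmxA //.
have postE Y : krausf L Y =
    post1 (adjmx (J1 *t 1%:M) *m Y *m (J1 *t 1%:M)) +
    post2 (adjmx (J2 *t 1%:M) *m Y *m (J2 *t 1%:M)).
  rewrite /krausf big_sumType /= L1E L2E /krausf.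
  by congr (_ + _); apply: eq_bigr => s _; rewrite adjmxM adjmxK !mulmxA.
exists (u1 + u2)%N, (krausf K), (krausf L); split=> //.
  by rewrite addn_gt0 u10.
have lK := cK.1; have lL := cL.1.
apply/funext; apply: tens_ext => [a x y|a x y|A B].
- rewrite !supch_linear !scalerDr !scalerA addrACA; congr (_ + _).
  by rewrite [_ * a]mulrC [(1 - t)%:C * a]mulrC.
- by rewrite supch_linear.
rewrite !supch_tens //; [|exact: cpre2.1|exact: cpre1.1].
rewrite preE.
pose M Z := tmap (krausf L) (@idmap R b1)
  (castmx (mulnA (u1 + u2) a1 b1, mulnA (u1 + u2) a1 b1) (tmap (@idmap R (u1 + u2)) Phi
    (castmx (esym (mulnA (u1 + u2) a0 b0), esym (mulnA (u1 + u2) a0 b0)) (Z *t B)))).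
have lM : linear M by rewrite /M; lin_tac.
rewrite -/(M _) lM (linZ lM); congr (_ *: _ + _ *: _); rewrite /M {M lM}.
  move: (pre1 A) => Z; move: Z; apply: tens_ext => [||P Q]; [lin_tac|lin_tac|].
  rewrite adjmx_tens adjmx1 !tensmx_mul mul1mx mulmx1 !tensAV !tmap_tens // /idmap.
  move: (Phi _) => W; move: W; apply: tens_ext => [||F G]; [lin_tac|lin_tac|].
  rewrite !tensA !tmap_tens //; last exact: cpost1.1.
  (* Orthogonality of the embeddings ([inrl0]) removes the postprocessing of the other branch. *)
  rewrite postE !adjmx_tens !adjmx1 !tensmx_mul !mul1mx !mulmx1 !mulmxA inlK inrl0.
  by rewrite !mul0mx tens0mx (lin0 cpost2.1) addr0 mul1mx -mulmxA inlK mulmx1.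
move: (pre2 A) => Z; move: Z; apply: tens_ext => [||P Q]; [lin_tac|lin_tac|].
rewrite adjmx_tens adjmx1 !tensmx_mul mul1mx mulmx1 !tensAV !tmap_tens // /idmap.
move: (Phi _) => W; move: W; apply: tens_ext => [||F G]; [lin_tac|lin_tac|].
rewrite !tensA !tmap_tens //; last exact: cpost2.1.
rewrite postE !adjmx_tens !adjmx1 !tensmx_mul !mul1mx !mulmx1 !mulmxA inrK inlr0.
by rewrite !mul0mx tens0mx (lin0 cpost1.1) add0r mul1mx -mulmxA inrK mulmx1.
Qed.

End Superchannels.

(** * Guessing games *)

Section TraceMatrix.
Variable R : realType.
Local Notation C := R[i].

(* Traces as 1 x 1 matrices, so that [tens_ext] applies to them. *)
Definition trm n (A : 'M[C]_n) : 'M[C]_1 := (\tr A)%:M.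

Lemma trm_inj m n (A : 'M[C]_m) (B : 'M[C]_n) : trm A = trm B -> \tr A = \tr B.
Proof. by move=> /matrixP/(_ 0 0); rewrite !mxE eqxx !mulr1n. Qed.

Lemma trm_mul_lin m n a (X Y : 'M[C]_(m, n)) (P : 'M[C]_(n, m)) :
  trm ((a *: X + Y) *m P) = a *: trm (X *m P) + trm (Y *m P).
Proof.
rewrite /trm mulmxDl -scalemxAl mxtraceD mxtraceZ.
by apply/matrixP => i j; rewrite !mxE mulrnDl mulrnAr.
Qed.

End TraceMatrix.

Ltac trlin_tac := by move=> ? ? ?;
  rewrite ?(mulmx_conj_lin, tensmx_linl, tensmx_linr, castmx_lin, tmap_lin) trm_mul_lin.

Section GuessingGames.
Variable R : realType.
Local Notation C := R[i].
Local Notation Re := complex.Re.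
Local Notation ix := mxtens_index.

(** A superchannel stopped before its postprocessing: the ancilla is still open for the player to
    measure. *)
Definition halfch a0 a1 b0 b1 r0 u (alpha : lmap R r0 (u * a0))
    (Phi : lmap R (a0 * b0) (a1 * b1)) : lmap R (r0 * b0) (u * (a1 * b1)) :=
  fun Y => tmap (@idmap R u) Phi
    (castmx (esym (mulnA u a0 b0), esym (mulnA u a0 b0)) (tmap alpha (@idmap R b0) Y)).

Lemma halfch_linear a0 a1 b0 b1 r0 u (alpha : lmap R r0 (u * a0))
    (Phi : lmap R (a0 * b0) (a1 * b1)) : linear (halfch alpha Phi).
Proof. rewrite /halfch; lin_tac. Qed.

Lemma halfch_test_bound a0 a1 b0 b1 r0 u (alpha : lmap R r0 (u * a0))
    (D : lmap R (a0 * b0) (a1 * b1)) c :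
  channel alpha -> linear D -> test_bound D c -> test_bound (halfch alpha D) c.
Proof.
move=> ca lD tD.
apply: (@test_bound_pre R _ _ _
  (fun X => castmx (esym (mulnA u a0 b0), esym (mulnA u a0 b0)) (tmap alpha (@idmap R b0) X))).
- lin_tac.
- apply: (@channel_comp R _ _ _
    (fun Z => castmx (esym (mulnA u a0 b0), esym (mulnA u a0 b0)) Z)).
    exact: channel_cast.
  exact: channel_tensid.
exact: test_bound_idl.
Qed.

Lemma reorder_bij u a1 b1 r1 : bijective (@reorder_idx u a1 b1 r1).
Proof.
pose g (q : 'I_(u * a1 * r1 * (b1 * b1))) : 'I_(u * (a1 * b1) * (r1 * b1)) :=
  let x := mxtens_unindex q in let y := mxtens_unindex x.1 in
  let ua := mxtens_unindex y.1 in let bb := mxtens_unindex x.2 in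
  ix (ix (ua.1, ix (ua.2, bb.1)), ix (y.2, bb.2)).
exists g => p.
  case: (mxtens_indexP p) => x y; case: (mxtens_indexP x) => i z.
  case: (mxtens_indexP z) => j k; case: (mxtens_indexP y) => l m.
  by rewrite /g /reorder_idx !mxtens_indexK.
case: (mxtens_indexP p) => x y; case: (mxtens_indexP x) => z l.
case: (mxtens_indexP z) => i j; case: (mxtens_indexP y) => k m.
by rewrite /g /reorder_idx !mxtens_indexK.
Qed.

Lemma tr_reindexM p q (f : 'I_p -> 'I_q) (A B : 'M[C]_q) : bijective f ->
  \tr (Defs.reindex f A *m Defs.reindex f B) = \tr (A *m B).
Proof.
move=> bf; have e : {on predT, bijective f} by case: bf => g fK gK; exists g => i _; rewrite ?fK ?gK.
rewrite /mxtrace [RHS](reindex f e); apply: eq_bigr => i _.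
rewrite !mxE [RHS](reindex f e); apply: eq_bigr => j _.
by rewrite !mxE.
Qed.

Lemma reindex_reorder u a1 b1 r1 (P : 'M[C]_u) (F : 'M[C]_a1) (G : 'M[C]_b1)
    (E : 'M[C]_r1) (D : 'M[C]_b1) :
  Defs.reindex (@reorder_idx u a1 b1 r1) (((P *t F) *t E) *t (G *t D)) =
  (P *t (F *t G)) *t (E *t D).
Proof.
apply/matrixP => p q.
case: (mxtens_indexP p) => x y; case: (mxtens_indexP x) => i z.
case: (mxtens_indexP z) => j k; case: (mxtens_indexP y) => l m.
case: (mxtens_indexP q) => x' y'; case: (mxtens_indexP x') => i' z'.
case: (mxtens_indexP z') => j' k'; case: (mxtens_indexP y') => l' m'.
rewrite mxE /reorder_idx !mxtens_indexK /= !tensmxE; ring.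
Qed.

Lemma tr_reorder u a1 b1 r1 (P : 'M[C]_u) (F : 'M[C]_a1) (G : 'M[C]_b1)
    (E : 'M[C]_r1) (D : 'M[C]_b1) (N : 'M[C]_(u * a1 * r1)) (M : 'M[C]_(b1 * b1)) :
  \tr (((P *t (F *t G)) *t (E *t D)) *m Defs.reindex (@reorder_idx u a1 b1 r1) (N *t M)) =
  \tr (((P *t F) *t E) *m N) * \tr ((G *t D) *m M).
Proof.
by rewrite -reindex_reorder (tr_reindexM _ _ (reorder_bij _ _ _ _)) tensmx_mul tr_tens.
Qed.

Definition kadj n m (S : finType) (K : S -> 'M[C]_(m, n)) (P : 'M[C]_m) : 'M[C]_n :=
  \sum_s (adjmx (K s) *m P *m K s).

Lemma kadj_measurement (I : finType) n m (S : finType) (K : S -> 'M[C]_(m, n))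
    (N : I -> 'M[C]_m) :
  \sum_s (adjmx (K s) *m K s) = 1%:M -> measurement N ->
  measurement (fun i => kadj K (N i)).
Proof.
move=> K1 [hN N1]; split=> [i|].
  by apply: psd_sum => s _; exact: psd_conjC.
rewrite /kadj exchange_big /= -K1; apply: eq_bigr => s _.
by rewrite -mulmx_suml -mulmx_sumr N1 mulmx1.
Qed.

(** A player holding an output of [Phi] can be imitated with [Phi] itself: the preprocessing is
    composed into the strategy, and the postprocessing is pulled back into the measurement by its
    dual, uniformly in the ensemble and in [M]. *)
Lemma PM_absorb a0 a1 a0' a1' b0 b1 r0 r1 u u0 (k : nat)
    (pre : lmap R a0' (u0 * a0)) (post : lmap R (u0 * a1) a1')
    (Phi : lmap R (a0 * b0) (a1 * b1)) (alpha : lmap R r0 (u * a0'))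
    (N : 'I_k -> 'M[C]_(u * a1' * r1)) :
  channel pre -> channel post -> linear Phi -> channel alpha -> measurement N ->
  exists2 N' : 'I_k -> 'M[C]_(u * u0 * a1 * r1), measurement N' &
  forall i (M : 'M[C]_(b1 * b1)) (rho : 'M[C]_(r0 * b0 * (r1 * b1))),
  \tr (tmap (halfch alpha (supch_apply pre post Phi)) (@idmap R (r1 * b1)) rho
        *m Defs.reindex (@reorder_idx u a1' b1 r1) (N i *t M)) =
  \tr (tmap (halfch (comp_pre alpha pre) Phi) (@idmap R (r1 * b1)) rho
        *m Defs.reindex (@reorder_idx (u * u0) a1 b1 r1) (N' i *t M)).
Proof.
move=> cpre cpost lPhi calpha hN; have [lpre _] := cpre; have [lpost _] := cpost.
have [la _] := calpha.
have cQ := @comp_mid_channel R a1 a1' u0 u post cpost.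
have [L LE L1] := channel_krausP cQ; have [lQ _] := cQ.
have cLr := channel_tensid r1 cQ.
have L1' : \sum_s (adjmx (L s *t (1%:M : 'M[C]_r1)) *m (L s *t 1%:M)) = 1%:M.
  under eq_bigr do rewrite adjmx_tens adjmx1 tensmx_mul mul1mx.
  by rewrite -tensmx_suml L1 tens11.
exists (fun i => kadj (fun s => L s *t (1%:M : 'M[C]_r1)) (N i)).
  exact: kadj_measurement.
move=> i M rho; apply: trm_inj.
have lpp : linear (comp_pre alpha pre) by exact: (comp_pre_channel calpha cpre).1.
have adjE Y E : \tr ((Y *t E) *m kadj (fun s => L s *t (1%:M : 'M[C]_r1)) (N i)) =
    \tr ((comp_mid post Y *t E) *m N i).
  rewrite -tr_krausf -tmap_krausf_id -LE tmap_tens //.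
move: rho; apply: tens_ext => [||Y Z]; [trlin_tac|trlin_tac|].
rewrite !tmap_tens //; try exact: halfch_linear.
rewrite /idmap; move: Y; apply: tens_ext => [a x y|a x y|A B].
- by rewrite halfch_linear tensmx_linl trm_mul_lin.
- by rewrite halfch_linear tensmx_linl trm_mul_lin.
move: Z; apply: tens_ext => [||E D]; [trlin_tac|trlin_tac|].
rewrite /halfch !tmap_tens // {1}/comp_pre /idmap; move: (alpha A) => W.
move: W; apply: tens_ext => [||P Q]; [trlin_tac|trlin_tac|].
rewrite tensAV [tmap _ pre _]tmap_tens // /idmap.
rewrite [tmap _ (supch_apply _ _ _) _]tmap_tens //; last exact: supch_linear.
rewrite supch_tens // /idmap; move: (pre Q) => W.
move: W; apply: tens_ext => [||S T]; [trlin_tac|trlin_tac|].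
rewrite !tensAV tensA tensAV !tmap_tens // /idmap; move: (Phi _) => W.
move: W; apply: tens_ext => [||F G]; [trlin_tac|trlin_tac|].
rewrite tensA tmap_tens // /idmap /trm !tr_reorder adjE.
by rewrite /comp_mid tensAV tmap_tens.
Qed.

Lemma pval_discrimination (I : finType) n (lam : I -> R) (rho : I -> 'M[C]_n)
    (f : lmap R n #|I|) : linear f ->
  pval (\sum_i (lam i)%:C *: (rho i *t delta_mx (enum_rank i) (enum_rank i))) f =
  \sum_i lam i * Re (f (rho i) (enum_rank i) (enum_rank i)).
Proof.
move=> lf; rewrite /pval (lin_sum (@tmap_linear R _ _ _ _ f _)) mulmx_suml retr_sum.
apply: eq_bigr => i _; rewrite (linZ (@tmap_linear R _ _ _ _ f _)) -scalemxAl retrZ.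
rewrite tmap_tens // /idmap /retr tr_tens_Omega trmx_delta mxtrace_mulC.
by rewrite tr_deltaM.
Qed.

Lemma Re_sumZ (I : finType) (lam : I -> R) (F : I -> C) :
  Re (\sum_i (lam i)%:C * F i) = \sum_i lam i * Re (F i).
Proof. by rewrite Re_sum; apply: eq_bigr => i _; rewrite ReZ. Qed.

Lemma ensemble_card_gt0 (I : finType) n (lam : I -> R) (rho : I -> 'M[C]_n) :
  ensemble lam rho -> (0 < #|I|)%N.
Proof.
move=> [_ lam1 _]; rewrite lt0n; apply/negP => /eqP /card0_eq I0.
by move: lam1; rewrite big_pred0 => [/eqP|i]; [rewrite eq_sym oner_eq0|have := I0 i].
Qed.

(** The ensemble becomes a classical-quantum operator X and the measurement [F] a channel into a
    register with [#|I|] levels. The guessing value is then a pairing of X with D followed by this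
    channel, to which [pairing_bound] applies. *)
Lemma discrimination_bound (I : finType) n m q (D : lmap R n m) (c p : R)
    (lam : I -> R) (rho : I -> 'M[C]_(n * q)) (F : I -> 'M[C]_(m * q)) :
  (0 < n)%N -> (0 < q)%N -> linear D -> 0 <= c -> test_bound D c ->
  ensemble lam rho -> measurement F ->
  (forall M, measurement M -> psucc_with lam rho M <= p) ->
  \sum_i lam i * retr (tmap D (@idmap R q) (rho i) *m F i) <= c * p.
Proof.
move=> n0 q0 lD c0 tD hE [hF F1] hp.
have I0 := ensemble_card_gt0 hE; case: hE => lam0 lam1 hrho.
have /choice[B BE] : forall i, exists B : 'M[C]_(m * q), F i = B *m adjmx B by move=> i; exact: psd_sqrt.
pose r (i : I) : 'I_#|I| := enum_rank i.
(* Measure-and-record channel: with F_i = B_i B_i^dag, the operators |i><j| B_i^dag write the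
   outcome i into the register. *)
pose K (s : I * 'I_(m * q)) : 'M[C]_(#|I|, m * q) := delta_mx (r s.1) s.2 *m adjmx (B s.1).
have K1 : \sum_s (adjmx (K s) *m K s) = 1%:M.
  rewrite -F1 -(pair_bigA _ (fun i j => adjmx (K (i, j)) *m K (i, j))) /=.
  apply: eq_bigr => i _; rewrite BE.
  have e j : adjmx (K (i, j)) *m K (i, j) = B i *m (delta_mx j j *m adjmx (B i)).
    rewrite /K /= adjmxM adjmxK -mulmxA [adjmx (delta_mx _ _) *m _]mulmxA.
    congr (_ *m (_ *m _)).
    have -> : adjmx (delta_mx (r i) j) = delta_mx j (r i) :> 'M[C]_(_, _).
      by apply/matrixP => x y; rewrite adjmxE !mxE rmorph_nat andbC.
    exact: mul_delta_mx.
  rewrite (eq_bigr _ (fun j _ => e j)) -mulmx_sumr -mulmx_suml; congr (_ *m _).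
  rewrite -[RHS]mul1mx; congr (_ *m _); apply/matrixP => x y; rewrite summxE mxE.
  rewrite (@big_only1 _ _ _ _ x) // => [|z zx _]; first by rewrite mxE eqxx eq_sym.
  by rewrite mxE eq_sym (negbTE zx).
have KE Y i : krausf K Y (r i) (r i) = \tr (Y *m F i).
  rewrite /krausf summxE -(pair_bigA _ (fun a j =>
    (K (a, j) *m Y *m adjmx (K (a, j))) (r i) (r i))) /=.
  have e a j : (K (a, j) *m Y *m adjmx (K (a, j))) (r i) (r i) =
      (a == i)%:R * (adjmx (B a) *m Y *m B a) j j.
    rewrite /K /= adjmxM adjmxK.
    have -> : adjmx (delta_mx (r a) j) = delta_mx j (r a) :> 'M[C]_(_, _).
      by apply/matrixP => x y; rewrite adjmxE !mxE rmorph_nat andbC.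
    have -> : delta_mx (r a) j *m adjmx (B a) *m Y *m (B a *m delta_mx j (r a)) =
        delta_mx (r a) j *m (adjmx (B a) *m Y *m B a) *m delta_mx j (r a) by rewrite !mulmxA.
    move: (adjmx (B a) *m Y *m B a) => Z.
    rewrite [LHS]mxE (@big_only1 _ _ _ _ j) // => [|z zj _]; last first.
      by rewrite [delta_mx j _ _ _]mxE (negbTE zj) mulr0.
    rewrite [X in X * _]mxE (@big_only1 _ _ _ _ j) // => [|z zj _]; last first.
      by rewrite [delta_mx (r a) j _ _]mxE (negbTE zj) andbF mul0r.
    rewrite !mxE !eqxx andbT /r (inj_eq enum_rank_inj) eq_sym.
    by case: eqP => _; rewrite ?mulr0 ?mul0r ?mulr1.
  rewrite (@big_only1 _ _ _ _ i) // => [|a ai _]; last first.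
    by rewrite big1 // => j _; rewrite e (negbTE ai) mul0r.
  under eq_bigr do rewrite e eqxx mul1r.
  by rewrite -/(mxtrace _) -mulmxA mxtrace_mulC -mulmxA -BE.
pose D2 Y := krausf K (tmap D (@idmap R q) Y).
have lD2 : linear D2 by move=> a x y; rewrite /D2 tmap_lin krausf_linear.
pose X := \sum_i (lam i)%:C *: (rho i *t delta_mx (r i) (r i)).
have hX : psd X.
  apply: psd_sum => i _; apply: psdZ; first by rewrite ler0c.
  by apply: psd_tens; [exact: (hrho i).1|exact: psd_delta].
have -> : \sum_i lam i * retr (tmap D (@idmap R q) (rho i) *m F i) = pval X D2.
  rewrite pval_discrimination //; apply: eq_bigr => i _; congr (_ * _).
  by rewrite /D2 KE.
apply: pairing_bound => //.
- by rewrite muln_gt0 n0.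
- apply: (@test_bound_post R _ _ _ (krausf K)); [exact: tmap_linear| |exact: test_bound_idr].
  exact: channel_krausf.
move=> f cf; have [lf _] := cf; have [L fE L1] := channel_krausP cf.
rewrite pval_discrimination //.
(* Conversely, reading the register after a channel f is a measurement on the original system, so
   the pairings of X with channels are at most p. *)
pose M i := kadj L (delta_mx (r i) (r i)).
have hM : measurement M.
  apply: kadj_measurement => //; split=> [i|]; first exact: psd_delta.
  apply/matrixP => x y; rewrite summxE mxE (@big_only1 _ _ _ _ (enum_val x)) //.
    by rewrite mxE /r enum_valK eqxx eq_sym.
  move=> z zx _; rewrite mxE; case: eqP => // xz; case/negP: zx.
  by rewrite xz /r enum_rankK.
apply: le_trans (hp _ hM); rewrite /psucc_with Re_sumZ.
apply: ler_sum => i _; rewrite ler_wpM2l // /M -tr_krausf -fE.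
by rewrite mxtrace_mulC tr_deltaM.
Qed.

(** For i != j, flipping the sign at i is an involution of the sign vectors that negates every
    term. *)
Lemma sum_signs n (i j : 'I_n) :
  \sum_(s : {ffun 'I_n -> bool}) ((-1) ^+ s i * (-1) ^+ s j : C) =
  (2 ^ n * (i == j))%:R.
Proof.
have [<-|ij] := eqVneq i j.
  rewrite muln1; under eq_bigr do rewrite -signr_addb addbb expr0.
  by rewrite sumr_const card_ffun card_bool card_ord.
rewrite muln0 mulr0n; set S := \sum_s _.
pose h (s : {ffun 'I_n -> bool}) := [ffun x => s x (+) (x == i)].
have hK : involutive h by move=> s; apply/ffunP => x; rewrite !ffunE addbK.
have : S = - S.
  rewrite {1}/S (reindex_inj (inv_inj hK)) -sumrN; apply: eq_bigr => s _.
  by rewrite !ffunE eqxx eq_sym (negbTE ij) addbT addbF signrN mulNr.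
move=> /eqP; rewrite -subr_eq0 opprK -mulr2n mulrn_eq0 /= => /eqP //.
Qed.

(** Diagonal signs times cyclic shifts: averaging over signs kills the off-diagonal entries,
    averaging over shifts equalises the diagonal. Writing the dimension as a successor gives the
    indices cyclic addition. *)
Lemma unitary_design n : (0 < n)%N ->
  exists (k : nat) (U : 'I_k -> 'M[C]_n), [/\ (0 < k)%N, forall i, unitary (U i) &
    forall X, \sum_i (adjmx (U i) *m X *m U i) = (k%:R / n%:R * \tr X) *: 1%:M].
Proof.
case: n => // n _.
pose T : finType := ({ffun 'I_n.+1 -> bool} * 'I_n.+1)%type.
pose V (t : T) : 'M[C]_n.+1 := \matrix_(p, q) ((-1) ^+ t.1 q * (p == q + t.2)%:R).
exists #|T|, (fun i => V (enum_val i)).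
have cT : #|T| = (2 ^ n.+1 * n.+1)%N.
  by rewrite card_prod card_ffun card_bool card_ord.
have uV t : unitary (V t).
  apply: mulmx1C; apply/matrixP => p q; rewrite mxE (@big_only1 _ _ _ _ (p + t.2)) //.
    rewrite adjmxE !mxE eqxx mulr1 rmorphXn /= rmorphN rmorph1 (inj_eq (addIr _)).
    by case: eqP => [->|_]; rewrite ?mulr0 // mulr1 -signr_addb addbb.
  by move=> z zp _; rewrite adjmxE mxE (negbTE zp) mulr0 rmorph0 mul0r.
split=> [|i|X]; first by rewrite cT muln_gt0 expn_gt0.
  exact: uV.
have vE t p q : (adjmx (V t) *m X *m V t) p q =
    (-1) ^+ t.1 p * (-1) ^+ t.1 q * X (p + t.2) (q + t.2).
  rewrite mxE (@big_only1 _ _ _ _ (q + t.2)) //; last first.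
    by move=> z zp _; rewrite [V t _ _]mxE (negbTE zp) mulr0 mulr0.
  rewrite mxE (@big_only1 _ _ _ _ (p + t.2)) //; last first.
    by move=> z zp _; rewrite adjmxE mxE (negbTE zp) mulr0 rmorph0 mul0r.
  rewrite adjmxE !mxE !eqxx !mulr1 rmorphXn /= rmorphN rmorph1; ring.
rewrite -(big_enum_val (fun t => adjmx (V t) *m X *m V t)) /=.
apply/matrixP => p q; rewrite summxE !mxE.
under eq_bigr do rewrite vE.
rewrite (eq_bigl predT) // -(pair_bigA _ (fun (s : {ffun 'I_n.+1 -> bool}) (a : 'I_n.+1) =>
  (-1) ^+ s p * (-1) ^+ s q * X (p + a) (q + a))) /= exchange_big /=.
under eq_bigr do rewrite -mulr_suml sum_signs.
rewrite -mulr_sumr [in RHS]cT [in RHS]natrM mulfK ?pnatr_eq0 //.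
have [<-|pq] := eqVneq p q; last by rewrite muln0 mul0r mulr0.
by rewrite muln1 mulr1 natrX /mxtrace [in RHS](reindex_inj (addrI p)).
Qed.

End GuessingGames.

(** * Twirled games *)

Section Twirling.
Variable R : realType.
Local Notation C := R[i].
Local Notation Re := complex.Re.
Local Notation ix := mxtens_index.

(** On B1 the rotation of the ensemble is undone by the same rotation inside the fixed measurement;
    on R1 it is transferred to the measurement of the player. *)
Lemma twirl_term a0 a1 b0 b1 r0 r1 u (alpha : lmap R r0 (u * a0))
    (Phi : lmap R (a0 * b0) (a1 * b1)) (U : 'M[C]_r1) (V : 'M[C]_b1)
    (N : 'M[C]_(u * a1 * r1)) (z : C) (rho : 'M[C]_(r0 * b0 * (r1 * b1))) :
  unitary V ->
  \tr (tmap (halfch alpha Phi) (@idmap R (r1 * b1))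
        ((1%:M *t (U *t V)) *m rho *m adjmx (1%:M *t (U *t V)))
      *m Defs.reindex (@reorder_idx u a1 b1 r1)
           (N *t (z *: ((1%:M *t V) *m Omega R b1 *m adjmx (1%:M *t V))))) =
  \tr (tmap (halfch alpha Phi) (@idmap R (r1 * b1)) rho
      *m Defs.reindex (@reorder_idx u a1 b1 r1)
           ((adjmx (1%:M *t U) *m N *m (1%:M *t U)) *t (z *: Omega R b1))).
Proof.
move=> uV; set X1 := Defs.reindex _ _; set X2 := Defs.reindex _ _.
have key G Z : trm ((G *t ((U *t V) *m Z *m adjmx (U *t V))) *m X1) = trm ((G *t Z) *m X2).
  move: G; apply: tens_ext => [||P G]; [trlin_tac|trlin_tac|].
  move: G; apply: tens_ext => [||F G]; [trlin_tac|trlin_tac|].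
  move: Z; apply: tens_ext => [||E D]; [trlin_tac|trlin_tac|].
  have -> : (P *t (F *t G)) *t ((U *t V) *m (E *t D) *m adjmx (U *t V)) =
      (P *t (F *t G)) *t ((U *m E *m adjmx U) *t (V *m D *m adjmx V)).
    by rewrite adjmx_tens !tensmx_mul.
  rewrite /trm /X1 /X2 !tr_reorder; congr (_ * _)%:M.
    have -> : (P *t F) *t (U *m E *m adjmx U) =
        (1%:M *t U) *m ((P *t F) *t E) *m adjmx (1%:M *t U).
      by rewrite adjmx_tens adjmx1 !tensmx_mul mul1mx mulmx1.
    by rewrite -!mulmxA mxtrace_mulC -!mulmxA.
  rewrite -!scalemxAr !mxtraceZ; congr (_ * _).
  have VV : adjmx (1%:M *t V) *m (G *t (V *m D *m adjmx V)) *m (1%:M *t V) = G *t D.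
    rewrite adjmx_tens adjmx1 !tensmx_mul mul1mx mulmx1 !mulmxA (unitaryC uV) mul1mx.
    by rewrite -mulmxA (unitaryC uV) mulmx1.
  by rewrite -VV !mulmxA mxtrace_mulC !mulmxA.
clearbody X1 X2; apply: trm_inj; move: rho.
apply: tens_ext => [||Y Z]; [trlin_tac|trlin_tac|].
have -> : (1%:M *t (U *t V)) *m (Y *t Z) *m adjmx (1%:M *t (U *t V)) =
    Y *t ((U *t V) *m Z *m adjmx (U *t V)).
  by rewrite adjmx_tens adjmx1 !tensmx_mul mul1mx mulmx1.
by rewrite !tmap_tens //; try exact: halfch_linear; rewrite key.
Qed.

(** Testing with J on the player's systems amounts to applying the channel represented by J and
    contracting with [Omega] on R1; [Omega] on the two copies of B1 completes the pairing. *)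
Lemma supch_value a0 a1 b0 b1 r0 r1 u (alpha : lmap R r0 (u * a0))
    (post : lmap R (u * a1) r1) (Phi : lmap R (a0 * b0) (a1 * b1))
    (J : 'M[C]_(u * a1 * r1)) (rho : 'M[C]_(r0 * b0 * (r1 * b1))) :
  linear alpha -> linear post -> linear Phi ->
  (forall X, \tr (tmap post (@idmap R r1) X *m Omega R r1) = \tr (X *m J)) ->
  \tr (tmap (halfch alpha Phi) (@idmap R (r1 * b1)) rho
      *m Defs.reindex (@reorder_idx u a1 b1 r1) (J *t Omega R b1)) =
  \tr (tmap (supch_apply alpha post Phi) (@idmap R (r1 * b1)) rho *m Omega R (r1 * b1)).
Proof.
move=> la lpost lPhi hJ; apply: trm_inj.
move: rho; apply: tens_ext => [||Y Z]; [trlin_tac|trlin_tac|].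
rewrite !tmap_tens //; try exact: halfch_linear; try exact: supch_linear.
rewrite /idmap; move: Y; apply: tens_ext => [a x y|a x y|A B].
- by rewrite halfch_linear tensmx_linl trm_mul_lin.
- by rewrite supch_linear tensmx_linl trm_mul_lin.
rewrite /halfch supch_tens // tmap_tens // /idmap; move: (alpha A) => W.
move: W; apply: tens_ext => [||P Q]; [trlin_tac|trlin_tac|].
rewrite tensAV tmap_tens // /idmap; move: (Phi _) => W.
move: W; apply: tens_ext => [||F G]; [trlin_tac|trlin_tac|].
rewrite tensA tmap_tens // /idmap.
move: Z; apply: tens_ext => [||E D]; [trlin_tac|trlin_tac|].
rewrite /trm tr_reorder !tr_tens_Omega trmx_tens tensmx_mul tr_tens -hJ tmap_tens //.
by rewrite tr_tens_Omega.
Qed.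

Lemma ptr_Omega n : ptr (Omega R n) = 1%:M.
Proof.
apply/matrixP => p q; rewrite ptrE mxE (@big_only1 _ _ _ _ p) // => [|x xp _].
  by rewrite OmegaE eqxx eq_sym.
by rewrite OmegaE eq_sym (negbTE xp).
Qed.

Definition is_design n k (U : 'I_k -> 'M[C]_n) : Prop :=
  [/\ (0 < k)%N, forall i, unitary (U i) &
    forall X, \sum_i (adjmx (U i) *m X *m U i) = (k%:R / n%:R * \tr X) *: 1%:M].

Lemma RC_nat n : (n%:R)%:C = n%:R :> C.
Proof. by rewrite rmorph_nat. Qed.

(** The design average of J is ptr J (x) 1 divided by m. This gives both the fixed measurement (J =
    [Omega]) and the measurement of the player that realises a given postprocessing. *)
Lemma twirl_measurement n m k (U : 'I_k -> 'M[C]_m) (J : 'M[C]_(n * m)) :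
  (0 < m)%N -> is_design U -> psd J -> ptr J = 1%:M ->
  measurement (fun i => (m%:R / k%:R)%:C *:
    ((1%:M *t U i) *m J *m adjmx (1%:M *t U i))).
Proof.
move=> m0 [k0 uU dU] hJ J1; split=> [i|].
  by apply: psdZ; [rewrite ler0c divr_ge0|exact: psd_conj].
apply: tr_tens_ext => Y E; rewrite mulmx_sumr raddf_sum /=.
have e i : \tr ((Y *t E) *m ((m%:R / k%:R)%:C *:
    ((1%:M *t U i) *m J *m adjmx (1%:M *t U i)))) =
    (m%:R / k%:R)%:C * \tr ((Y *t (adjmx (U i) *m E *m U i)) *m J).
  rewrite -scalemxAr mxtraceZ; congr (_ * _); rewrite !mulmxA mxtrace_mulC !mulmxA.
  by rewrite adjmx_tens adjmx1 !tensmx_mul !mul1mx mulmx1.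
rewrite (eq_bigr _ (fun i _ => e i)) -mulr_sumr.
have -> : \sum_i \tr ((Y *t (adjmx (U i) *m E *m U i)) *m J) =
    \tr ((Y *t (\sum_i (adjmx (U i) *m E *m U i))) *m J).
  by rewrite tensmx_sumr mulmx_suml raddf_sum.
rewrite dU tensmxZr -scalemxAl mxtraceZ tr_ptrM J1 !mulmx1 tr_tens mulrA.
have -> : (m%:R / k%:R)%:C = m%:R / k%:R :> C by rewrite rmorphM fmorphV /= !RC_nat.
rewrite mulrA.
have -> : m%:R / k%:R * (k%:R / m%:R) = 1 :> C.
  by field; rewrite !pnatr_eq0 -!lt0n k0 m0.
by rewrite mul1r mulrC.
Qed.

(** * The twirled game attached to one state *)

Section Game.
Variables (a0 a1 b0 b1 r0 r1 : nat) (k l : nat).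
Variables (U : 'I_k -> 'M[C]_r1) (V : 'I_l -> 'M[C]_b1).
Variable rho : 'M[C]_(r0 * b0 * (r1 * b1)).
Hypotheses (dU : is_design U) (dV : is_design V).
Hypotheses (r10 : (0 < r1)%N) (b10 : (0 < b1)%N).

Definition game_lam (ij : 'I_k * 'I_l) : R := (k%:R * l%:R)^-1.

Definition game_W (ij : 'I_k * 'I_l) : 'M[C]_(r0 * b0 * (r1 * b1)) :=
  1%:M *t (U ij.1 *t V ij.2).

Definition game_rho (ij : 'I_k * 'I_l) : 'M[C]_(r0 * b0 * (r1 * b1)) :=
  game_W ij *m rho *m adjmx (game_W ij).

Definition game_M (j : 'I_l) : 'M[C]_(b1 * b1) :=
  (b1%:R / l%:R)%:C *: ((1%:M *t V j) *m Omega R b1 *m adjmx (1%:M *t V j)).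

(** The prior 1/(kl), the l equal terms in j, the weight b1/l of [game_M] and the factor r1 from the
    sum of the player's rotated operators multiply to this. [game_psucc] has the same factor, so it
    cancels in the end. *)
Definition game_scale : R := b1%:R * r1%:R / (k%:R * l%:R).

Lemma game_scale_gt0 : 0 < game_scale.
Proof.
by case: dU dV => k0 _ _ [l0 _ _]; rewrite divr_gt0 // mulr_gt0 // ltr0n.
Qed.

Lemma game_W_adj ij : adjmx (game_W ij) *m game_W ij = 1%:M.
Proof.
case: dU dV => _ uU _ [_ uV _].
by rewrite /game_W !adjmx_tens !tensmx_mul (unitaryC (uU _)) (unitaryC (uV _)) adjmx1 mul1mx !tens11.
Qed.

(** The rotations leave s (x) 1 invariant, so a domination of [rho] passes to every member of the
    ensemble with the same s. *)
Lemma game_W_comm ij (s : 'M[C]_(r0 * b0)) :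
  game_W ij *m (s *t 1%:M) *m adjmx (game_W ij) = s *t 1%:M.
Proof.
case: dU dV => _ uU _ [_ uV _].
rewrite /game_W !adjmx_tens !tensmx_mul adjmx1 mul1mx !mulmx1 tensmx_mul uU uV tens11 //.
Qed.

Lemma game_ensemble : density rho -> ensemble game_lam game_rho.
Proof.
case: dU dV => k0 _ _ [l0 _ _] [hr r1'].
have kl0 : k%:R * l%:R != 0 :> R by rewrite mulf_neq0 // pnatr_eq0 -lt0n.
split=> [ij||ij]; first by rewrite /game_lam invr_ge0 mulr_ge0.
  by rewrite sumr_const card_prod !card_ord -[_ *+ _]mulr_natr natrM mulVf.
split; first exact: psd_conj.
by rewrite /game_rho mxtrace_mulC mulmxA game_W_adj mul1mx.
Qed.

Lemma game_M_measurement : measurement game_M.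
Proof. by apply: twirl_measurement => //; [exact: Omega_psd|exact: ptr_Omega]. Qed.

Lemma game_value u (alpha : lmap R r0 (u * a0)) (post : lmap R (u * a1) r1)
    (Phi : lmap R (a0 * b0) (a1 * b1)) (N : 'I_k -> 'M[C]_(u * a1 * r1))
    (J : 'M[C]_(u * a1 * r1)) :
  linear alpha -> linear post -> linear Phi ->
  (forall X, \tr (tmap post (@idmap R r1) X *m Omega R r1) = \tr (X *m J)) ->
  \sum_i (adjmx (1%:M *t U i) *m N i *m (1%:M *t U i)) = r1%:R *: J ->
  Re (\sum_(ij : 'I_k * 'I_l) (game_lam ij)%:C *
    \tr (tmap (halfch alpha Phi) (@idmap R (r1 * b1)) (game_rho ij)
      *m Defs.reindex (@reorder_idx u a1 b1 r1) (N ij.1 *t game_M ij.2))) =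
  game_scale * pval rho (supch_apply alpha post Phi).
Proof.
move=> la lpost lPhi hJ hN; case: dU dV => k0 uU _ [l0 uV _].
pose T := tmap (halfch alpha Phi) (@idmap R (r1 * b1)) rho.
pose z : C := (b1%:R / l%:R)%:C.
pose re (X : 'M[C]_(u * a1 * r1 * (b1 * b1))) := Defs.reindex (@reorder_idx u a1 b1 r1) X.
have lre : linear (re : lmap R _ _) := (channel_reindex R (reorder_bij _ _ _ _)).1.
pose N' i := adjmx (1%:M *t U i) *m N i *m (1%:M *t U i).
have e ij : (game_lam ij)%:C * \tr (tmap (halfch alpha Phi) (@idmap R (r1 * b1)) (game_rho ij)
      *m Defs.reindex (@reorder_idx u a1 b1 r1) (N ij.1 *t game_M ij.2)) =
    ((k%:R * l%:R)^-1)%:C * \tr (T *m re (N' ij.1 *t (z *: Omega R b1))).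
  by rewrite -(twirl_term alpha Phi (U ij.1) (N ij.1) z rho (uV ij.2)).
rewrite (eq_bigr _ (fun ij _ => e ij)) -mulr_sumr.
rewrite -(pair_bigA _ (fun i (j : 'I_l) => \tr (T *m re (N' i *t (z *: Omega R b1))))) /=.
under eq_bigr do rewrite sumr_const card_ord -mulr_natl.
rewrite -mulr_sumr.
have -> : \sum_i \tr (T *m re (N' i *t (z *: Omega R b1))) =
    r1%:R * (z * \tr (T *m re (J *t Omega R b1))).
  transitivity (\tr (T *m re ((\sum_i N' i) *t (z *: Omega R b1)))).
    by rewrite tensmx_suml (lin_sum lre) mulmx_sumr raddf_sum.
  by rewrite hN tensmxZl tensmxZr (linZ lre) (linZ lre) -!scalemxAr !mxtraceZ.
rewrite /T (supch_value _ la lpost lPhi hJ) /pval /retr -!RC_nat !mulrA /z -!rmorphM /= ReZ.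
congr (_ * _); rewrite /game_scale; field.
by rewrite !pnatr_eq0 -!lt0n k0 l0.
Qed.

(** Only the back-rotated sum of the player's operators enters the value. Divided by r1 it has
    partial trace 1, because the operators sum to the identity, and therefore represents a
    postprocessing channel. *)
Lemma game_upper u (alpha : lmap R r0 (u * a0)) (Phi : lmap R (a0 * b0) (a1 * b1))
    (N : 'I_k -> 'M[C]_(u * a1 * r1)) :
  linear alpha -> linear Phi -> measurement N ->
  exists2 post : lmap R (u * a1) r1, channel post &
  Re (\sum_(ij : 'I_k * 'I_l) (game_lam ij)%:C *
    \tr (tmap (halfch alpha Phi) (@idmap R (r1 * b1)) (game_rho ij)
      *m Defs.reindex (@reorder_idx u a1 b1 r1) (N ij.1 *t game_M ij.2))) =
  game_scale * pval rho (supch_apply alpha post Phi).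
Proof.
move=> la lPhi [hN N1]; case: (dU) => k0 uU _.
pose Nt := \sum_i (adjmx (1%:M *t U i) *m N i *m (1%:M *t U i)).
have r1n : r1%:R != 0 :> C by rewrite pnatr_eq0 -lt0n.
pose J := r1%:R^-1 *: Nt.
have hJ : psd J.
  apply: psdZ; first by rewrite invr_ge0.
  by apply: psd_sum => i _; exact: psd_conjC.
have J1 : ptr J = 1%:M.
  apply: tr_ext => Y; rewrite -tr_ptrM /J -scalemxAr mxtraceZ /Nt mulmx_sumr raddf_sum /=.
  have e i : \tr ((Y *t 1%:M) *m (adjmx (1%:M *t U i) *m N i *m (1%:M *t U i))) =
      \tr ((Y *t 1%:M) *m N i).
    rewrite !mulmxA mxtrace_mulC !mulmxA adjmx_tens adjmx1 !tensmx_mul !mul1mx !mulmx1.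
    by rewrite uU.
  rewrite (eq_bigr _ (fun i _ => e i)).
  have -> : \sum_i \tr ((Y *t 1%:M) *m N i) = \tr (Y *t (1%:M : 'M[C]_r1)).
    by rewrite -[in RHS](mulmx1 (Y *t 1%:M)) -N1 mulmx_sumr raddf_sum.
  by rewrite tr_tens mxtrace1 mulmx1 mulrCA mulVf // mulr1.
have [post cpost postE] := choi_channel hJ J1.
exists post => //; apply: game_value postE _ => //; first exact: cpost.1.
by rewrite -/Nt /J scalerA divff // scale1r.
Qed.

Lemma game_lower u (alpha : lmap R r0 (u * a0)) (post : lmap R (u * a1) r1)
    (Phi : lmap R (a0 * b0) (a1 * b1)) :
  linear alpha -> channel post -> linear Phi ->
  exists2 N : 'I_k -> 'M[C]_(u * a1 * r1), measurement N &
  Re (\sum_(ij : 'I_k * 'I_l) (game_lam ij)%:C *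
    \tr (tmap (halfch alpha Phi) (@idmap R (r1 * b1)) (game_rho ij)
      *m Defs.reindex (@reorder_idx u a1 b1 r1) (N ij.1 *t game_M ij.2))) =
  game_scale * pval rho (supch_apply alpha post Phi).
Proof.
move=> la cpost lPhi; have [J [hJ J1 JE]] := channel_choi cpost.
case: (dU) => k0 uU _.
pose N i := (r1%:R / k%:R)%:C *: ((1%:M *t U i) *m J *m adjmx (1%:M *t U i)).
exists N.
  exact: twirl_measurement.
apply: (@game_value _ _ _ _ N _ la cpost.1 lPhi JE); rewrite /N.
have e i : adjmx (1%:M *t U i) *m ((r1%:R / k%:R)%:C *:
    ((1%:M *t U i) *m J *m adjmx (1%:M *t U i))) *m (1%:M *t U i) = (r1%:R / k%:R)%:C *: J.
  rewrite -scalemxAr -scalemxAl; congr (_ *: _); rewrite !mulmxA.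
  have UU : adjmx ((1%:M : 'M[C]_(u * a1)) *t U i) *m (1%:M *t U i) = 1%:M.
    by rewrite adjmx_tens tensmx_mul (unitaryC (uU i)) adjmx1 mul1mx tens11.
  by rewrite UU mul1mx -mulmxA UU mulmx1.
rewrite (eq_bigr _ (fun i _ => e i)) sumr_const card_ord -scaler_nat scalerA -RC_nat.
rewrite -rmorphM /= mulrC divfK ?RC_nat // pnatr_eq0 -lt0n //.
Qed.

(** Each member is at most t s (x) 1, so summing over any measurement gives at most t Tr(s (x) 1) =
    t r1 b1, times the prior. *)
Lemma game_psucc (s : 'M[C]_(r0 * b0)) (t : R) M : 0 <= t ->
  psd (t%:C *: (s *t 1%:M) - rho) -> \tr s = 1 -> measurement M ->
  psucc_with game_lam game_rho M <= game_scale * t.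
Proof.
move=> t0 hs s1 [hM M1]; case: (dU) (dV) => k0 _ _ [l0 _ _].
rewrite /psucc_with Re_sumZ.
have kl0 : 0 <= (k%:R * l%:R)^-1 :> R by rewrite invr_ge0 mulr_ge0.
have h ij : game_lam ij * Re (\tr (game_rho ij *m M ij)) <=
    (k%:R * l%:R)^-1 * (t * retr ((s *t 1%:M) *m M ij)).
  rewrite ler_wpM2l // -/(retr _).
  have : psd (game_W ij *m (t%:C *: (s *t 1%:M) - rho) *m adjmx (game_W ij)).
    exact: psd_conj.
  rewrite mulmxBr mulmxBl -scalemxAr -scalemxAl game_W_comm -/(game_rho ij) => hd.
  have := retr_psd_ge0 hd (hM ij); rewrite mulmxBl -scalemxAl retrB retrZ.
  by rewrite subr_ge0.
apply: le_trans (ler_sum _ (fun ij _ => h ij)) _.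
rewrite -!mulr_sumr -retr_sum -mulmx_sumr M1 mulmx1 /retr tr_tens s1 mul1r mxtrace1.
by rewrite -RC_nat natrM /= /game_scale le_eqVlt; apply/orP; left; apply/eqP; ring.
Qed.

End Game.
End Twirling.

(** * The equivalence *)

Section Main.
Variable R : realType.
Local Notation C := R[i].
Local Notation Re := complex.Re.
Local Notation ix := mxtens_index.

Lemma outputs_exist a0 a1 a0' a1' b0 b1 (Phi : lmap R (a0 * b0) (a1 * b1)) :
  (0 < a0)%N -> (0 < a1')%N ->
  exists Psi, @superch_outputs R a0 a1 a0' a1' b0 b1 Phi Psi.
Proof.
move=> a00 a10'.
have [pre cpre] := @channel_exists R a0' (1 * a0) ltac:(by rewrite mul1n).
have [post cpost] := @channel_exists R (1 * a1) a1' a10'.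
by exists (supch_apply pre post Phi), 1%N, pre, post.
Qed.

Section Differences.
Variables (n m : nat) (f g : lmap R n m).
Hypotheses (cf : channel f) (cg : channel g).

Lemma diff_linear : linear (fun X => f X - g X).
Proof. exact: linear_subf cf.1 cg.1. Qed.

Lemma diff_tr0 X : \tr (f X - g X) = 0.
Proof. by case: cf cg => _ [_ tf] [_ [_ tg]]; rewrite raddfB /= tf tg subrr. Qed.

Lemma diff_adj X : f (adjmx X) - g (adjmx X) = adjmx (f X - g X).
Proof.
case: cf cg => lf [cpf _] [lg [cpg _]].
by rewrite (channel_herm _ lf cpf) (channel_herm _ lg cpg) adjmxD adjmxN.
Qed.

Lemma diff_test_boundC c :
  test_bound (fun X => f X - g X) c -> test_bound (fun X => g X - f X) c.
Proof.
move=> h; have -> : (fun X => g X - f X) = (fun X => - (f X - g X)).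
  by apply/funext => X; rewrite opprB.
apply: test_boundN h; [exact: diff_linear|exact: diff_tr0].
Qed.

End Differences.

Lemma ereal_sup_real (S : set (\bar R)) (b : R) : (S !=set0)%classic ->
  (forall x, S x -> (x <= b%:E)%E) -> (forall x, S x -> (-oo < x)%E) ->
  exists p : R, ereal_sup S = p%:E.
Proof.
move=> [x Sx] hb hx.
have h1 : (ereal_sup S <= b%:E)%E by apply: ge_ereal_sup => y; exact: hb.
have h2 : (-oo < ereal_sup S)%E by apply: lt_le_trans (hx _ Sx) (ereal_sup_ubound Sx).
by case: (ereal_sup S) h1 h2 => [p||] //; exists p.
Qed.

Lemma ereal_sup_slack (S : set (\bar R)) (x y e : R) : 0 < e ->
  (x%:E <= ereal_sup S + y%:E)%E -> exists2 z, S z & ((x - y - e)%:E < z)%E.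
Proof.
move=> e0 h; apply: ereal_sup_gt; case: (ereal_sup S) h => [s||] //=.
- by rewrite -EFinD lee_fin lte_fin => h; lra.
- by rewrite ltry.
Qed.

Lemma real_sup_le (S : set (\bar R)) (x y : R) :
  (forall e : R, 0 < e -> exists2 z, S z & (x%:E <= z + (y + e)%:E)%E) ->
  (x%:E <= ereal_sup S + y%:E)%E.
Proof.
move=> h; apply/lee_addgt0Pr => e e0; have [z Sz hz] := h e e0.
apply: le_trans hz _; rewrite -addeA -EFinD leeD2r //; exact: ereal_sup_ubound.
Qed.

(** Finiteness allows the products with eps/2 to be computed in the reals; the explicit bound is
    only qualitative. *)
Lemma dual_dnorm_real n m (rho : 'M[C]_(n * m)) : (0 < m)%N -> psd rho ->
  exists2 p : R, dual_dnorm rho = p%:E & forall f, channel f -> pval rho f <= p.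
Proof.
move=> m0 hr.
have [f0 cf0] := @channel_exists R n m m0.
have hb f : channel f -> pval rho f <=
    (n * m * (n * m))%:R * Re (\tr rho) ^+ 2 + (n * m * (n * m))%:R * n%:R ^+ 2.
  move=> cf; have [w [hw w1 wE]] := channel_choi cf.
  rewrite /pval /retr wE -/(retr (rho *m w)).
  have h1 := @sqnorm_le R _ rho _ (fun i j => psd_entry_le i j hr).
  have h2 := @sqnorm_le R _ w _ (fun i j => psd_entry_le i j hw).
  have tw : Re (\tr w) = n%:R by rewrite -tr_ptr w1 mxtrace1 -(rmorph_nat (real_complex R)).
  rewrite tw in h2; have := mxpair_amgm 1 rho w.
  have := sqnorm_ge0 w; have := sqnorm_ge0 rho; move: h1 h2.
  move: (retr (rho *m adjmx rho)) (retr (w *m adjmx w)) (retr (rho *m w)) (_ * _) (_ * _).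
  by move=> x y z a b; lra.
have [p pE] : exists p : R, dual_dnorm rho = p%:E.
  apply: ereal_sup_real.
  - by exists (Re (pairing rho f0))%:E, f0.
  - by move=> _ [f [cf ->]]; rewrite lee_fin Re_pairing //; exact: hb.
  - by move=> _ [f [cf ->]]; exact: ltNyr.
exists p => // f cf; rewrite -lee_fin -pE; apply: ereal_sup_ubound.
by exists f; rewrite Re_pairing.
Qed.

Lemma psucc_real (I : finType) n (lam : I -> R) (rho : I -> 'M[C]_n) :
  ensemble lam rho -> exists2 p : R, psucc lam rho = p%:E &
    forall M, measurement M -> psucc_with lam rho M <= p.
Proof.
move=> hE; have /card_gt0P[i0 _] := ensemble_card_gt0 hE; case: hE => lam0 lam1 hrho.
have hb M : measurement M -> psucc_with lam rho M <= 1.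
  move=> [hM M1]; rewrite /psucc_with Re_sumZ -lam1; apply: ler_sum => i _.
  rewrite -[leRHS]mulr1 ler_wpM2l // -/(retr _).
  have -> : 1 = retr (rho i) by rewrite /retr (hrho i).2.
  have : psd (1%:M - M i).
    rewrite -M1 (bigD1 i) //= [M i + _]addrC addrK; exact: psd_sum.
  move=> /(retr_psd_ge0 (hrho i).1); rewrite mulmxBr mulmx1 retrB; lra.
pose M0 (i : I) : 'M[C]_n := if i == i0 then 1%:M else 0.
have hM0 : measurement M0.
  split=> [i|]; first by rewrite /M0; case: eqP => _; [exact: psd1|exact: psd0].
  rewrite (@big_only1 _ _ _ _ i0) //; first by rewrite /M0 eqxx.
  by move=> j ji _; rewrite /M0 (negbTE ji).
have [p pE] : exists p : R, psucc lam rho = p%:E.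
  apply: ereal_sup_real.
  - by exists (psucc_with lam rho M0)%:E, M0.
  - by move=> _ [M [hM ->]]; rewrite lee_fin; exact: hb.
  - by move=> _ [M [hM ->]]; exact: ltNyr.
exists p => // M hM; rewrite -lee_fin -pE; apply: ereal_sup_ubound.
by exists M.
Qed.

Section Equivalence.
Variables (a0 a1 a0' a1' b0 b1 : nat).
Variables (Phi1 : lmap R (a0 * b0) (a1 * b1)) (Phi2 : lmap R (a0' * b0) (a1' * b1)).
Variable eps : R.
Hypothesis a0_gt0 : (0 < a0)%N.
Hypotheses (a0'_gt0 : (0 < a0')%N) (a1'_gt0 : (0 < a1')%N).
Hypotheses (b0_gt0 : (0 < b0)%N) (b1_gt0 : (0 < b1)%N).
Hypotheses (cPhi1 : channel Phi1) (cPhi2 : channel Phi2) (eps_ge0 : 0 <= eps).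

Local Notation outputs1 := (@superch_outputs R a0 a1 a0' a1' b0 b1 Phi1).

(** The slack e makes the inequality strict, so an actual output can be chosen although the infimum
    may not be attained. *)
Lemma delta_test_bound (e : R) : (deltaAA Phi1 Phi2 <= eps%:E)%E -> 0 < e ->
  exists2 Psi, outputs1 Psi & test_bound (fun X => Phi2 X - Psi X) (eps / 2 + e).
Proof.
move=> hd e0.
have : (deltaAA Phi1 Phi2 < (2 * (eps / 2 + e))%:E)%E.
  by apply: le_lt_trans hd _; rewrite lte_fin; lra.
move=> /ereal_inf_lt[_ [Psi [hPsi ->]] /ltW hlt]; exists Psi => //.
have cPsi := outputs_channel cPhi1 hPsi.
apply: diff_test_boundC => //; apply: dnorm_test_bound hlt.
  exact: diff_linear.
exact: diff_tr0.
Qed.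

Lemma test_bound_delta :
  (forall e : R, 0 < e ->
    exists2 Psi, outputs1 Psi & test_bound (fun X => Phi2 X - Psi X) (eps / 2 + e)) ->
  (deltaAA Phi1 Phi2 <= eps%:E)%E.
Proof.
move=> h; apply/lee_addgt0Pr => e e0.
have [Psi hPsi /diff_test_boundC hb] := h _ (divr_gt0 e0 (ltr0Sn R 1)).
have cPsi := outputs_channel cPhi1 hPsi.
have {}hb := hb cPhi2 cPsi.
apply: (@le_trans _ _ (dnorm (fun X => Psi X - Phi2 X))).
  by apply: ereal_inf_lbound; exists Psi.
have -> : (eps%:E + e%:E)%E = (2 * (eps / 2 + e / 2))%:E by rewrite -EFinD; congr (_%:E); lra.
have c0 : 0 <= eps / 2 + e / 2 by apply: addr_ge0; rewrite divr_ge0 // ltW.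
apply: test_bound_dnorm hb => //.
- exact: diff_linear.
- exact: diff_tr0.
- exact: diff_adj.
Qed.

Lemma small_scale (p e : R) : 0 < e -> exists2 d, 0 < d & d * p <= e.
Proof.
move=> e0; exists (e / (`|p| + 1)); first by rewrite divr_gt0 // ltr_wpDl.
have p1 : 0 < `|p| + 1 by rewrite ltr_wpDl.
rewrite mulrAC ler_pdivrMr // ler_pM2l //; apply: le_trans (ler_norm p) _.
by rewrite lerDl.
Qed.

(** The same outer superchannel is applied to a nearby output Psi of [Phi1]; the result is again an
    output of [Phi1], hence a competitor on the right, and the error is paired with rho by
    [pairing_bound]. *)
Lemma cond_i_ii r0 r1 (rho : 'M[C]_((r0 * b0) * (r1 * b1))) :
  (0 < r0)%N -> (0 < r1)%N -> (deltaAA Phi1 Phi2 <= eps%:E)%E -> density rho ->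
  (@sup_pairing R a0' a1' r0 r1 b0 b1 rho Phi2
   <= @sup_pairing R a0 a1 r0 r1 b0 b1 rho Phi1 + (eps / 2)%:E * dual_dnorm rho)%E.
Proof.
move=> r00 r10 hd [hr _].
have rb0 : (0 < r0 * b0)%N by rewrite muln_gt0 r00.
have rb1 : (0 < r1 * b1)%N by rewrite muln_gt0 r10.
have [p -> hp] := dual_dnorm_real rb1 hr.
apply: ge_ereal_sup => _ [_ [[u [pre [post [u0 cpre cpost ->]]]] ->]].
rewrite Re_pairing; last exact: supch_channel.
rewrite -EFinM; apply: real_sup_le => e e0; have [d d0 hde] := small_scale p e0.
have [Psi hPsi hb] := delta_test_bound hd d0.
have cPsi := outputs_channel cPhi1 hPsi.
have oPsi := outputs_comp u0 cpre cpost cPhi1 hPsi.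
exists (pval rho (supch_apply pre post Psi))%:E.
  exists (supch_apply pre post Psi); split=> //; rewrite Re_pairing //.
  exact: supch_channel.
rewrite -EFinD lee_fin.
have lD : linear (fun X => Phi2 X - Psi X) by exact: diff_linear.
have hb' := supch_test_bound cpre cpost lD hb.
have c0 : 0 <= eps / 2 + d by rewrite addr_ge0 ?divr_ge0 // ltW.
have := pairing_bound rb0 rb1 (@supch_linear R _ _ _ _ _ _ _ pre post _) c0 hb' hr hp.
have -> : supch_apply pre post (fun X => Phi2 X - Psi X) =
    (fun X => supch_apply pre post Phi2 X - supch_apply pre post Psi X).
  by apply/funext => X; apply: supchB; [exact: cPhi2.1|exact: cPsi.1].
rewrite pvalB; try exact: supch_linear.
move: (pval _ (supch_apply _ _ Phi2)) (pval _ (supch_apply _ _ Psi)) => x y.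
by rewrite mulrDl; lra.
Qed.

Lemma halfchB c0 c1 r0 u (alpha : lmap R r0 (u * c0))
    (f g : lmap R (c0 * b0) (c1 * b1)) X : linear f -> linear g ->
  halfch alpha (fun Y => f Y - g Y) X = halfch alpha f X - halfch alpha g X.
Proof. by move=> lf lg; rewrite /halfch tmap_idB. Qed.

Lemma reorder_measurement u c1 r1 k l (N : 'I_k -> 'M[C]_(u * c1 * r1))
    (M : 'I_l -> 'M[C]_(b1 * b1)) : measurement N -> measurement M ->
  measurement (fun ij : 'I_k * 'I_l =>
    Defs.reindex (@reorder_idx u c1 b1 r1) (N ij.1 *t M ij.2)).
Proof.
move=> [hN N1] [hM M1]; split=> [ij|].
  by apply: psd_reindex; exact: psd_tens.
have bij := reorder_bij u c1 b1 r1.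
have lre := (channel_reindex R bij).1.
rewrite -(lin_sum lre) -(pair_bigA _ (fun i j => N i *t M j)) /=.
under eq_bigr do rewrite -tensmx_sumr M1.
rewrite -tensmx_suml N1 tens11; apply/matrixP => i j; rewrite !mxE.
by rewrite (bij_eq bij).
Qed.

Lemma cond_i_iii r0 r1 k l (lam : 'I_k * 'I_l -> R)
    (rho : 'I_k * 'I_l -> 'M[C]_((r0 * b0) * (r1 * b1)))
    (M : 'I_l -> 'M[C]_(b1 * b1)) :
  (0 < r0)%N -> (0 < r1)%N -> (deltaAA Phi1 Phi2 <= eps%:E)%E ->
  ensemble lam rho -> measurement M ->
  (@PM R a0' a1' b0 b1 r0 r1 k l Phi2 M lam rho
   <= @PM R a0 a1 b0 b1 r0 r1 k l Phi1 M lam rho + (eps / 2)%:E * psucc lam rho)%E.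
Proof.
move=> r00 r10 hd hE hM.
have rb0 : (0 < r0 * b0)%N by rewrite muln_gt0 r00.
have rb1 : (0 < r1 * b1)%N by rewrite muln_gt0 r10.
have [p -> hp] := psucc_real hE.
apply: ge_ereal_sup => _ [u [alpha [N [u0 calpha hN ->]]]].
rewrite Re_sumZ.
pose val c1 v (g : lmap R (r0 * b0) (v * (c1 * b1))) (L : 'I_k -> 'M[C]_(v * c1 * r1)) : R :=
  \sum_ij lam ij * retr (tmap g (@idmap R (r1 * b1)) (rho ij)
    *m Defs.reindex (@reorder_idx v c1 b1 r1) (L ij.1 *t M ij.2)).
rewrite -[\sum_ij _]/(val a1' u (halfch alpha Phi2) N).
rewrite -EFinM; apply: real_sup_le => e e0; have [d d0 hde] := small_scale p e0.
have [Psi hPsi hb] := delta_test_bound hd d0.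
have cPsi := outputs_channel cPhi1 hPsi.
case: hPsi => u1 [pre [post [u10 cpre cpost PsiE]]].
have [N' hN' N'E] := @PM_absorb R _ _ _ _ b0 b1 r0 r1 u u1 k pre post Phi1 alpha N
  cpre cpost cPhi1.1 calpha hN.
exists (val a1 (u * u1)%N (halfch (comp_pre alpha pre) Phi1) N')%:E.
  exists (u * u1)%N, (comp_pre alpha pre), N'; split=> //.
  - by rewrite muln_gt0 u0.
  - exact: comp_pre_channel.
  - by congr (_%:E); apply/esym; exact: Re_sumZ.
have -> : val a1 (u * u1)%N (halfch (comp_pre alpha pre) Phi1) N' = val a1' u (halfch alpha Psi) N.
  by apply: eq_bigr => ij _; rewrite /retr -N'E PsiE.
have lD : linear (fun X => Phi2 X - Psi X) by exact: diff_linear.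
have hb' := halfch_test_bound calpha lD hb.
have c0 : 0 <= eps / 2 + d by rewrite addr_ge0 ?divr_ge0 // ltW.
have := discrimination_bound rb0 rb1 (@halfch_linear R _ _ _ _ _ _ alpha _) c0 hb' hE
  (reorder_measurement hN hM) hp.
rewrite -[X in X <= _ -> _]/(val a1' u (halfch alpha (fun X => Phi2 X - Psi X)) N).
have -> : val a1' u (halfch alpha (fun X => Phi2 X - Psi X)) N =
    val a1' u (halfch alpha Phi2) N - val a1' u (halfch alpha Psi) N.
  have -> : halfch alpha (fun X => Phi2 X - Psi X) =
      (fun X => halfch alpha Phi2 X - halfch alpha Psi X).
    by apply/funext => X; apply: halfchB; [exact: cPhi2.1|exact: cPsi.1].
  rewrite /val -sumrB; apply: eq_bigr => ij _; rewrite tmapB_id; try exact: halfch_linear.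
  by rewrite mulmxBl retrB mulrBr.
move: (val _ _ (halfch alpha Phi2) N) (val _ _ _ _) => x y.
by rewrite -EFinD lee_fin mulrDl; lra.
Qed.

Lemma channel_entry_le n m (f : lmap R n m) p q i j : channel f ->
  Re `|f (delta_mx p q) i j| <= n%:R.
Proof.
move=> cf; have [lf [cpf _]] := cf; have [_ [_ tpf]] := channel_tensid n cf.
rewrite -blk_Omega -tmap_idE //.
apply: le_trans (psd_entry_le _ _ (cpf _ _ (@Omega_psd R n))) _.
by rewrite tpf -tr_ptr ptr_Omega mxtrace1 -(rmorph_nat (real_complex R)).
Qed.

(** Exchanges the quantifiers between tests and outputs. Half of e pays for the choice of an output
    for each test, the other half for the approximate minimax theorem. *)
Lemma minimax_outputs (c : R) :
  (forall (T : 'M[C]_(a0' * b0 * (a1' * b1))) (e : R), testop T -> 0 < e ->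
    exists2 Psi, outputs1 Psi & pval T Phi2 - pval T Psi <= c + e) ->
  forall e : R, 0 < e ->
    exists2 Psi, outputs1 Psi & test_bound (fun X => Phi2 X - Psi X) (c + e).
Proof.
move=> hyp e e0.
set n := (a0' * b0)%N; set m := (a1' * b1)%N.
have n0 : (0 < n)%N by rewrite muln_gt0 a0'_gt0.
(* Choi matrices place the outputs in the matrix space of the test operators. Only the entry formula
   and the pairing are kept, so that the concrete definition stays folded. *)
have [ch [chE BE]] : exists ch : lmap R n m -> 'M[C]_(n * m),
    (forall f p i q j, ch f (ix (p, i)) (ix (q, j)) = Num.conj (f (delta_mx p q) i j)) /\
    (forall T f, channel f -> retr (T *m ch f) = pval T f).
  exists (fun f => choi (adjmap f)); split=> [f p i q j|T f cf]; first exact: choi_adjE.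
  exact: Re_pairing.
pose Y y := exists2 Psi, outputs1 Psi & y = ch Phi2 - ch Psi.
have {}BE T Psi : channel Psi -> retr (T *m (ch Phi2 - ch Psi)) = pval T Phi2 - pval T Psi.
  by move=> cPsi; rewrite mulmxBr retrB !BE.
have cX : convexp (@testop R n m).
  move=> t x y /andP[t0 t1] [hx [s hs hsx]] [hy [s' hs' hsy]].
  have t0C : 0 <= t%:C :> C by rewrite ler0c.
  have t1C : 0 <= (1 - t)%:C :> C by rewrite ler0c subr_ge0.
  split; first exact: psdD (psdZ t0C hx) (psdZ t1C hy).
  exists (t%:C *: s + (1 - t)%:C *: s').
    split; first by apply: psdD; apply: psdZ => //; [exact: hs.1|exact: hs'.1].
    by rewrite mxtraceD !mxtraceZ hs.2 hs'.2 !mulr1 -rmorphD /= addrC subrK.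
  have -> : (t%:C *: s + (1 - t)%:C *: s') *t 1%:M - (t%:C *: x + (1 - t)%:C *: y) =
      t%:C *: (s *t 1%:M - x) + (1 - t)%:C *: (s' *t 1%:M - y).
    by rewrite tensmxDl !tensmxZl !scalerBr opprD addrACA.
  exact: psdD (psdZ t0C hsx) (psdZ t1C hsy).
have cY : convexp Y.
  move=> t _ _ ht [P hP ->] [P' hP' ->].
  exists (fun X => t%:C *: P X + (1 - t)%:C *: P' X); first exact: outputs_convex.
  apply: mxtensP => p i q j.
  rewrite [LHS]mxDE !mxZE !mxDE !mxNE !chE.
  move: (Phi2 _ i j) (P _) (P' _) => x A A'; rewrite mxDE !mxZE.
  rewrite [Num.conj (_ + _)]rmorphD /= ![Num.conj (_ * _)]rmorphM /= !conj_RC.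
  by rewrite rmorphB rmorph1; ring.
have qX (x : 'M[C]_(n * m)) : testop x -> retr (x *m adjmx x) <= (n * m * (n * m))%:R * m%:R ^+ 2.
  move=> [hx [s hs hsx]]; apply: sqnorm_le => i j.
  apply: le_trans (psd_entry_le i j hx) _.
  have : 0 <= retr (s *t 1%:M - x) by exact: ge0_Re (psd_tr_ge0 hsx).
  rewrite retrB [retr (s *t _)]/retr tr_tens hs.2 mul1r mxtrace1 -(rmorph_nat (real_complex R)) /=.
  by rewrite subr_ge0.
have qY y : Y y -> retr (y *m adjmx y) <= (n * m * (n * m))%:R * (n%:R + n%:R) ^+ 2.
  move=> [Psi hPsi ->]; apply: sqnorm_le => x y'.
  case: (mxtens_indexP x) => p i; case: (mxtens_indexP y') => q j.
  rewrite mxDE mxNE !chE -rmorphB norm_conjC.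
  have := ler_normB (Phi2 (delta_mx p q) i j) (Psi (delta_mx p q) i j).
  rewrite lecE => /andP[_]; rewrite ReD => /le_trans; apply.
  by apply: lerD; apply: channel_entry_le => //; exact: outputs_channel hPsi.
pose D : R := (n * m * (n * m))%:R * m%:R ^+ 2 + (n * m * (n * m))%:R * (n%:R + n%:R) ^+ 2.
have D1 : (n * m * (n * m))%:R * m%:R ^+ 2 <= D by rewrite lerDl mulr_ge0 // sqr_ge0.
have D2 : (n * m * (n * m))%:R * (n%:R + n%:R) ^+ 2 <= D by rewrite lerDr mulr_ge0 // sqr_ge0.
have [Psi0 hPsi0] := @outputs_exist a0 a1 a0' a1' b0 b1 Phi1 a0_gt0 a1'_gt0.
have t0 : testop (0 : 'M[C]_(n * m)).
  split; first exact: psd0.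
  have n1 : n%:R != 0 :> C by rewrite pnatr_eq0 -lt0n.
  have hs : psd (n%:R^-1 *: 1%:M : 'M[C]_n) by apply: psdZ; [rewrite invr_ge0|exact: psd1].
  exists (n%:R^-1 *: 1%:M); first by split=> //; rewrite mxtraceZ mxtrace1 mulVf.
  by rewrite subr0; apply: psd_tens => //; exact: psd1.
have e2 : 0 < e / 2 by lra.
have [] := @minimax R (n * m) (@testop R n m) Y D (c + e / 2) (e / 2)
  0 (ch Phi2 - ch Psi0) cX cY
  (fun x hx => le_trans (qX x hx) D1) (fun y hy => le_trans (qY y hy) D2)
  e2 t0 (ex_intro2 _ _ Psi0 hPsi0 (erefl _)).
  move=> T hT; have [Psi hPsi h] := hyp T _ hT e2.
  exists (ch Phi2 - ch Psi); first by exists Psi.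
  by rewrite BE //; exact: outputs_channel hPsi.
move=> _ [Psi hPsi ->] h; exists Psi => //; have cPsi := outputs_channel cPhi1 hPsi.
apply: testop_bound; first exact: diff_linear.
move=> T hT; rewrite pvalB; [|exact: cPhi2.1|exact: cPsi.1].
have := h _ hT; rewrite BE //; move: (pval T Phi2) (pval T Psi) => x y; lra.
Qed.

Lemma pvalZ n m (f : lmap R n m) (t : R) X : pval (t%:C *: X) f = t * pval X f.
Proof. by rewrite /pval (linZ (@tmap_linear R _ _ _ _ f _)) -scalemxAl retrZ. Qed.

(** The step shared by (ii) and (iii): a nonzero test is divided by its trace, giving a state
    dominated by t s (x) 1 with t = 1 / Tr T. The required inequality scales back to eps/2 + e; for
    T = 0 any output will do. *)
Lemma testop_reduce (T : 'M[C]_(a0' * b0 * (a1' * b1))) (e : R) :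
  (forall (rho : 'M[C]_(a0' * b0 * (a1' * b1))) (s : 'M[C]_(a0' * b0)) (t d : R),
     density rho -> density s -> 0 < t -> 0 < d -> psd (t%:C *: (s *t 1%:M) - rho) ->
     exists2 Psi, outputs1 Psi & pval rho Phi2 - pval rho Psi <= eps / 2 * t + d) ->
  testop T -> 0 < e ->
  exists2 Psi, outputs1 Psi & pval T Phi2 - pval T Psi <= eps / 2 + e.
Proof.
move=> h [hT [s hs hsT]] e0.
have t0 : 0 <= Re (\tr T) by exact/ge0_Re/psd_tr_ge0.
have [T1|tn0] := eqVneq (Re (\tr T)) 0.
  have [Psi0 hPsi0] := @outputs_exist a0 a1 a0' a1' b0 b1 Phi1 a0_gt0 a1'_gt0.
  exists Psi0 => //; have -> : T = 0%:C *: T by rewrite scale0r (psd_tr0 hT T1).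
  by rewrite !pvalZ !mul0r subr0 addr_ge0 ?divr_ge0 // ltW.
have tp : 0 < Re (\tr T) by rewrite lt_def tn0.
set t := Re (\tr T) in t0 tn0 tp *.
pose rho := (t^-1)%:C *: T.
have tC : 0 <= (t^-1)%:C :> C by rewrite ler0c invr_ge0.
have hrho : density rho.
  split; first exact: psdZ.
  by rewrite mxtraceZ (ge0_ReE (psd_tr_ge0 hT)) -/t -rmorphM /= mulVf.
have hd : psd ((t^-1)%:C *: (s *t 1%:M) - rho).
  by rewrite -scalerBr; exact: psdZ.
have ti : 0 < t^-1 by rewrite invr_gt0.
have [Psi hPsi hb] := h rho s t^-1 (e / t) hrho hs ti (divr_gt0 e0 tp) hd.
exists Psi => //; move: hb; rewrite /rho !pvalZ -mulrBr -mulrDl.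
by rewrite mulrC ler_pM2r.
Qed.

Lemma cond_ii_i :
  (forall rho : 'M[C]_((a0' * b0) * (a1' * b1)), density rho ->
    (@sup_pairing R a0' a1' a0' a1' b0 b1 rho Phi2
     <= @sup_pairing R a0 a1 a0' a1' b0 b1 rho Phi1 + (eps / 2)%:E * dual_dnorm rho)%E) ->
  (deltaAA Phi1 Phi2 <= eps%:E)%E.
Proof.
move=> hii; apply/test_bound_delta/minimax_outputs => T e hT e0.
apply: testop_reduce hT e0 => {T e} rho s t d hrho hs t0 d0 hd.
(* [Phi2] is its own output under the trivial superchannel, which is possible because R has the
   dimensions of A'. *)
have h1 : ((pval rho Phi2)%:E <= @sup_pairing R a0' a1' a0' a1' b0 b1 rho Phi2)%E.
  apply: ereal_sup_ubound; exists Phi2; rewrite Re_pairing //; split=> //.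
  exact: outputs_self.
(* A channel pairs with s (x) 1 to Tr s = 1, so domination by t s (x) 1 bounds the dual norm by
   t. *)
have h2 : ((eps / 2)%:E * dual_dnorm rho <= (eps / 2 * t)%:E)%E.
  rewrite [X in (_ <= X)%E]EFinM; apply: lee_wpmul2l; first by rewrite lee_fin divr_ge0.
  apply: ge_ereal_sup => _ [f [cf ->]]; rewrite lee_fin Re_pairing //.
  have [w [hw w1 wE]] := channel_choi cf; rewrite /pval /retr wE -/(retr (rho *m w)).
  have := retr_psd_ge0 hd hw; rewrite mulmxBl -scalemxAl retrB retrZ.
  have -> : retr ((s *t 1%:M) *m w) = 1 by rewrite /retr tr_ptrM w1 mulmx1 hs.2.
  by rewrite mulr1 subr_ge0.
have h3 := le_trans h1 (le_trans (hii _ hrho) (leeD2l _ h2)).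
have [_ [Psi [hPsi ->]]] := ereal_sup_slack d0 h3.
rewrite lte_fin Re_pairing; last exact: outputs_channel hPsi.
move=> h; exists Psi => //; move: h.
by move: (pval rho Phi2) (pval rho Psi) => x y; lra.
Qed.

Lemma rescale_bound (z x y t d b : R) : 0 < z ->
  z * x - b * (z * t) - z * d < z * y -> x - y <= b * t + d.
Proof. by move=> z0 h; rewrite -(ler_pM2l z0); lra. Qed.

Lemma cond_iii_i :
  (forall (k l : nat) (lam : 'I_k * 'I_l -> R)
     (rho : 'I_k * 'I_l -> 'M[C]_((a0' * b0) * (a1' * b1)))
     (M : 'I_l -> 'M[C]_(b1 * b1)),
     ensemble lam rho -> measurement M ->
     (@PM R a0' a1' b0 b1 a0' a1' k l Phi2 M lam rho
      <= @PM R a0 a1 b0 b1 a0' a1' k l Phi1 M lam rho + (eps / 2)%:E * psucc lam rho)%E) ->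
  (deltaAA Phi1 Phi2 <= eps%:E)%E.
Proof.
move=> hiii; apply/test_bound_delta/minimax_outputs => T e hT e0.
apply: testop_reduce hT e0 => {T e} rho s t d hrho hs t0 d0 hd.
have [k [U dU]] := @unitary_design R a1' a1'_gt0.
have [l [V dV]] := @unitary_design R b1 b1_gt0.
have z0 := game_scale_gt0 dU dV a1'_gt0 b1_gt0.
have hE := game_ensemble dU dV hrho.
have hM := game_M_measurement dV b1_gt0.
set z := game_scale R b1 a1' k l in z0.
(* The trivial superchannel is written with explicit pre- and postprocessing, so that [game_lower]
   can turn the latter into a measurement. *)
have [u [pre [post [u0 cpre cpost PhiE]]]] := outputs_self cPhi2.
have [N hN NE] := @game_lower R _ _ b0 b1 _ a1' k l U V rho dU dV a1'_gt0 u pre post Phi2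
  cpre.1 cpost cPhi2.1.
have h1 : ((z * pval rho Phi2)%:E <= @PM R a0' a1' b0 b1 a0' a1' k l Phi2
    (game_M V) (@game_lam R k l) (game_rho U V rho))%E.
  apply: ereal_sup_ubound; exists u, pre, N; split=> //.
  by rewrite [in LHS]PhiE -NE.
have h2 : ((eps / 2)%:E * psucc (@game_lam R k l) (game_rho U V rho)
    <= (eps / 2 * (z * t))%:E)%E.
  rewrite [X in (_ <= X)%E]EFinM; apply: lee_wpmul2l; first by rewrite lee_fin divr_ge0.
  apply: ge_ereal_sup => _ [M' [hM' ->]]; rewrite lee_fin.
  exact: game_psucc (ltW t0) hd hs.2 hM'.
have h3 := le_trans h1 (le_trans (hiii _ _ _ _ _ hE hM) (leeD2l _ h2)).
have [_ [u' [alpha [N' [u0' calpha hN' ->]]]]] := ereal_sup_slack (mulr_gt0 z0 d0) h3.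
(* An almost optimal strategy for [Phi1] becomes an output of [Phi1] with value scaled by z;
   dividing by z > 0 finishes. *)
have [post' cpost' vE] := @game_upper R _ _ b0 b1 _ a1' k l U V rho dU dV a1'_gt0 u' alpha
  Phi1 N' calpha.1 cPhi1.1 hN'.
rewrite vE lte_fin -/z => h; exists (supch_apply alpha post' Phi1).
  by exists u', alpha, post'.
exact: rescale_bound z0 h.
Qed.

End Equivalence.
End Main.

Theorem theorem8 (R : realType) (a0 a1 a0' a1' b0 b1 : nat)
  (Phi1 : lmap R (a0 * b0) (a1 * b1)) (Phi2 : lmap R (a0' * b0) (a1' * b1))
  (eps : R) :
  (0 < a0)%N -> (0 < a1)%N -> (0 < a0')%N -> (0 < a1')%N ->
  (0 < b0)%N -> (0 < b1)%N ->
  channel Phi1 -> channel Phi2 -> 0 <= eps ->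
  let cond_i := (deltaAA Phi1 Phi2 <= eps%:E)%E in
  let cond_ii (r0 r1 : nat) :=
    forall rho : 'M[R[i]]_((r0 * b0) * (r1 * b1)), density rho ->
      (@sup_pairing R a0' a1' r0 r1 b0 b1 rho Phi2
       <= @sup_pairing R a0 a1 r0 r1 b0 b1 rho Phi1
          + (eps / 2)%:E * dual_dnorm rho)%E in
  let cond_iii (r0 r1 : nat) :=
    forall (k l : nat) (lam : 'I_k * 'I_l -> R)
           (rho : 'I_k * 'I_l -> 'M[R[i]]_((r0 * b0) * (r1 * b1)))
           (M : 'I_l -> 'M[R[i]]_(b1 * b1)),
      ensemble lam rho -> measurement M ->
      (@PM R a0' a1' b0 b1 r0 r1 k l Phi2 M lam rho
       <= @PM R a0 a1 b0 b1 r0 r1 k l Phi1 M lam rho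
          + (eps / 2)%:E * psucc lam rho)%E in
  [/\ cond_i <-> (forall r0 r1 : nat, (0 < r0)%N -> (0 < r1)%N -> cond_ii r0 r1),
      cond_i <-> (forall r0 r1 : nat, (0 < r0)%N -> (0 < r1)%N -> cond_iii r0 r1),
      cond_i <-> cond_ii a0' a1'
    & cond_i <-> cond_iii a0' a1'].
Proof.
move=> p0 p1 p0' p1' q0 q1 c1 c2 e0 cond_i cond_ii cond_iii.
have i_ii r0 r1 : (0 < r0)%N -> (0 < r1)%N -> cond_i -> cond_ii r0 r1.
  by move=> h0 h1 hi rho hr; exact: cond_i_ii.
have i_iii r0 r1 : (0 < r0)%N -> (0 < r1)%N -> cond_i -> cond_iii r0 r1.
  by move=> h0 h1 hi k l lam rho M hE hM; exact: cond_i_iii.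
have ii_i : cond_ii a0' a1' -> cond_i by exact: cond_ii_i.
have iii_i : cond_iii a0' a1' -> cond_i by exact: cond_iii_i.
split; split; auto.
Qed.
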